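(* Let $\gamma,\kappa>0$, let $A:\mathbb{R}^n\to\mathbb{R}$ be a $\gamma$-function and $V:\mathbb{R}^n\to\mathbb{R}$ a $\kappa$-function, and let $q>0$ be such that $q+V(x)+A(\xi)\ge 1$ for all $x,\xi\in\mathbb{R}^n$. Assume: (C1) $A,V$ are $C^\infty$ functions on $\mathbb{R}^n$ and the function $(x,\xi)\mapsto A(\xi)+V(x)$ belongs to $\Sigma^1_{A,V}$; (C2) there exist $\delta>0$, $C>0$ such that $q+V(x)+A(\xi)\ge C(1+|x|+|\xi|)^\delta$ for all $x,\xi\in\mathbb{R}^n$; (C3) $\mu>0$ is such that $\int_{\mathbb{R}^n}\int_{\mathbb{R}^n}(q+V(x)+A(\xi))^{-\mu}\,dx\,d\xi<\infty$. Let $r\ge\mu$. Then for every $L\in\mathbb{N}$ there exists $L_0\in\mathbb{N}$ such that $$L\,j^{\frac1r}\le\lambda_j(A(D)+V(x))\quad\text{for all } j\ge L_0 .$$ In other words, the eigenvalues $\lambda_j(A(D)+V(x))$ have growth of order at least $j^{1/r}$ as $j\to\infty$.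
   Context: $\tau$-functions: a continuous function $\Gamma:\mathbb{R}^n\to\mathbb{R}$ is a $\tau$-function ($\tau>0$) if there is $q_0>0$ such that (a) $\Gamma(x)+\frac{q_0}{4}>0$ for all $x\in\mathbb{R}^n$; and (b) there are $C_1>0$, $R>0$ with $C_1\big|(\frac{q_0}{2}+\Gamma(x))^{\frac1{2\tau}}-(\frac{q_0}{2}+\Gamma(y))^{\frac1{2\tau}}\big|\le |x-y|$ for all $|x|,|y|\ge R$. For $m\in\mathbb{R}$, $\Sigma^m_{A,V}$ is the set of $a\in C^\infty(\mathbb{R}^n\times\mathbb{R}^n)$ such that for all multi-indices $\alpha,\beta$ there is $C_{\alpha\beta}$ with $|\partial_x^\beta\partial_\xi^\alpha a(x,\xi)|\le C_{\alpha\beta}(q+V(x)+A(\xi))^{m-\frac{|\beta|}{2\kappa}-\frac{|\alpha|}{2\gamma}}$ for all $x,\xi\in\mathbb{R}^n$. $A(D)$ is the Fourier multiplier $A(D)u(x)=(2\pi)^{-n}\int e^{ix\cdot\xi}A(\xi)\hat u(\xi)\,d\xi$, $V(x)$ is multiplication by $V$, and $A(D)+V(x)$ is understood as the self-adjoint operator on $L^2(\mathbb{R}^n)$ determined by its action on Schwartz functions. $\lambda_j(A(D)+V(x))$, $j=1,2,\dots$, are its eigenvalues, counted with multiplicity, in non-decreasing order. *)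

(* Defs.v *)
From HB Require Import structures.
From mathcomp Require Import all_boot all_order all_algebra.
From mathcomp Require Import complex.
From mathcomp Require Import all_classical all_reals all_analysis.

Set Implicit Arguments.
Unset Strict Implicit.
Unset Printing Implicit Defensive.

Import Order.TTheory GRing.Theory Num.Theory.
Import numFieldNormedType.Exports.

Local Open Scope classical_set_scope.
Local Open Scope ring_scope.

Section measurable_rV.
Context {R : realType} (n : nat).

Let coord (i : 'I_n) (x : 'rV[R]_n) : R := x ord0 i.

Let rV_set0 : g_sigma_preimage coord set0.
Proof. exact: sigma_algebra0. Qed.

Let rV_setC A : g_sigma_preimage coord A -> g_sigma_preimage coord (~` A).
Proof. exact: sigma_algebraC. Qed.

Let rV_bigcup (F : (set _)^nat) : (forall i, g_sigma_preimage coord (F i)) ->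
  g_sigma_preimage coord (\bigcup_i F i).
Proof. exact: sigma_algebra_bigcup. Qed.

(* The sigma-algebra generated by the coordinates, i.e. the Borel sets. *)
HB.instance Definition _ :=
  @isMeasurable.Build (measure_tuple_display default_measure_display)
    'rV[R]_n (g_sigma_preimage coord) rV_set0 rV_setC rV_bigcup.

End measurable_rV.

Definition cons_rV {R : realType} (n : nat)
  (p : measurableTypeR R * 'rV[R]_n) : 'rV[R]_n.+1 :=
  \row_(i < n.+1) if unlift ord0 i is Some j then p.2 ord0 j else p.1.

Lemma measurable_coord {R : realType} (n : nat) (i : 'I_n) :
  measurable_fun setT (fun x : 'rV[R]_n => x ord0 i).
Proof.
move=> _ Y mY; rewrite setTI; apply: sub_sigma_algebra => /=.
rewrite -bigcup_seq/=; exists i => /=; first by rewrite mem_index_enum.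
by exists Y => //; rewrite setTI.
Qed.

Lemma measurable_cons_rV {R : realType} (n : nat) :
  measurable_fun setT (@cons_rV R n).
Proof.
pose coord i (x : 'rV[R]_n.+1) : R := x ord0 i.
have mc i : measurable_fun setT (coord i \o @cons_rV R n).
  case: (unliftP ord0 i) => [j|] ->.
  - rewrite (_ : _ \o _ = (fun x : 'rV[R]_n => x ord0 j) \o snd).
      by apply: measurableT_comp => //; exact: measurable_coord.
    by apply/funext => p /=; rewrite /coord mxE liftK.
  - rewrite (_ : _ \o _ = fst) //.
    by apply/funext => p /=; rewrite /coord mxE unlift_none.
have sub : g_sigma_preimage coord `<=`
    image_set_system setT (@cons_rV R n) measurable.
  apply: smallest_sub.
    exact/sigma_algebra_image/sigma_algebra_measurable.
  rewrite -bigcup_seq; apply: bigcup_sub => i _ A [B mB <-].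
  by rewrite /image_set_system /= !setTI -comp_preimage -[X in measurable X]setTI;
    exact: mc.
by move=> _ A /sub; rewrite /image_set_system /= setTI.
Qed.

Section lebesgue_step.
Context {R : realType} (n : nat).
Variable mu : {sigma_finite_measure set 'rV[R]_n -> \bar R}.

Let prod_mu : {measure set (measurableTypeR R * 'rV[R]_n)%type -> \bar R} :=
  ((@lebesgue_measure R) \x mu)%E.

Definition lebesgue_step : set 'rV[R]_n.+1 -> \bar R :=
  pushforward prod_mu (@cons_rV R n).

Let step0 : lebesgue_step set0 = 0%E.
Proof. by rewrite /lebesgue_step /pushforward preimage_set0 measure0. Qed.

Let step_ge0 A : (0 <= lebesgue_step A)%E.
Proof. exact: (measure_ge0 prod_mu). Qed.

Let step_sigma_additive : semi_sigma_additive lebesgue_step.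
Proof.
move=> F mF tF mUF; rewrite /lebesgue_step /pushforward preimage_bigcup.
apply: measure_semi_sigma_additive.
- by move=> k; rewrite -[X in measurable X]setTI; exact: measurable_cons_rV.
- apply/trivIsetP => /= i j _ _ ij; rewrite -preimage_setI.
  by move/trivIsetP : tF => /(_ _ _ _ _ ij) ->//; rewrite preimage_set0.
- by rewrite -preimage_bigcup -[X in measurable X]setTI; exact: measurable_cons_rV.
Qed.

HB.instance Definition _ := isMeasure.Build _ _ _
  lebesgue_step step0 step_ge0 step_sigma_additive.

Let step_sigma_finite : sigma_finite setT lebesgue_step.
Proof.
pose tl (x : 'rV[R]_n.+1) : 'rV[R]_n := \row_i x ord0 (lift ord0 i).
pose uncons (x : 'rV[R]_n.+1) : measurableTypeR R * 'rV[R]_n :=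
  (x ord0 ord0, tl x).
have mtl : measurable_fun setT tl.
  have sub : g_sigma_preimage (fun i (x : 'rV[R]_n) => x ord0 i : R) `<=`
      image_set_system setT tl measurable.
    apply: smallest_sub.
      exact/sigma_algebra_image/sigma_algebra_measurable.
    rewrite -bigcup_seq; apply: bigcup_sub => i _ A [B mB <-].
    rewrite /image_set_system /= !setTI -comp_preimage.
    rewrite (_ : _ \o _ = fun x : 'rV[R]_n.+1 => x ord0 (lift ord0 i)).
      by rewrite -[X in measurable X]setTI; exact: measurable_coord.
    by apply/funext => x /=; rewrite mxE.
  by move=> _ A /sub; rewrite /image_set_system /= setTI.
have muncons : measurable_fun setT uncons.
  by apply/measurable_fun_pairP; split => //; exact: measurable_coord.
have consK p : uncons (cons_rV p) = p.
  case: p => a x; rewrite /uncons /cons_rV /tl mxE unlift_none /=.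
  by congr pair; apply/rowP => i; rewrite !mxE liftK.
have [F FT Ffin] : sigma_finite setT prod_mu.
  have /sigma_finiteP[F [TF ndF Foo]] := sigma_finiteT (@lebesgue_measure R).
  have /sigma_finiteP[G [TG ndG Goo]] := sigma_finiteT mu.
  exists (fun k => F k `*` G k).
    rewrite -setXTT TF TG predeqE => -[x y]; split.
      move=> [/= [k _ Fkx] [l _ Gly]]; exists (maxn k l) => //; split.
      - by move: x Fkx; exact/subsetPset/ndF/leq_maxl.
      - by move: y Gly; exact/subsetPset/ndG/leq_maxr.
    by move=> [k _ []/= ? ?]; split; exists k.
  move=> k; have [? ?] := Foo k; have [? ?] := Goo k.
  split; first exact: measurableX.
  by rewrite /= product_measure1E// lte_mul_pinfty// ge0_fin_numE.
exists (fun k => uncons @^-1` F k).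
  by rewrite -preimage_bigcup -FT preimage_setT.
move=> k; have [mF Fk] := Ffin k; split.
  by rewrite -[X in measurable X]setTI; exact: muncons.
rewrite /lebesgue_step /pushforward -comp_preimage.
by rewrite (_ : _ \o _ = id) //; apply/funext => p /=.
Qed.

HB.instance Definition _ := Measure_isSigmaFinite.Build _ _ _
  lebesgue_step step_sigma_finite.

End lebesgue_step.

(* lebesgue_step mu is the image of dx \x mu under (x, y) |-> (x, y_1, .., y_n);
   the recursion starts with the unit mass on the one-point space R^0. *)
Fixpoint lebesgue_rV {R : realType} (n : nat) :
    {sigma_finite_measure set 'rV[R]_n -> \bar R} :=
  if n is m.+1 then lebesgue_step (lebesgue_rV m)
  else @dirac _ 'rV[R]_0 0 R.

Section euclidean.
Context {R : realType} {n : nat}.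
Implicit Types x y : 'rV[R]_n.

Definition dotv x y : R := \sum_(i < n) x ord0 i * y ord0 i.

(* The library norm on 'rV is the sup norm. *)
Definition enorm x : R := Num.sqrt (dotv x x).

End euclidean.

Section smooth.
Context {R : realType} {n : nat}.
Implicit Types (f : 'rV[R]_n -> R) (al be : 'I_n -> nat).

Definition partial (i : 'I_n) f : 'rV[R]_n -> R :=
  fun x => 'D_(delta_mx ord0 i) f x.

Definition smooth f : Prop := forall s : seq 'I_n,
  let g := foldr partial f s in
  continuous g /\ forall (i : 'I_n) x, derivable g x (delta_mx ord0 i).

Definition mdeg al : nat := (\sum_(i < n) al i)%N.

Definition mderiv al f : 'rV[R]_n -> R :=
  foldr (fun i => iter (al i) (partial i)) f (enum 'I_n).

Definition schwartzR f : Prop := smooth f /\ forall al be, exists C : R,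
  forall x : 'rV[R]_n, `|(\prod_(i < n) x ord0 i ^+ al i) * mderiv be f x| <= C.

End smooth.

Section symbols.
Context {R : realType} {n : nat}.
Implicit Types (A V Gam : 'rV[R]_n -> R) (a : 'rV[R]_n -> 'rV[R]_n -> R).

Definition tau_function (tau : R) Gam : Prop :=
  [/\ 0 < tau, continuous Gam & exists2 q0 : R, 0 < q0 &
    (forall x, 0 < Gam x + q0 / 4) /\
    exists C1 M : R, [/\ 0 < C1, 0 < M &
      forall x y, M <= enorm x -> M <= enorm y ->
        C1 * `|(q0 / 2 + Gam x) `^ (1 / (2 * tau))
               - (q0 / 2 + Gam y) `^ (1 / (2 * tau))| <= enorm (x - y)]].

(* Smoothness of a function of (x, xi), as a function on R^(n + n). *)
Definition smooth2 a : Prop :=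
  smooth (fun z : 'rV[R]_(n + n) => a (lsubmx z) (rsubmx z)).

Definition mderiv2 (be al : 'I_n -> nat) a (x xi : 'rV[R]_n) : R :=
  mderiv be (fun x' => mderiv al (a x') xi) x.

Definition symbol_class (gam kap q : R) A V (m : R) a : Prop :=
  smooth2 a /\
  forall al be : 'I_n -> nat, exists C : R, forall x xi,
    `|mderiv2 be al a x xi| <=
      C * (q + V x + A xi) `^
            (m - (mdeg be)%:R / (2 * kap) - (mdeg al)%:R / (2 * gam)).

End symbols.

Section operators.
Context {R : realType} {n : nat}.
Local Notation C := R[i].
Local Notation mu := (@lebesgue_rV R n).
Implicit Types (u v f g : 'rV[R]_n -> C) (A V : 'rV[R]_n -> R).

Definition cintegral u : C :=
  Complex (\int[mu]_x complex.Re (u x)) (\int[mu]_x complex.Im (u x)).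

Definition expi (t : R) : C := Complex (cos t) (sin t).

Definition schwartz u : Prop :=
  schwartzR (fun x => complex.Re (u x)) /\
  schwartzR (fun x => complex.Im (u x)).

Definition fourier u (xi : 'rV[R]_n) : C :=
  cintegral (fun x => expi (- dotv x xi) * u x).

Definition multiplier A u (x : 'rV[R]_n) : C :=
  real_complex R ((2 * pi) ^- n) *
  cintegral (fun xi => expi (dotv x xi) * real_complex R (A xi) * fourier u xi).

Definition AD_plus_V A V u : 'rV[R]_n -> C :=
  fun x => multiplier A u x + real_complex R (V x) * u x.

(* Elements of L^2(R^n) are represented by square-integrable functions, read
   modulo a.e. equality; unbounded operators are represented by their graphs. *)

Definition ae_eqC u v : Prop := {ae mu, forall x, u x = v x}.

Definition L2norm u : \bar R :=
  Lnorm mu 2%:E (fun x => (Normc.normc (u x))%:E).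

Definition L2 u : Prop :=
  [/\ measurable_fun setT (fun x => complex.Re (u x)),
      measurable_fun setT (fun x => complex.Im (u x)) & (L2norm u < +oo)%E].

Definition inner u v : C := cintegral (fun x => u x * conjc (v x)).

Implicit Type H : ('rV[R]_n -> C) -> ('rV[R]_n -> C) -> Prop.

(* The graph of H is the graph of its adjoint and the domain is dense; this
   forces H to be linear and single-valued modulo a.e. equality. *)
Definition selfadjoint H : Prop :=
  [/\ forall u f, H u f -> L2 u /\ L2 f,
      forall w, L2 w -> forall e : R, 0 < e ->
        exists u f, H u f /\ (L2norm (fun x => w x - u x)%R < e%:E)%E
    & forall v g, L2 v -> L2 g ->
        (H v g <-> forall u f, H u f -> inner f v = inner u g)].

Definition closure_on_schwartz (P : ('rV[R]_n -> C) -> ('rV[R]_n -> C)) u f :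
    Prop :=
  [/\ L2 u, L2 f & exists phi : nat -> 'rV[R]_n -> C,
    [/\ forall k, schwartz (phi k),
        L2norm (fun x => phi k x - u x) @[k --> \oo] --> 0%E
      & L2norm (fun x => P (phi k) x - f x) @[k --> \oo] --> 0%E]].

(* A symmetric operator on Schwartz functions has a unique self-adjoint extension
   exactly when its closure is self-adjoint; the extension is then the closure. *)
Definition selfadjoint_determined_by P H : Prop :=
  selfadjoint H /\ forall u f, H u f <-> closure_on_schwartz P u f.

Definition eigenfunction H (E : R) u : Prop :=
  H u (fun x => real_complex R E * u x).

(* dim ker (H - E) = m; E is an eigenvalue when m > 0. *)
Definition multiplicity H (E : R) (m : nat) : Prop :=
  exists e : 'I_m -> 'rV[R]_n -> C,
    [/\ forall i, eigenfunction H E (e i),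
        forall c : 'I_m -> C,
          ae_eqC (fun x => \sum_(i < m) c i * e i x) (fun=> 0) ->
          forall i, c i = 0
      & forall u, eigenfunction H E u ->
          exists c : 'I_m -> C, ae_eqC u (fun x => \sum_(i < m) c i * e i x)].

(* lam 1 <= lam 2 <= .. lists the eigenvalues of H, each E being repeated
   dim ker (H - E) times; lam 0 is irrelevant. *)
Definition eigenvalue_sequence H (lam : nat -> R) : Prop :=
  (forall i j : nat, (1 <= i)%N -> (i <= j)%N -> lam i <= lam j) /\
  forall E : R, exists2 m : nat, multiplicity H E m &
    ([set j : nat | (1 <= j)%N /\ lam j = E] #= `I_m)%card.

End operators.

(* Main.v *)
From HB Require Import structures.
Require Import Defs.
From mathcomp Require Import all_boot all_order all_algebra.
From mathcomp Require Import complex.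
From mathcomp Require Import all_classical all_reals all_analysis.
From mathcomp Require Import measurable_realfun.
From mathcomp Require Import ring lra zify.

Set Implicit Arguments.
Unset Strict Implicit.
Unset Printing Implicit Defensive.

Import Order.TTheory GRing.Theory Num.Theory.
Import numFieldNormedType.Exports.

Local Open Scope classical_set_scope.
Local Open Scope ring_scope.

(* Put a(x, xi) = q + V(x) + A(xi).  Up to constants q1 and q2, the quadratic form
   of P = A(D) + V is the sum of the mean of V over |u|^2 and the mean of A over
   |hat u|^2.  Hence, if u is a normalized eigenfunction whose eigenvalue is much
   smaller than Lam, most of u lives on E = {V + q1 <= Lam} and most of hat u on
   F = {A + q2 <= Lam}: the mass of the Fourier transform of 1_E u over F is bounded
   below.  For xi fixed, that transform is the inner product of u with a function
   of norm |E|^(1/2), so Bessel's inequality for J orthonormal eigenfunctions with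
   eigenvalues well below Lam gives J <= C |E| |F|.  The rectangle E x F lies in
   {a <= 2 Lam}, and the integrability of a^(-mu) forces the volume of that set to
   be o(Lam^mu), by dominated convergence.  The eigenvalues therefore grow faster
   than any multiple of j^(1/mu).

   Only inequalities are needed from Plancherel's theorem; they come from
   damping the frequency integral by exp(-c |xi_i|), whose transform is the
   (tensor) Poisson kernel. *)

(** * Integrals of real functions *)

(** The obstacle is that the quadratic form can be computed only on Schwartz functions, where the
    multiplier integral converges absolutely, whereas an eigenfunction is only a limit of such
    functions in the graph norm. The quantity carried through the argument is therefore the mass
    over F of the Fourier transform of 1_E u. It is continuous for the L^2 norm because E and F have
    finite volume, so a lower bound proved for Schwartz approximations survives in the limit. On
    Schwartz functions an exchange of two integrals identifies the form, and Fourier inversion is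
    never invoked. The lower Plancherel bound is applied to the Schwartz function itself, which is
    continuous and bounded; the upper bound must also cover its discontinuous restrictions to E and
    to the complement of E. That A and V may be integrated against rapidly decreasing functions
    comes from the Lipschitz condition on tau-functions, which forces polynomial growth. *)

Section real_integral.
Context {d : measure_display} {T : measurableType d} {R : realType}.
Variable mu : {measure set T -> \bar R}.
Implicit Types f g : T -> R.

(** [Rintegral] reads an infinite integral as 0, so the linearity and order rules below all carry
    this hypothesis. *)
Definition L1 f : Prop := mu.-integrable setT (EFin \o f).

Lemma L1_measurable f : L1 f -> measurable_fun setT f.
Proof. by move=> /(@measurable_int _ _ _ mu) /measurable_EFinP. Qed.

Lemma L1_le f g : measurable_fun setT f -> (forall x, `|f x| <= g x) ->
  L1 g -> L1 f.
Proof.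
move=> mf fg; apply: le_integrable => //; first exact/measurable_EFinP.
by move=> x _ /=; rewrite lee_fin (le_trans (fg x))// ler_norm.
Qed.

Lemma L1_lt_pinfty f : measurable_fun setT f -> (forall x, 0 <= f x) ->
  (\int[mu]_x (f x)%:E < +oo)%E -> L1 f.
Proof.
move=> mf f0 foo; apply/integrableP; split; first exact/measurable_EFinP.
by under eq_integral => x _ do rewrite gee0_abs ?lee_fin//.
Qed.

Lemma L1D f g : L1 f -> L1 g -> L1 (fun x => f x + g x).
Proof. by move=> lf lg; exact: (integrableD measurableT lf lg). Qed.

Lemma L1B f g : L1 f -> L1 g -> L1 (fun x => f x - g x).
Proof. by move=> lf lg; exact: (integrableB measurableT lf lg). Qed.

Lemma L1Z c f : L1 f -> L1 (fun x => c * f x).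
Proof. by move=> lf; exact: (integrableZl measurableT c lf). Qed.

Lemma L1_norm f : L1 f -> L1 (fun x => `|f x|).
Proof. by move=> lf; exact: integrable_norm. Qed.

Lemma L1_sum (I : Type) (s : seq I) (P : pred I) (F : I -> T -> R) :
  (forall i, L1 (F i)) -> L1 (fun x => \sum_(i <- s | P i) F i x).
Proof.
move=> lF; have := @integrable_sum _ _ _ mu setT measurableT I s P
  (fun i => EFin \o F i) (fun i _ => lF i).
by apply: eq_integrable => // x _ /=; rewrite sumEFin.
Qed.

Lemma L1_bounded f g (M : R) : L1 f -> measurable_fun setT g ->
  (forall x, `|g x| <= M) -> L1 (fun x => f x * g x).
Proof.
move=> lf mg gM; apply: (@L1_le _ (fun x => M * `|f x|)).
- by apply: measurable_funM => //; exact: L1_measurable.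
- by move=> x; rewrite normrM mulrC ler_wpM2r.
- exact/L1Z/L1_norm.
Qed.

Lemma EFin_Rintegral f : L1 f ->
  (\int[mu]_x (f x)%:E)%E = (\int[mu]_x f x)%:E.
Proof. by move=> lf; rewrite fineK//; exact: integrable_fin_num. Qed.

Lemma RintD f g : L1 f -> L1 g ->
  \int[mu]_x (f x + g x) = \int[mu]_x f x + \int[mu]_x g x.
Proof. exact: RintegralD. Qed.

Lemma RintB f g : L1 f -> L1 g ->
  \int[mu]_x (f x - g x) = \int[mu]_x f x - \int[mu]_x g x.
Proof. exact: RintegralB. Qed.

Lemma RintZ c f : L1 f -> \int[mu]_x (c * f x) = c * \int[mu]_x f x.
Proof. by move=> lf; exact: RintegralZl. Qed.

Lemma Rint_le f g : L1 f -> L1 g -> (forall x, f x <= g x) ->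
  \int[mu]_x f x <= \int[mu]_x g x.
Proof. by move=> lf lg fg; exact: le_Rintegral. Qed.

Lemma Rint_sum (I : Type) (s : seq I) (F : I -> T -> R) :
  (forall i, L1 (F i)) ->
  \int[mu]_x (\sum_(i <- s) F i x) = \sum_(i <- s) \int[mu]_x F i x.
Proof.
move=> lF; elim: s => [|i s ih].
  by rewrite big_nil; under eq_Rintegral do rewrite big_nil;
     rewrite /Rintegral integral0.
rewrite big_cons -ih -RintD//; last exact: L1_sum.
by apply: eq_Rintegral => x _; rewrite big_cons.
Qed.

Lemma Rint_norm_le f g : L1 f -> L1 g -> (forall x, `|f x| <= g x) ->
  `|\int[mu]_x f x| <= \int[mu]_x g x.
Proof.
move=> lf lg fg; apply: le_trans (le_normr_Rintegral measurableT lf) _.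
by apply: Rint_le => //; exact: L1_norm.
Qed.

Lemma Rint_dominated (F : nat -> T -> R) f g :
  (forall k, measurable_fun setT (F k)) -> (forall k x, `|F k x| <= g x) ->
  L1 g -> (forall x, F k x @[k --> \oo] --> f x) ->
  L1 f /\ \int[mu]_x F k x @[k --> \oo] --> \int[mu]_x f x.
Proof.
move=> mF Fg lg cF.
have mf : measurable_fun setT f by apply: measurable_fun_cvg => // x _; exact: cF.
have lF k : L1 (F k) by apply: L1_le (Fg k) lg.
have lf : L1 f.
  apply: (L1_le mf _ lg) => x.
  have cn : `|F k x| @[k --> \oo] --> `|f x| by apply: cvg_norm; exact: cF.
  by apply: (cvgr_to_le cn); near=> k; exact: Fg.
split => //; apply: fine_cvg; rewrite -EFin_Rintegral//.
apply: (@dominated_cvg _ _ _ mu setT measurableT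
  (fun k x => (F k x)%:E) (EFin \o f) (EFin \o g)) => //=.
- by move=> k; exact/measurable_EFinP.
- by move=> x _; apply: cvg_EFin; [near=> k|exact: cF].
- by move=> k x _; rewrite lee_fin.
Unshelve. all: by end_near.
Qed.

Lemma Rint_dominated_cvg (F : nat -> T -> R) f g :
  (forall k, measurable_fun setT (F k)) -> (forall k x, `|F k x| <= g x) ->
  L1 g -> (forall x, F k x @[k --> \oo] --> f x) ->
  \int[mu]_x F k x @[k --> \oo] --> \int[mu]_x f x.
Proof. by move=> mF Fg lg cF; case: (Rint_dominated mF Fg lg cF). Qed.

(** A uniform bound on the integrals replaces the majorant of dominated convergence and makes the
    limit integrable. [plancherel_le] removes the damping in this way. *)
Lemma Rint_fatou (F : nat -> T -> R) f (B : R) :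
  (forall k, L1 (F k)) -> (forall k x, 0 <= F k x) ->
  (forall k, \int[mu]_x F k x <= B) ->
  (forall x, F k x @[k --> \oo] --> f x) ->
  L1 f /\ \int[mu]_x f x <= B.
Proof.
move=> lF F0 FB cF.
have mf : measurable_fun setT f.
  by apply: measurable_fun_cvg => [k|x _]; [exact/L1_measurable/lF|exact: cF].
have f0 x : 0 <= f x by apply: (cvgr_to_ge (cF x)); near=> k; exact: F0.
have := @fatou _ _ _ mu setT measurableT (fun k x => (F k x)%:E)
  (fun k => (measurable_EFinP _ _).2 (L1_measurable (lF k)))
  (fun k x _ => F0 k x).
have -> : (fun x => limn_einf ((fun k x0 => (F k x0)%:E)^~ x)) = EFin \o f.
  apply/funext => x; apply: (cvg_limn_einf_sup _).1.
  by apply: cvg_EFin; [near=> k|exact: cF].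
move=> le1.
have le2 : (\int[mu]_x (f x)%:E <= B%:E)%E.
  apply: le_trans le1 _; rewrite limn_einf_lim; apply: lime_le.
    exact: is_cvg_einfs.
  near=> k; apply: le_trans (ereal_inf_lbound _) _; first by exists k => /=.
  by rewrite EFin_Rintegral// lee_fin.
have lf : L1 f by apply: L1_lt_pinfty => //; exact: le_lt_trans le2 (ltry _).
by split => //; rewrite -lee_fin -EFin_Rintegral.
Unshelve. all: by end_near.
Qed.

End real_integral.

(** * Product measures and Fubini's theorem for real functions with a product majorant *)

Section product_sigma_finite.
Context {d1 d2 : measure_display} {T1 : measurableType d1}
  {T2 : measurableType d2} {R : realType}.
Variables (m1 : {sigma_finite_measure set T1 -> \bar R})
  (m2 : {sigma_finite_measure set T2 -> \bar R}).

Lemma sigma_finite_product : sigma_finite setT (m1 \x m2)%E.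
Proof.
have /sigma_finiteP[F [TF ndF Foo]] := sigma_finiteT m1.
have /sigma_finiteP[G [TG ndG Goo]] := sigma_finiteT m2.
exists (fun k => F k `*` G k).
  rewrite -setXTT TF TG predeqE => -[x y]; split.
    move=> [/= [k _ Fkx] [l _ Gly]]; exists (maxn k l) => //; split.
    - by move: x Fkx; exact/subsetPset/ndF/leq_maxl.
    - by move: y Gly; exact/subsetPset/ndG/leq_maxr.
  by move=> [k _ []/= ? ?]; split; exists k.
move=> k; have [? ?] := Foo k; have [? ?] := Goo k.
split; first exact: measurableX.
by rewrite /= product_measure1E// lte_mul_pinfty// ge0_fin_numE.
Qed.

(* The library reserves the canonical sigma-finite structure on products for
   subprobability measures. *)
Definition product_sigma_finite_measure :
    {sigma_finite_measure set (T1 * T2)%type -> \bar R} :=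
  HB.pack_for {sigma_finite_measure set (T1 * T2)%type -> \bar R} (m1 \x m2)%E
    (Measure_isSigmaFinite.Build _ _ _ (m1 \x m2)%E sigma_finite_product).

End product_sigma_finite.

Section real_fubini.
Context {d1 d2 : measure_display} {T1 : measurableType d1}
  {T2 : measurableType d2} {R : realType}.
Variables (m1 : {sigma_finite_measure set T1 -> \bar R})
  (m2 : {sigma_finite_measure set T2 -> \bar R}).
Variables (F : T1 * T2 -> R) (f : T1 -> R) (g : T2 -> R).
Hypotheses (mF : measurable_fun setT F) (lf : L1 m1 f) (lg : L1 m2 g)
  (Ffg : forall x y, `|F (x, y)| <= f x * g y).

Lemma prod_dominated_integrable :
  (m1 \x m2)%E.-integrable setT (EFin \o F).
Proof.
apply/integrable12ltyP; first exact/measurable_EFinP.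
have mFE : measurable_fun setT (fun z => `|(F z)%:E|%E).
  by apply: measurableT_comp => //; exact/measurable_EFinP.
apply: (@le_lt_trans _ _ (\int[m1]_x (`|f x| * \int[m2]_y `|g y|)%:E)%E); last first.
  rewrite EFin_Rintegral ?ltry//.
  rewrite (_ : (fun x => _) = (fun x => (\int[m2]_y `|g y|) * `|f x|)).
    exact/L1Z/L1_norm.
  by apply/funext => x; rewrite mulrC.
apply: ge0_le_integral => //=.
- by move=> x _; exact: integral_ge0.
- exact: (measurable_fun_fubini_tonelli_F (fun z => `|(F z)%:E|)%E).
- apply/measurable_EFinP; apply: measurable_funM => //.
  by apply: measurableT_comp => //; exact: L1_measurable lf.
- move=> x _; rewrite -RintZ; last exact: L1_norm.
  rewrite -EFin_Rintegral; last exact/L1Z/L1_norm.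
  apply: ge0_le_integral => //=.
  + by apply/measurable_EFinP; do 2 apply: measurableT_comp => //.
  + apply/measurable_EFinP; apply: measurable_funM => //.
    by apply: measurableT_comp => //; exact: L1_measurable lg.
  + move=> y _; rewrite lee_fin -normrM.
    exact: le_trans (Ffg x y) (ler_norm _).
Qed.

(** The pointwise majorant f x * g y makes every slice integrable, not just almost every one, so
    iterated real integrals need no exceptional set. *)
Lemma prod_dominated_L1l x : L1 m2 (fun y => F (x, y)).
Proof.
apply: (@L1_le _ _ _ _ _ (fun y => f x * g y)) => //; last exact: L1Z.
exact: measurableT_comp.
Qed.

Lemma prod_dominated_L1r y : L1 m1 (fun x => F (x, y)).
Proof.
apply: (@L1_le _ _ _ _ _ (fun x => g y * f x)) => //; last exact: L1Z.
- exact: measurableT_comp.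
- by move=> x; rewrite mulrC.
Qed.

Lemma L1_fubini : L1 m1 (fun x => \int[m2]_y F (x, y)).
Proof.
have := integrable_fubini_F prod_dominated_integrable.
apply: eq_integrable => // x _ /=.
by rewrite /fubini_F /= EFin_Rintegral//; exact: prod_dominated_L1l.
Qed.

Lemma Rint_fubini1 : \int[(m1 \x m2)%E]_z F z = \int[m1]_x \int[m2]_y F (x, y).
Proof.
congr fine; rewrite -integral12_prod_meas1; last exact: prod_dominated_integrable.
apply: eq_integral => x _ /=.
by rewrite /fubini_F /= EFin_Rintegral//; exact: prod_dominated_L1l.
Qed.

Lemma Rint_fubini :
  \int[m1]_x \int[m2]_y F (x, y) = \int[m2]_y \int[m1]_x F (x, y).
Proof.
rewrite -Rint_fubini1; congr fine.
rewrite -integral21_prod_meas1; last exact: prod_dominated_integrable.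
apply: eq_integral => y _ /=.
by rewrite /fubini_G /= EFin_Rintegral//; exact: prod_dominated_L1r.
Qed.

End real_fubini.

(** * Lebesgue measure on row vectors *)

Section rV_measurable.
Context {R : realType}.

(** The sigma-algebra is generated by the coordinates, so open sets must first be shown measurable.
    An open set is the union of the boxes it contains that have a rational centre and radius
    1/(k+1), and these are countably many. *)
Lemma continuous_measurable_rV (n : nat) (f : 'rV[R]_n -> R) :
  continuous f -> measurable_fun setT f.
Proof.
move=> cf; suff mO (U : set 'rV[R]_n) : open U -> measurable U.
  apply: (measurability (@RGenOpens.G R)); first exact: RGenOpens.measurableE.
  move=> _ [_ [a [b ->] <-]]; rewrite setTI; apply: mO.
  by apply: open_comp => // x _; exact: cf.
move=> oU.
pose box (z : 'rV[rat]_n * nat) : set 'rV[R]_n :=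
  \bigcap_(i in [set: 'I_n]) (fun x : 'rV[R]_n => x ord0 i) @^-1`
    ball (ratr (z.1 ord0 i) : R) (z.2.+1%:R^-1).
have mbox z : measurable (box z).
  apply: fin_bigcap_measurable => // i _; rewrite -[X in measurable X]setTI.
  by apply: measurable_coord => //; exact: measurable_ball.
pose F z := if `[< box z `<=` U >] then box z else set0.
suff -> : U = \bigcup_z F z.
  by apply: countable_bigcupT_measurable => // z; rewrite /F; case: asboolP.
apply/seteqP; split => [x Ux|x [z _]]; last first.
  by rewrite /F; case: (asboolP (box z `<=` U)) => // bU zx; exact: bU.
have /nbhs_ballP[e /= e0 eU] : nbhs x U by exact: open_nbhs_nbhs.
(* Twice the radius is below e, because x and y each lie within one radius of the rational
   centre. *)
have [k ke] : exists k, k.+1%:R^-1 < e / 2.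
  have /ltr_add_invr[k] : 0 < e / 2 by rewrite divr_gt0.
  by rewrite add0r; exists k.
have k0 : 0 < k.+1%:R^-1 :> R by rewrite invr_gt0.
have /choice[q qx] : forall i, exists q : rat, `|ratr q - x ord0 i| < k.+1%:R^-1.
  move=> i; have /rat_in_itvoo[q] : x ord0 i < x ord0 i + k.+1%:R^-1.
    by rewrite ltrDl.
  rewrite in_itv/= => /andP[q1 q2]; exists q.
  by rewrite gtr0_norm ?subr_gt0// ltrBlDl.
exists (\row_i q i, k) => //; rewrite /F; case: asboolP => [_|bU].
  by move=> i _; rewrite /box /= mxE; exact: qx.
exfalso; apply: bU => y by_; apply: eU; split => // i0 i; rewrite (ord1 i0).
have := by_ i I; rewrite /= mxE /ball /= => yq.
rewrite (_ : _ - _ = (x ord0 i - ratr (q i)) + (ratr (q i) - y ord0 i)); last by ring.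
rewrite (le_lt_trans (ler_normD _ _))// (splitr e) ltrD//.
  by rewrite distrC (lt_trans (qx i)).
exact: lt_trans yq ke.
Qed.

Lemma measurable_dotv (n : nat) :
  measurable_fun setT (fun z : 'rV[R]_n * 'rV[R]_n => dotv z.1 z.2).
Proof.
apply: measurable_sum => i; apply: measurable_funM.
  exact: measurableT_comp (measurable_coord i) measurable_fst.
exact: measurableT_comp (measurable_coord i) measurable_snd.
Qed.

Lemma measurable_dotvl (n : nat) (y : 'rV[R]_n) :
  measurable_fun setT (fun x : 'rV[R]_n => dotv x y).
Proof.
apply: measurable_sum => i; apply: measurable_funM => //.
exact: measurable_coord.
Qed.

Lemma measurable_add_rV (n : nat) (y : 'rV[R]_n) (c : R) :
  measurable_fun setT (fun x : 'rV[R]_n => y + c *: x).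
Proof.
have sub : g_sigma_preimage (fun i (x : 'rV[R]_n) => x ord0 i : R) `<=`
    image_set_system setT (fun x : 'rV[R]_n => y + c *: x) measurable.
  apply: smallest_sub.
    exact/sigma_algebra_image/sigma_algebra_measurable.
  rewrite -bigcup_seq; apply: bigcup_sub => i _ A [B mB <-].
  rewrite /image_set_system /= !setTI -comp_preimage.
  rewrite (_ : _ \o _ = fun x : 'rV[R]_n => y ord0 i + c * x ord0 i).
    rewrite -[X in measurable X]setTI.
    by apply: measurable_funD => //; apply: measurable_funM => //;
      exact: measurable_coord.
  by apply/funext => x /=; rewrite !mxE.
by move=> _ A /sub; rewrite /image_set_system /= setTI.
Qed.

Lemma cons_rV0 n (t : R) (y : 'rV[R]_n) : cons_rV (t, y) ord0 ord0 = t.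
Proof. by rewrite mxE unlift_none. Qed.

Lemma cons_rVS n (t : R) (y : 'rV[R]_n) i :
  cons_rV (t, y) ord0 (lift ord0 i) = y ord0 i.
Proof. by rewrite mxE liftK. Qed.

Lemma ge0_integral_cons n (f : 'rV[R]_n.+1 -> \bar R) :
  measurable_fun setT f -> (forall x, 0 <= f x)%E ->
  (\int[lebesgue_rV n.+1]_x f x =
   \int[@lebesgue_measure R]_t \int[lebesgue_rV n]_y f (cons_rV (t, y)))%E.
Proof.
move=> mf f0.
rewrite [LHS](@ge0_integral_pushforward _ _ _ _ _ _ (@measurable_cons_rV R n))//.
rewrite preimage_setT fubini_tonelli1//; last by move=> z; exact: f0.
by apply: measurableT_comp => //; exact: measurable_cons_rV.
Qed.

(** The product majorant carries the recursion defining [lebesgue_rV] over from nonnegative to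
    signed integrands. *)
Lemma Rint_cons n (f : 'rV[R]_n.+1 -> R) (g : R -> R) (h : 'rV[R]_n -> R) :
  measurable_fun setT f -> L1 (@lebesgue_measure R) g -> L1 (lebesgue_rV n) h ->
  (forall t y, `|f (cons_rV (t, y))| <= g t * h y) ->
  L1 (lebesgue_rV n.+1) f /\
  \int[lebesgue_rV n.+1]_x f x =
    \int[@lebesgue_measure R]_t \int[lebesgue_rV n]_y f (cons_rV (t, y)).
Proof.
move=> mf lg lh fgh.
have mfc : measurable_fun setT (fun z => f (@cons_rV R n z)).
  by apply: measurableT_comp => //; exact: measurable_cons_rV.
have ip := prod_dominated_integrable mfc lg lh fgh.
have mEf : measurable_fun setT (EFin \o f) by exact/measurable_EFinP.
split.
  exact: (@integrable_pushforward _ _ _ _ _ _ (@measurable_cons_rV R n) _ _ _ mEf).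
rewrite -(Rint_fubini1 mfc lg lh fgh); congr fine.
by rewrite [LHS](@integral_pushforward _ _ _ _ _ _ (@measurable_cons_rV R n) _ _ _ mEf).
Qed.

Lemma Rint_rV0 (f : 'rV[R]_0 -> R) :
  L1 (lebesgue_rV 0) f /\ \int[lebesgue_rV 0]_x f x = f 0.
Proof.
have mf : measurable_fun setT f.
  rewrite (_ : f = cst (f 0)) //; apply/funext => x /=; congr f.
  by apply/rowP => -[].
split; last first.
  rewrite /Rintegral /= integral_dirac//=; last exact/measurable_EFinP.
  by rewrite indicE mem_set// mul1r.
apply: (@L1_le _ _ _ _ _ (cst `|f 0|)) => //.
  by move=> x /=; rewrite (_ : x = 0)//; apply/rowP => -[].
apply/integrableP; split; first exact/measurable_EFinP.
by rewrite /= integral_dirac//= diracT mul1e ltry.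
Qed.

Lemma Rint_prod n (g : 'I_n -> R -> R) :
  (forall i, L1 (@lebesgue_measure R) (g i)) ->
  L1 (lebesgue_rV n) (fun x => \prod_(i < n) g i (x ord0 i)) /\
  \int[lebesgue_rV n]_x (\prod_(i < n) g i (x ord0 i)) =
    \prod_(i < n) \int[@lebesgue_measure R]_t g i t.
Proof.
elim: n g => [|n ih] g lg.
  by have [? ->] := Rint_rV0 (fun x => \prod_(i < 0) g i (x ord0 i)); split => //;
    rewrite !big_ord0.
have [lh hE] := ih (fun i => g (lift ord0 i)) (fun i => lg (lift ord0 i)).
have gE t y : \prod_(i < n.+1) g i (cons_rV (t, y) ord0 i) =
    g ord0 t * \prod_(i < n) g (lift ord0 i) (y ord0 i).
  rewrite big_ord_recl cons_rV0; congr (_ * _).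
  by apply: eq_bigr => i _; rewrite cons_rVS.
have mp : measurable_fun setT (fun x : 'rV[R]_n.+1 => \prod_(i < n.+1) g i (x ord0 i)).
  apply: measurable_prod => i _.
  apply: (@measurableT_comp _ _ _ _ _ _ (g i)); last exact: measurable_coord.
  exact: L1_measurable (lg i).
have gle t y : `|\prod_(i < n.+1) g i (cons_rV (t, y) ord0 i)| <=
    `|g ord0 t| * `|\prod_(i < n) g (lift ord0 i) (y ord0 i)|.
  by rewrite gE normrM.
have [lp ->] := Rint_cons mp (L1_norm (lg ord0)) (L1_norm lh) gle.
split => //; rewrite big_ord_recl -hE mulrC -RintZ//.
apply: eq_Rintegral => t _; rewrite mulrC -RintZ//.
by apply: eq_Rintegral => y _; rewrite gE.
Qed.

End rV_measurable.

(** * One-dimensional integrals and the transform of the exponential weight *)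

Section one_dim.
Context {R : realType}.
Local Notation leb := (@lebesgue_measure R).
Implicit Types f g F : R -> R.

Lemma norm_cos_le1 (t : R) : `|cos t| <= 1.
Proof. by rewrite ler_norml cos_geN1 cos_le1. Qed.

Lemma norm_sin_le1 (t : R) : `|sin t| <= 1.
Proof. by rewrite ler_norml sin_geN1 sin_le1. Qed.

Lemma L1_continuous_le f g : continuous f -> (forall t, `|f t| <= g t) ->
  L1 leb g -> L1 leb f.
Proof.
move=> cf fg lg; apply: (@L1_le _ (measurableTypeR R) R leb f g) => //.
exact: continuous_measurable_fun.
Qed.

(** The Cauchy density up to the factor pi. It has two uses: as the standard integrable majorant
    and, rescaled, as the factor of the Poisson kernel. *)
Definition cauchy_weight (t : R) : R := (1 + t ^+ 2)^-1.

Lemma cauchy_weight_gt0 t : 0 < cauchy_weight t.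
Proof. by rewrite invr_gt0 ltr_pwDl// sqr_ge0. Qed.

Lemma continuous_cauchy_weight : continuous cauchy_weight.
Proof.
move=> t; apply: cvgV; first by rewrite gt_eqF// ltr_pwDl// sqr_ge0.
by apply: cvgD; [exact: cvg_cst|exact: exprn_continuous].
Qed.

Lemma measurable_cauchy_weight : measurable_fun setT cauchy_weight.
Proof. by apply: continuous_measurable_fun; exact: continuous_cauchy_weight. Qed.

Lemma integral_cauchy_weight : (\int[leb]_t (cauchy_weight t)%:E)%E = pi%:E.
Proof.
rewrite ge0_symfun_integralT//=.
- rewrite (_ : [set x | _] = `[0, +oo[%classic); last first.
    by apply/seteqP; split => x /=; rewrite in_itv/= andbT.
  by rewrite integral0y_oneDsqr -EFinM mulrCA divff ?mulr1.
- by move=> t; exact/ltW/cauchy_weight_gt0.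
- exact: continuous_cauchy_weight.
- by move=> t; rewrite /cauchy_weight /= sqrrN.
Qed.

Lemma L1_cauchy_weight : L1 leb cauchy_weight.
Proof.
apply: L1_lt_pinfty; first exact: measurable_cauchy_weight.
  by move=> t; exact/ltW/cauchy_weight_gt0.
by rewrite integral_cauchy_weight ltry.
Qed.

Lemma Rint_cauchy_weight : \int[leb]_t cauchy_weight t = pi.
Proof. by rewrite /Rintegral integral_cauchy_weight. Qed.

Lemma FTC_is_derive F f (a b : R) : a < b -> continuous f ->
  (forall t, is_derive t (1 : R) F (f t)) ->
  \int[leb]_(t in `[a, b]) f t = F b - F a.
Proof.
move=> ab cf dF; have cF : continuous F.
  by move=> t; apply: differentiable_continuous; apply/derivable1_diffP.
rewrite /Rintegral (@continuous_FTC2 _ _ F)//.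
- exact: continuous_subspaceT.
- split; first by move=> t _.
  + exact/cvg_at_right_filter/cF.
  + exact/cvg_at_left_filter/cF.
- by move=> t _; rewrite derive1E derive_val.
Qed.

Lemma Rint_symm_itv_cvg f : L1 leb f ->
  \int[leb]_(t in `[- k.+1%:R, k.+1%:R]) f t @[k --> \oo] --> \int[leb]_t f t.
Proof.
move=> lf; under eq_fun do rewrite Rintegral_mkcond.
apply: (proj2 (Rint_dominated _ _ (L1_norm lf) _)).
- move=> k; apply/(measurable_restrictT _ _).1 => //.
  by apply: measurable_funTS; exact: (L1_measurable lf).
- by move=> k t; rewrite patchE; case: ifPn => // _; rewrite normr0.
- move=> t; apply: cvg_near_cst; near=> k; rewrite patchE mem_set//=.
  rewrite in_itv/= -ler_norml (le_trans _ (_ : k%:R <= _))//.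
    by near: k; exact: nbhs_infty_ger.
  by rewrite ler_nat.
Unshelve. all: by end_near.
Qed.

(** The integrand may have a corner at 0, as [exp_weight] does, so each half-line has its own
    antiderivative. Limits along the integers are enough, since f is integrable. *)
Lemma Rint_antiderivatives f f1 f2 F1 F2 (l1 l2 : R) : L1 leb f ->
  continuous f1 -> continuous f2 ->
  (forall t, 0 <= t -> f t = f1 t) -> (forall t, t <= 0 -> f t = f2 t) ->
  (forall t, is_derive t (1 : R) F1 (f1 t)) -> (forall t, is_derive t (1 : R) F2 (f2 t)) ->
  F1 k.+1%:R @[k --> \oo] --> l1 -> F2 (- k.+1%:R) @[k --> \oo] --> l2 ->
  \int[leb]_t f t = l1 - F1 0 + (F2 0 - l2).
Proof.
move=> lf cf1 cf2 ff1 ff2 dF1 dF2 cF1 cF2.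
have FE k : \int[leb]_(t in `[- k.+1%:R, k.+1%:R]) f t =
    (F1 k.+1%:R - F1 0) + (F2 0 - F2 (- k.+1%:R)).
  have ls (A : set R) : measurable A -> leb.-integrable A (EFin \o f).
    by move=> mA; apply: (@integrableS _ _ _ leb setT A).
  have k0 : 0 < k.+1%:R :> R by [].
  have Nk0 : - k.+1%:R < 0 :> R by rewrite oppr_lt0.
  rewrite -(FTC_is_derive k0 cf1 dF1) -(FTC_is_derive Nk0 cf2 dF2).
  have -> : \int[leb]_(t in `[0, k.+1%:R]) f1 t = \int[leb]_(t in `[0, k.+1%:R]) f t.
    by apply: eq_Rintegral => t; rewrite inE/= in_itv/= => /andP[t0 _]; rewrite ff1.
  have -> : \int[leb]_(t in `[- k.+1%:R, 0]) f2 t = \int[leb]_(t in `[- k.+1%:R, 0]) f t.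
    by apply: eq_Rintegral => t; rewrite inE/= in_itv/= => /andP[_ t0]; rewrite ff2.
  have := @Rintegral_itvB _ f (BLeft (- k.+1%:R)) (BRight k.+1%:R) 0.
  rewrite Rintegral_itv_obnd_cbnd; last exact: ls.
  by move=> <-; rewrite ?subrK ?bnd_simp ?ltW//; exact: ls.
have := Rint_symm_itv_cvg lf.
under eq_fun do rewrite FE.
move=> c1; apply: (cvg_unique _ c1) => //.
by apply: cvgD; apply: cvgB => //; exact: cvg_cst.
Qed.

Lemma cvg0_le (u v : nat -> R) : (forall k, `|u k| <= v k) ->
  v k @[k --> \oo] --> 0 -> u k @[k --> \oo] --> 0.
Proof.
move=> uv cv; apply: (@squeeze_cvgr _ _ _ _ (fun k => - v k) v) => //.
  by near=> k; rewrite -ler_norml.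
by rewrite -oppr0; exact: cvgN.
Unshelve. all: by end_near.
Qed.

Lemma cauchy_weight_le_invn C F : (forall t, `|F t| <= C * cauchy_weight t) ->
  F k.+1%:R @[k --> \oo] --> 0 /\ F (- k.+1%:R) @[k --> \oo] --> 0.
Proof.
move=> FC.
have C0 : 0 <= C.
  have := le_trans (normr_ge0 _) (FC 0).
  by rewrite pmulr_lge0// cauchy_weight_gt0.
have cC : C * harmonic k @[k --> \oo] --> (0 : R).
  by rewrite -[X in _ --> X](mulr0 C); apply: cvgMl_tmp; exact: cvg_harmonic.
have le k : cauchy_weight k.+1%:R <= harmonic k.
  rewrite /cauchy_weight /= lef_pV2 ?posrE// ?ltr_pwDl ?sqr_ge0//.
  by rewrite -[leLHS]add0r lerD// expr2 ler_peMr// ler1n.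
split; apply: (cvg0_le _ cC) => k; rewrite (le_trans (FC _))// ler_wpM2l//.
by rewrite /cauchy_weight sqrrN; exact: le.
Qed.

Lemma Rint_derivative F f C : continuous f ->
  (forall t, is_derive t (1 : R) F (f t)) ->
  (forall t, `|F t| <= C * cauchy_weight t) ->
  (forall t, `|f t| <= C * cauchy_weight t) -> \int[leb]_t f t = 0.
Proof.
move=> cf dF FC fC; have [F1 F2] := cauchy_weight_le_invn FC.
rewrite (@Rint_antiderivatives f f f F F 0 0)//; first by ring.
by apply: (L1_continuous_le cf fC); exact/L1Z/L1_cauchy_weight.
Qed.

Lemma is_derive_expR_sin (a z t : R) :
  is_derive t (1 : R) (fun t => expR (a * t) * sin (z * t))
    (a * (expR (a * t) * sin (z * t)) + z * (expR (a * t) * cos (z * t))).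
Proof.
have dl (b : R) : is_derive t (1 : R) (fun t => b * t) b.
  by apply: is_derive_eq; rewrite /GRing.scale/= mulr1.
have d1 := is_derive1_comp (is_derive_expR (a * t)) (dl a).
have d2 := is_derive1_comp (is_derive_sin (z * t)) (dl z).
by apply: is_derive_eq (is_deriveM d1 d2) _; rewrite /GRing.scale/=; ring.
Qed.

Lemma is_derive_expR_cos (a z t : R) :
  is_derive t (1 : R) (fun t => expR (a * t) * cos (z * t))
    (a * (expR (a * t) * cos (z * t)) - z * (expR (a * t) * sin (z * t))).
Proof.
have dl (b : R) : is_derive t (1 : R) (fun t => b * t) b.
  by apply: is_derive_eq; rewrite /GRing.scale/= mulr1.
have d1 := is_derive1_comp (is_derive_expR (a * t)) (dl a).
have d2 := is_derive1_comp (is_derive_cos (z * t)) (dl z).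
by apply: is_derive_eq (is_deriveM d1 d2) _; rewrite /GRing.scale/=; ring.
Qed.

(** The antiderivative is the real part of exp((a + i z) t) / (a + i z); the next lemma uses the
    imaginary part. *)
Lemma is_derive_antiderivative_cos (a z t : R) : a != 0 ->
  is_derive t (1 : R) (fun t => (a ^+ 2 + z ^+ 2)^-1 *
    (a * (expR (a * t) * cos (z * t)) + z * (expR (a * t) * sin (z * t))))
    (expR (a * t) * cos (z * t)).
Proof.
move=> a0; have D0 : a ^+ 2 + z ^+ 2 != 0.
  by rewrite gt_eqF// ltr_pwDl ?sqr_ge0// exprn_even_gt0.
have ds := is_derive_expR_sin a z t; have dc := is_derive_expR_cos a z t.
apply: is_derive_eq; rewrite /GRing.scale/=.
by rewrite -[RHS](mulKf D0); congr (_ * _); ring.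
Qed.

Lemma is_derive_antiderivative_sin (a z t : R) : a != 0 ->
  is_derive t (1 : R) (fun t => (a ^+ 2 + z ^+ 2)^-1 *
    (a * (expR (a * t) * sin (z * t)) - z * (expR (a * t) * cos (z * t))))
    (expR (a * t) * sin (z * t)).
Proof.
move=> a0; have D0 : a ^+ 2 + z ^+ 2 != 0.
  by rewrite gt_eqF// ltr_pwDl ?sqr_ge0// exprn_even_gt0.
have ds := is_derive_expR_sin a z t; have dc := is_derive_expR_cos a z t.
apply: is_derive_eq; rewrite /GRing.scale/=.
by rewrite -[RHS](mulKf D0); congr (_ * _); ring.
Qed.

Definition exp_weight (c t : R) : R := expR (- (c * `|t|)).

Lemma exp_weight_gt0 c t : 0 < exp_weight c t.
Proof. exact: expR_gt0. Qed.

Lemma exp_weight_le1 c t : 0 <= c -> exp_weight c t <= 1.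
Proof. by move=> c0; rewrite -expR0 ler_expR oppr_le0 mulr_ge0. Qed.

(** With s = c |t|, exp(s) = exp(s/2)^2 >= (1 + s/2)^2 >= 1 + s^2/4, and (1 + 4/c^2) (1 + s^2/4) >=
    1 + t^2 since s^2/c^2 = t^2. *)
Lemma exp_weight_le c t : 0 < c ->
  exp_weight c t <= (1 + 4 / c ^+ 2) * cauchy_weight t.
Proof.
move=> c0; rewrite /exp_weight /cauchy_weight expRN.
rewrite -[leLHS]mul1r ler_pdivlMr ?ltr_pwDl ?sqr_ge0// mulrAC.
rewrite ler_pdivrMr ?expR_gt0//.
set s := c * `|t|; have s0 : 0 <= s by rewrite mulr_ge0// ltW.
have es : 1 + s ^+ 2 / 4 <= expR s.
  have -> : expR s = expR (s / 2) ^+ 2 by rewrite -expRM_natl; congr expR; field.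
  apply: (@le_trans _ _ ((1 + s / 2) ^+ 2)).
    by rewrite -subr_ge0; have -> : (1 + s / 2) ^+ 2 - (1 + s ^+ 2 / 4) = s by field.
  by rewrite ler_pXn2r ?nnegrE ?expR_ge0 ?addr_ge0 ?divr_ge0// expR_ge1Dx.
have c4 : 0 <= 4 / c ^+ 2 by rewrite divr_ge0// sqr_ge0.
apply: (@le_trans _ _ ((1 + 4 / c ^+ 2) * (1 + s ^+ 2 / 4))); last first.
  by rewrite ler_wpM2l// addr_ge0.
have -> : (1 + 4 / c ^+ 2) * (1 + s ^+ 2 / 4) =
    1 + t ^+ 2 + 4 / c ^+ 2 + s ^+ 2 / 4.
  rewrite /s exprMn real_normK ?num_real//; field; exact: lt0r_neq0.
by rewrite mul1r -addrA ler_wpDr// addr_ge0// divr_ge0// sqr_ge0.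
Qed.

Lemma continuous_exp_weight c : continuous (exp_weight c).
Proof.
move=> t; apply: continuous_comp; last exact: continuous_expR.
by apply: cvgN; apply: cvgMl_tmp; exact: norm_continuous.
Qed.

Lemma L1_exp_weight c : 0 < c -> L1 leb (exp_weight c).
Proof.
move=> c0; apply: (@L1_continuous_le _ (fun t => (1 + 4 / c ^+ 2) * cauchy_weight t)).
- exact: continuous_exp_weight.
- move=> t; rewrite ger0_norm; first exact: exp_weight_le.
  exact/ltW/exp_weight_gt0.
- exact/L1Z/L1_cauchy_weight.
Qed.

(** Makes the boundary values at infinity of the antiderivatives vanish. *)
Lemma cvg_exp_lin (G : nat -> R) (c z1 z2 z : R) : 0 < c ->
  (forall k, G k = expR (- c * k.+1%:R) *
     (z1 * cos (z * k.+1%:R) + z2 * sin (z * k.+1%:R))) ->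
  G k @[k --> \oo] --> 0.
Proof.
move=> c0 GE.
have h t : `|exp_weight c t| <= (1 + 4 / c ^+ 2) * cauchy_weight t.
  rewrite ger0_norm; first exact: exp_weight_le.
  exact/ltW/exp_weight_gt0.
have ce : (`|z1| + `|z2|) * exp_weight c k.+1%:R @[k --> \oo] --> 0.
  rewrite -[X in _ --> X](mulr0 (`|z1| + `|z2|)); apply: cvgMl_tmp.
  exact: (proj1 (cauchy_weight_le_invn h)).
apply: cvg0_le ce => k.
rewrite GE normrM mulrC /exp_weight (@ger0_norm _ (expR _)) ?expR_ge0// mulNr.
rewrite (@ger0_norm _ k.+1%:R)// ler_wpM2r ?expR_ge0//.
apply: le_trans (ler_normD _ _) _; rewrite !normrM.
by apply: lerD; rewrite ler_piMr// ler_norml ?cos_geN1 ?cos_le1 ?sin_geN1 ?sin_le1.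
Qed.

(** The rate is -c on the right half-line and c on the left one. Both antiderivatives vanish at
    infinity, and each half-line contributes c / (c^2 + z^2) from its value at 0. *)
Lemma Rint_exp_weight_cos c z : 0 < c ->
  \int[leb]_t (exp_weight c t * cos (z * t)) = 2 * c / (c ^+ 2 + z ^+ 2).
Proof.
move=> c0; have nc0 : - c != 0 by rewrite oppr_eq0 gt_eqF.
pose E a t := expR (a * t) * cos (z * t).
pose F a t := (a ^+ 2 + z ^+ 2)^-1 *
    (a * (expR (a * t) * cos (z * t)) + z * (expR (a * t) * sin (z * t))).
have cE a : continuous (E a).
  by move=> t; apply: differentiable_continuous; apply/derivable1_diffP;
     exact: (@ex_derive _ _ _ _ _ _ _ (is_derive_expR_cos a z t)).
transitivity (0 - F (- c) 0 + (F c 0 - 0)); last first.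
  rewrite /F !mulr0 expR0 sin0 cos0 sqrrN !mulr0 !mulr1 !addr0 subr0; field.
  by rewrite gt_eqF// ltr_pwDl ?sqr_ge0// exprn_even_gt0 ?gt_eqF.
apply: (@Rint_antiderivatives _ (E (- c)) (E c)).
- apply: L1_bounded (L1_exp_weight c0) _ _.
  + by apply: continuous_measurable_fun => t; apply: continuous_comp;
      [exact: mulrl_continuous|exact: continuous_cos].
  + by move=> t; exact: norm_cos_le1.
- exact: cE.
- exact: cE.
- by move=> t t0; rewrite /E /exp_weight ger0_norm// mulNr.
- by move=> t t0; rewrite /E /exp_weight ler0_norm// mulrN opprK.
- by move=> t; exact: is_derive_antiderivative_cos.
- by move=> t; apply: is_derive_antiderivative_cos; rewrite gt_eqF.
- apply: (@cvg_exp_lin _ c (((- c) ^+ 2 + z ^+ 2)^-1 * - c)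
    (((- c) ^+ 2 + z ^+ 2)^-1 * z) z c0) => k.
  by rewrite /F; ring.
- apply: (@cvg_exp_lin _ c ((c ^+ 2 + z ^+ 2)^-1 * c)
    (- ((c ^+ 2 + z ^+ 2)^-1 * z)) z c0) => k.
  by rewrite /F mulrN (mulrN z) sinN cosN mulNr; ring.
Qed.

Lemma Rint_exp_weight_sin c z : 0 < c ->
  \int[leb]_t (exp_weight c t * sin (z * t)) = 0.
Proof.
move=> c0; have nc0 : - c != 0 by rewrite oppr_eq0 gt_eqF.
pose E a t := expR (a * t) * sin (z * t).
pose F a t := (a ^+ 2 + z ^+ 2)^-1 *
    (a * (expR (a * t) * sin (z * t)) - z * (expR (a * t) * cos (z * t))).
have cE a : continuous (E a).
  by move=> t; apply: differentiable_continuous; apply/derivable1_diffP;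
     exact: (@ex_derive _ _ _ _ _ _ _ (is_derive_expR_sin a z t)).
transitivity (0 - F (- c) 0 + (F c 0 - 0)); last first.
  by rewrite /F !mulr0 expR0 sin0 cos0 sqrrN !mulr0 !mulr1 !subr0; ring.
apply: (@Rint_antiderivatives _ (E (- c)) (E c)).
- apply: L1_bounded (L1_exp_weight c0) _ _.
  + by apply: continuous_measurable_fun => t; apply: continuous_comp;
      [exact: mulrl_continuous|exact: continuous_sin].
  + by move=> t; exact: norm_sin_le1.
- exact: cE.
- exact: cE.
- by move=> t t0; rewrite /E /exp_weight ger0_norm// mulNr.
- by move=> t t0; rewrite /E /exp_weight ler0_norm// mulrN opprK.
- by move=> t; exact: is_derive_antiderivative_sin.
- by move=> t; apply: is_derive_antiderivative_sin; rewrite gt_eqF.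
- apply: (@cvg_exp_lin _ c (- (((- c) ^+ 2 + z ^+ 2)^-1 * z))
    (((- c) ^+ 2 + z ^+ 2)^-1 * - c) z c0) => k.
  by rewrite /F; ring.
- apply: (@cvg_exp_lin _ c (- ((c ^+ 2 + z ^+ 2)^-1 * z))
    (- ((c ^+ 2 + z ^+ 2)^-1 * c)) z c0) => k.
  by rewrite /F mulrN (mulrN z) sinN cosN mulNr; ring.
Qed.

End one_dim.

(** * Affine changes of variables *)

Section affine_change.
Context {R : realType}.
Local Notation leb := (@lebesgue_measure R).

Lemma measurable_affine (a c : R) :
  measurable_fun setT (fun z : measurableTypeR R => a + c * z : measurableTypeR R).
Proof.
apply: (@continuous_measurable_fun R (fun z => a + c * z)) => z.
by apply: cvgD; [exact: cvg_cst|exact: mulrl_continuous].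
Qed.

(** The rescaled pushforward is a measure that agrees with Lebesgue measure on half-open intervals,
    and these determine it. *)
Lemma lebesgue_measure_affine (a c : R) (A : set (measurableTypeR R)) :
  0 < c -> measurable A ->
  leb A = (c%:E * leb ((fun z : measurableTypeR R => a + c * z)%R @^-1` A))%E.
Proof.
move=> c0 mA.
pose phi : {mfun measurableTypeR R >-> measurableTypeR R} :=
  HB.pack (fun z : measurableTypeR R => a + c * z : measurableTypeR R)
    (isMeasurableFun.Build _ _ _ _ _ (measurable_affine a c)).
have cn : 0 <= c by exact: ltW.
rewrite (@lebesgue_measure_unique R (mscale (NngNum cn) (pushforward leb phi)))//.
move=> _ [[u v]] _ <- /=; rewrite /mscale /= /pushforward.
rewrite (_ : _ @^-1` _ = `](u - a) / c, (v - a) / c]%classic); last first.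
  apply/seteqP; split => z /=; rewrite !in_itv/= ltr_pdivrMr// ler_pdivlMr//.
    by rewrite ltrBlDl lerBrDl (mulrC z).
  by rewrite ltrBlDl lerBrDl (mulrC z).
rewrite !lebesgue_measure_itv/= !lte_fin ltr_pM2r ?invr_gt0// ltrD2r.
case: ifPn => _; last by rewrite mule0.
by rewrite -!EFinB -EFinM; congr EFin; field; rewrite gt_eqF.
Qed.

Lemma ge0_integral_affine (a c : R) (f : measurableTypeR R -> \bar R) : 0 < c ->
  measurable_fun setT f -> (forall z, 0 <= f z)%E ->
  (\int[leb]_z f z = c%:E * \int[leb]_z f (a + c * z)%R)%E.
Proof.
move=> c0 mf f0.
pose phi : {mfun measurableTypeR R >-> measurableTypeR R} :=
  HB.pack (fun z : measurableTypeR R => a + c * z : measurableTypeR R)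
    (isMeasurableFun.Build _ _ _ _ _ (measurable_affine a c)).
have cn : 0 <= c by exact: ltW.
rewrite (@eq_measure_integral _ _ _ setT (mscale (NngNum cn) (pushforward leb phi))).
  rewrite ge0_integral_mscale//.
  by rewrite ge0_integral_pushforward// => z _; exact: f0.
by move=> A mA _; exact: lebesgue_measure_affine.
Qed.

(** A dilation acts on each coordinate separately, so induction on the dimension with one factor c
    per coordinate takes the place of a Jacobian. *)
Lemma ge0_integral_affine_rV n (a : 'rV[R]_n) (c : R) (f : 'rV[R]_n -> \bar R) :
  0 < c -> measurable_fun setT f -> (forall z, 0 <= f z)%E ->
  (\int[lebesgue_rV n]_z f z =
   (c ^+ n)%:E * \int[lebesgue_rV n]_z f (a + c *: z)%R)%E.
Proof.
move=> c0; elim: n a f => [|n ih] a f mf f0.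
  rewrite expr0 mul1e; apply: eq_integral => x _; congr f.
  by apply/rowP => -[].
have mfa : measurable_fun setT (fun z : 'rV[R]_n.+1 => f (a + c *: z)).
  by apply: measurableT_comp => //; exact: measurable_add_rV.
rewrite !ge0_integral_cons//.
pose a' : 'rV[R]_n := \row_i a ord0 (lift ord0 i).
have E t y : a + c *: cons_rV (t, y) = cons_rV (a ord0 ord0 + c * t, a' + c *: y).
  apply/rowP => i; rewrite mxE [in RHS]mxE; case: (unliftP ord0 i) => [j|] ->.
    by rewrite mxE cons_rVS !mxE.
  by rewrite mxE cons_rV0.
have mc : measurable_fun setT (fun z => f (@cons_rV R n z)).
  by apply: measurableT_comp => //; exact: measurable_cons_rV.
have mI := measurable_fun_fubini_tonelli_F (m2 := lebesgue_rV n)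
  (fun z => f (@cons_rV R n z)) mc (fun z => f0 _).
have I0 t : (0 <= \int[lebesgue_rV n]_y f (cons_rV (t, y)))%E.
  by apply: integral_ge0 => y _; exact: f0.
rewrite (ge0_integral_affine (a ord0 ord0) c0 mI I0).
rewrite exprS EFinM -muleA; congr (_ * _)%E.
rewrite -ge0_integralZl//; last 3 first.
- apply: (measurable_fun_fubini_tonelli_F (fun z => f (a + c *: cons_rV z))).
    by apply: measurableT_comp mfa _; exact: measurable_cons_rV.
  by move=> z; exact: f0.
- by move=> t _; apply: integral_ge0 => y _; exact: f0.
- by rewrite lee_fin exprn_ge0// ltW.
apply: eq_integral => t _; rewrite /fubini_F [LHS](ih a')//; last first.
  exact: (measurableT_comp mc (pair1_measurable _)).
by congr (_ * _)%E; apply: eq_integral => y _; rewrite E.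
Qed.

Lemma Rint_affine_rV n (a : 'rV[R]_n) (c : R) (f : 'rV[R]_n -> R) : 0 < c ->
  measurable_fun setT f -> (forall z, 0 <= f z) ->
  \int[lebesgue_rV n]_z f z = c ^+ n * \int[lebesgue_rV n]_z f (a + c *: z).
Proof.
move=> c0 mf f0; rewrite /Rintegral.
rewrite (@ge0_integral_affine_rV n a c)//; last exact/measurable_EFinP.
(* An infinite integral stays infinite after multiplication by the positive factor, and both sides
   are then read as 0. *)
case: (\int[_]_z _)%E => [r||]; [by []| |].
  by rewrite gt0_muley/= ?mulr0// lte_fin exprn_gt0.
by rewrite gt0_muleNy/= ?mulr0// lte_fin exprn_gt0.
Qed.

Lemma L1_affine_rV n (a : 'rV[R]_n) (c : R) (f : 'rV[R]_n -> R) : 0 < c ->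
  (forall z, 0 <= f z) ->
  L1 (lebesgue_rV n) f -> L1 (lebesgue_rV n) (fun z => f (a + c *: z)).
Proof.
move=> c0 f0 lf; apply: L1_lt_pinfty => //.
  by apply: (measurableT_comp (L1_measurable lf)); exact: measurable_add_rV.
have mf : measurable_fun setT (EFin \o f).
  by apply/measurable_EFinP; exact: L1_measurable lf.
have E := @ge0_integral_affine_rV n a c (EFin \o f) c0 mf f0.
have := EFin_Rintegral lf; rewrite -[X in X = _]/(integral _ _ (EFin \o f)) E.
case: (integral _ _ _) => [r _||]; rewrite ?ltry//.
by rewrite gt0_muley// lte_fin exprn_gt0.
Qed.

End affine_change.

(** * The integrable weight on R^n and integrals of directional derivatives *)

Section rV_weight.
Context {R : realType}.
Local Notation leb := (@lebesgue_measure R).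

Definition weight n (x : 'rV[R]_n) : R := \prod_(i < n) cauchy_weight (x ord0 i).

Lemma weight_gt0 n (x : 'rV[R]_n) : 0 < weight x.
Proof. by apply: prodr_gt0 => i _; exact: cauchy_weight_gt0. Qed.

Lemma L1_weight n : L1 (lebesgue_rV n) (@weight n).
Proof. exact: (proj1 (Rint_prod (fun i => @L1_cauchy_weight R))). Qed.

Lemma weight_cons n t (y : 'rV[R]_n) :
  weight (cons_rV (t, y)) = cauchy_weight t * weight y.
Proof.
rewrite /weight big_ord_recl cons_rV0; congr (_ * _).
by apply: eq_bigr => i _; rewrite cons_rVS.
Qed.

Lemma cons_rV_delta0 n (h t : R) (y : 'rV[R]_n) :
  h *: delta_mx ord0 ord0 + cons_rV (t, y) = cons_rV (h + t, y).
Proof.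
apply/rowP => i; rewrite 3!mxE; case: (unliftP ord0 i) => [j|] ->.
  by rewrite !cons_rVS mulr0 add0r.
by rewrite !cons_rV0 mulr1.
Qed.

Lemma cons_rV_deltaS n (h t : R) (y : 'rV[R]_n) j :
  h *: delta_mx ord0 (lift ord0 j) + cons_rV (t, y) =
  cons_rV (t, h *: delta_mx ord0 j + y).
Proof.
apply/rowP => i; rewrite 3!mxE; case: (unliftP ord0 i) => [k|] ->.
  by rewrite !cons_rVS !mxE (inj_eq lift_inj).
by rewrite !cons_rV0 mulr0 add0r.
Qed.

Lemma continuous_cons_rVl n (y : 'rV[R]_n) : continuous (fun t : R => cons_rV (t, y)).
Proof.
move=> t A /nbhs_ballP[e /= e0 eA]; apply/nbhs_ballP; exists e => // s ts.
apply: eA; split => // i j; rewrite (ord1 i).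
by case: (unliftP ord0 j) => [k|] ->; rewrite ?cons_rVS ?cons_rV0//; exact: ballxx.
Qed.

Lemma continuous_cons_rVr n (t : R) : continuous (fun y : 'rV[R]_n => cons_rV (t, y)).
Proof.
move=> y A /nbhs_ballP[e /= e0 eA]; apply/nbhs_ballP; exists e => // s [_ ys].
apply: eA; split => // i j; rewrite (ord1 i).
by case: (unliftP ord0 j) => [k|] ->; rewrite ?cons_rVS ?cons_rV0//; exact: ballxx.
Qed.

(** The two difference quotients are the same function of h, so a derivative of F in the single
    direction v is enough. *)
Lemma is_derive_along (U W : normedModType R) (F : W -> R) (g : U -> W)
    (x u : U) (v : W) (b : R) :
  (forall h : R, g (h *: u + x) = h *: v + g x) ->
  is_derive (g x) v F b -> is_derive x u (F \o g) b.
Proof.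
move=> gE [dF FE].
have E : (fun h : R => h^-1 *: (((F \o g) \o shift x) (h *: u) - (F \o g) x)) =
    (fun h : R => h^-1 *: ((F \o shift (g x)) (h *: v) - F (g x))).
  by apply/funext => h /=; rewrite gE.
by split; [move: dF; rewrite /derivable E|rewrite -FE /derive E].
Qed.

(** Induction on the dimension. A direction among the last n coordinates is handled inside the inner
    integral by the induction hypothesis; for the first coordinate the integrals are exchanged and
    the fundamental theorem of calculus applies for y fixed. The weight bounds justify Fubini and
    make the boundary values vanish. *)
Lemma Rint_partial_eq0 n (i : 'I_n) (F G : 'rV[R]_n -> R) (C : R) :
  continuous G -> (forall x, is_derive x (delta_mx ord0 i) F (G x)) ->
  (forall x, `|F x| <= C * weight x) -> (forall x, `|G x| <= C * weight x) ->
  \int[lebesgue_rV n]_x G x = 0.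
Proof.
elim: n i F G C => [[]//|n ih] i F G C cG dF FC GC.
have mG := continuous_measurable_rV cG.
have GC' t y : `|G (cons_rV (t, y))| <= (C * cauchy_weight t) * weight y.
  by rewrite -mulrA -weight_cons.
have [_ ->] := Rint_cons mG (L1Z C (@L1_cauchy_weight R)) (@L1_weight n) GC'.
case: (unliftP ord0 i) => [j|] iE.
  rewrite (_ : (fun t => _) = cst 0); first by rewrite /Rintegral integral0.
  apply/funext => t; apply: (ih j (fun y => F (cons_rV (t, y)))
    (fun y => G (cons_rV (t, y))) (C * cauchy_weight t)).
  - by move=> y; apply: continuous_comp; [exact: continuous_cons_rVr|exact: cG].
  - move=> y; apply: (@is_derive_along _ _ F (fun y => cons_rV (t, y)) _ _ _ _ _ (dF _)) => h.
    by rewrite iE cons_rV_deltaS.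
  - by move=> y; rewrite -mulrA -weight_cons.
  - by move=> y; exact: GC'.
have mGc : measurable_fun setT (fun z => G (@cons_rV R n z)).
  by apply: measurableT_comp => //; exact: measurable_cons_rV.
rewrite (Rint_fubini mGc (L1Z C (@L1_cauchy_weight R)) (@L1_weight n) GC').
rewrite (_ : (fun y => _) = cst 0); first by rewrite /Rintegral integral0.
apply/funext => y; apply: (@Rint_derivative _ (fun t => F (cons_rV (t, y)))
  (fun t => G (cons_rV (t, y))) (C * weight y)).
- by move=> t; apply: continuous_comp; [exact: continuous_cons_rVl|exact: cG].
- move=> t; apply: (@is_derive_along R _ F (fun t => cons_rV (t, y)) _ _ _ _ _ (dF _)) => h.
  by rewrite iE cons_rV_delta0 /GRing.scale/= mulr1.
- by move=> t; rewrite mulrAC -mulrA -weight_cons.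
- by move=> t; rewrite mulrAC; exact: GC'.
Qed.

End rV_weight.

(** * Cosine and sine transforms, Poisson kernel *)

Section trig_transform.
Context {R : realType} {n : nat}.
Local Notation mu := (@lebesgue_rV R n).
Implicit Types (f g : 'rV[R]_n -> R) (x y z xi : 'rV[R]_n).

Lemma measurable_weight : measurable_fun setT (@weight R n).
Proof. exact: L1_measurable (@L1_weight R n). Qed.

Lemma measurable_weightV : measurable_fun setT (fun x : 'rV[R]_n => (weight x)^-1).
Proof.
rewrite (_ : (fun x => _) = (fun x => \prod_(i < n) (1 + x ord0 i ^+ 2))).
  apply: measurable_prod => i _; apply: measurable_funD => //.
  by apply: measurable_funX; exact: measurable_coord.
apply/funext => x; rewrite /weight -prodfV.
by apply: eq_bigr => i _; rewrite invrK.
Qed.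

Lemma weightN x : weight (- x) = weight x.
Proof. by apply: eq_bigr => i _; rewrite mxE /cauchy_weight sqrrN. Qed.

(** Fubini needs integrability over the product, but h controls F only in t. The integrable positive
    [weight] in x is multiplied in and divided out again. *)
Lemma measurable_Rint_param d (T : measurableType d)
    (m : {sigma_finite_measure set T -> \bar R}) (F : 'rV[R]_n * T -> R) (h : T -> R) :
  measurable_fun setT F -> L1 m h -> (forall x t, `|F (x, t)| <= h t) ->
  measurable_fun setT (fun x : 'rV[R]_n => \int[m]_t F (x, t)).
Proof.
move=> mF lh Fh.
have mw : measurable_fun setT (fun z : 'rV[R]_n * T => weight z.1).
  exact: measurableT_comp measurable_weight measurable_fst.
have mwF : measurable_fun setT (fun z : 'rV[R]_n * T => weight z.1 * F z) by exact: measurable_funM.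
have wF x t : `|weight (x, t).1 * F (x, t)| <= weight x * h t.
  by rewrite normrM ger0_norm ?ler_wpM2l// ltW// weight_gt0.
have lF x : L1 m (fun t => F (x, t)).
  by apply: (L1_le _ (Fh x) lh); exact: measurableT_comp.
rewrite (_ : (fun x => _) =
    (fun x => (weight x)^-1 * \int[m]_t (weight (x, t).1 * F (x, t)))).
  apply: measurable_funM; first exact: measurable_weightV.
  exact: L1_measurable (L1_fubini mwF (@L1_weight R n) lh wF).
apply/funext => x.
rewrite (_ : Rintegral _ _ (fun t => weight (x, t).1 * F (x, t)) =
  weight x * \int[m]_t F (x, t)); last exact: (RintZ (weight x) (lF x)).
rewrite mulKf//.
by rewrite gt_eqF// weight_gt0.
Qed.

(** For real f the Fourier transform is [cos_transform f] minus i times [sin_transform f]. Working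
    with these two keeps all integrals real. *)
Definition cos_transform f xi : R := \int[mu]_x (f x * cos (dotv x xi)).

Definition sin_transform f xi : R := \int[mu]_x (f x * sin (dotv x xi)).

Lemma measurable_cosR : measurable_fun setT (@cos R).
Proof. by apply: continuous_measurable_fun; exact: continuous_cos. Qed.

Lemma measurable_sinR : measurable_fun setT (@sin R).
Proof. by apply: continuous_measurable_fun; exact: continuous_sin. Qed.

Lemma measurable_dotvr x : measurable_fun setT (fun xi => dotv x xi).
Proof.
apply: measurable_sum => i; apply: measurable_funM => //.
exact: measurable_coord.
Qed.

Lemma L1_cos f xi : L1 mu f -> L1 mu (fun x => f x * cos (dotv x xi)).
Proof.
move=> lf; apply: (L1_bounded lf _ (fun x => norm_cos_le1 _)).
exact: measurableT_comp measurable_cosR (measurable_dotvl xi).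
Qed.

Lemma L1_sin f xi : L1 mu f -> L1 mu (fun x => f x * sin (dotv x xi)).
Proof.
move=> lf; apply: (L1_bounded lf _ (fun x => norm_sin_le1 _)).
exact: measurableT_comp measurable_sinR (measurable_dotvl xi).
Qed.

Let measurable_trig_param f (h : R -> R) :
  measurable_fun setT h -> (forall t, `|h t| <= 1) -> L1 mu f ->
  measurable_fun setT (fun xi => \int[mu]_x (f x * h (dotv x xi))).
Proof.
move=> mh h1 lf.
apply: (@measurable_Rint_param _ _ mu
  (fun z : 'rV[R]_n * 'rV[R]_n => f z.2 * h (dotv z.2 z.1)) (fun x => `|f x|)).
- apply: measurable_funM.
    exact: measurableT_comp (L1_measurable lf) measurable_snd.
  apply: measurableT_comp => //.
  apply: measurable_sum => i; apply: measurable_funM.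
    exact: measurableT_comp (measurable_coord i) measurable_snd.
  exact: measurableT_comp (measurable_coord i) measurable_fst.
- exact: L1_norm.
- by move=> x y /=; rewrite normrM ler_piMr.
Qed.

Lemma measurable_cos_transform f : L1 mu f -> measurable_fun setT (cos_transform f).
Proof. exact: (measurable_trig_param measurable_cosR norm_cos_le1). Qed.

Lemma measurable_sin_transform f : L1 mu f -> measurable_fun setT (sin_transform f).
Proof. exact: (measurable_trig_param measurable_sinR norm_sin_le1). Qed.

Lemma norm_cos_transform f xi : L1 mu f -> `|cos_transform f xi| <= \int[mu]_x `|f x|.
Proof.
move=> lf; apply: Rint_norm_le; [exact: L1_cos|exact: L1_norm|].
by move=> x; rewrite normrM ler_piMr// norm_cos_le1.
Qed.

Lemma norm_sin_transform f xi : L1 mu f -> `|sin_transform f xi| <= \int[mu]_x `|f x|.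
Proof.
move=> lf; apply: Rint_norm_le; [exact: L1_sin|exact: L1_norm|].
by move=> x; rewrite normrM ler_piMr// norm_sin_le1.
Qed.

(** The product over the coordinates of 2 c / (c^2 + z_i^2), that is, of one-dimensional Poisson
    kernels. Its integral is (2 pi)^n for every c > 0. *)
Definition poisson_kernel (c : R) z : R := (2 / c) ^+ n * weight (c^-1 *: z).

Lemma poisson_kernel_ge0 c z : 0 < c -> 0 <= poisson_kernel c z.
Proof.
move=> c0; rewrite mulr_ge0 ?exprn_ge0 ?divr_ge0 ?(ltW c0)//.
exact/ltW/weight_gt0.
Qed.

Lemma poisson_kernelE c x y : poisson_kernel c (x - y) =
  (2 / c) ^+ n * weight (- (c^-1 *: x) + c^-1 *: y).
Proof. by rewrite /poisson_kernel -weightN scalerBr opprB addrC. Qed.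

Lemma L1_poisson_kernel c x : 0 < c -> L1 mu (fun y => poisson_kernel c (x - y)).
Proof.
move=> c0; under eq_fun do rewrite poisson_kernelE.
apply: L1Z; apply: (@L1_affine_rV _ _ _ _ (@weight R n)); last exact: L1_weight.
  by rewrite invr_gt0.
by move=> z; exact/ltW/weight_gt0.
Qed.

Lemma Rint_weight : \int[mu]_x weight x = pi ^+ n.
Proof.
rewrite (proj2 (Rint_prod (fun i => @L1_cauchy_weight R))).
under eq_bigr do rewrite Rint_cauchy_weight.
by rewrite prodr_const card_ord.
Qed.

Lemma Rint_poisson_kernel c x : 0 < c ->
  \int[mu]_y poisson_kernel c (x - y) = (2 * pi) ^+ n.
Proof.
move=> c0; under eq_Rintegral do rewrite poisson_kernelE.
rewrite RintZ; last first.
  apply: (@L1_affine_rV _ _ _ _ (@weight R n)); last exact: L1_weight.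
    by rewrite invr_gt0.
  by move=> z; exact/ltW/weight_gt0.
have := @Rint_affine_rV R n (- (c^-1 *: x)) c^-1 (@weight R n).
rewrite invr_gt0 => /(_ c0 measurable_weight (fun z => ltW (weight_gt0 z))).
rewrite Rint_weight => piE.
rewrite exprMn -mulrA -piE -exprMn mulrC.
by rewrite !exprMn mulrC.
Qed.

Definition exp_weight_rV (c : R) xi : R := \prod_(i < n) exp_weight c (xi ord0 i).

Lemma exp_weight_rV_gt0 c xi : 0 < exp_weight_rV c xi.
Proof. by apply: prodr_gt0 => i _; exact: exp_weight_gt0. Qed.

Lemma exp_weight_rV_le1 c xi : 0 <= c -> exp_weight_rV c xi <= 1.
Proof.
move=> c0; apply: prodr_ile1 => i _.
by rewrite exp_weight_le1// ltW// exp_weight_gt0.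
Qed.

Lemma L1_exp_weight_rV c : 0 < c -> L1 mu (exp_weight_rV c).
Proof. by move=> c0; exact: (proj1 (Rint_prod (fun i => L1_exp_weight c0))). Qed.

Lemma cvg_exp_weight_rV xi : exp_weight_rV (harmonic k) xi @[k --> \oo] --> (1 : R).
Proof.
rewrite (_ : (fun k => _) = fun k => expR (- (harmonic k * \sum_(i < n) `|xi ord0 i|))).
  rewrite -[X in _ --> X]expR0; apply: continuous_cvg; first exact: continuous_expR.
  rewrite -[X in _ --> X]oppr0; apply: cvgN.
  rewrite -[X in _ --> X](mul0r (\sum_(i < n) `|xi ord0 i|)).
  by apply: cvgMr_tmp; exact: cvg_harmonic.
apply/funext => k; rewrite /exp_weight_rV mulr_sumr -sumrN expR_sum.
exact: eq_bigr.
Qed.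

End trig_transform.

(** Both transforms are computed together because the addition formulas couple cosine and sine in
    the induction on the dimension. *)
Lemma Rint_exp_weight_rV (R : realType) (c : R) n (z : 'rV[R]_n) : 0 < c ->
  \int[lebesgue_rV n]_xi (exp_weight_rV c xi * cos (dotv z xi)) = poisson_kernel c z /\
  \int[lebesgue_rV n]_xi (exp_weight_rV c xi * sin (dotv z xi)) = 0.
Proof.
move=> c0; elim: n z => [|n ih] z.
  rewrite !(proj2 (Rint_rV0 _)) /exp_weight_rV /dotv /poisson_kernel /weight.
  by rewrite !big_ord0 cos0 sin0 expr0 !mulr1 mulr0.
pose z' : 'rV[R]_n := \row_i z ord0 (lift ord0 i); pose z0 := z ord0 ord0.
have [ic is_] := ih z'.
have lw := @L1_exp_weight_rV R n c c0; have l1 := @L1_exp_weight R c c0.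
have dE t y : dotv z (cons_rV (t, y)) = z0 * t + dotv z' y.
  rewrite /dotv big_ord_recl cons_rV0; congr (_ + _).
  by apply: eq_bigr => i _; rewrite cons_rVS !mxE.
have wE t y : exp_weight_rV c (cons_rV (t, y)) = exp_weight c t * exp_weight_rV c y.
  rewrite /exp_weight_rV big_ord_recl cons_rV0; congr (_ * _).
  by apply: eq_bigr => i _; rewrite cons_rVS.
have lwh (h : R -> R) : measurable_fun setT h -> (forall s, `|h s| <= 1) ->
    L1 (lebesgue_rV n) (fun y => exp_weight_rV c y * h (dotv z' y)).
  move=> mh h1; apply: (L1_bounded lw _ (fun y => h1 _)).
  exact: measurableT_comp mh (measurable_dotvr z').
have l1h (h : R -> R) : continuous h -> (forall s, `|h s| <= 1) ->
    L1 (@lebesgue_measure R) (fun t => exp_weight c t * h (z0 * t)).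
  move=> ch h1; apply: (L1_bounded l1 _ (fun t => h1 _)).
  apply: continuous_measurable_fun => t; apply: continuous_comp; last exact: ch.
  exact: mulrl_continuous.
have step (h : R -> R) : measurable_fun setT h -> (forall s, `|h s| <= 1) ->
    \int[lebesgue_rV n.+1]_xi (exp_weight_rV c xi * h (dotv z xi)) =
    \int[@lebesgue_measure R]_t \int[lebesgue_rV n]_y
      (exp_weight c t * exp_weight_rV c y * h (z0 * t + dotv z' y)).
  move=> mh h1; rewrite (proj2 (Rint_cons _ l1 lw _)).
  - by apply: eq_Rintegral => t _; apply: eq_Rintegral => y _; rewrite wE dE.
  - apply: measurable_funM; first exact: L1_measurable (L1_exp_weight_rV c0).
    exact: measurableT_comp mh (measurable_dotvr z).
  - move=> t y; rewrite normrM wE.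
    have e0 : 0 <= exp_weight c t * exp_weight_rV c y.
      by rewrite mulr_ge0// ltW ?exp_weight_gt0 ?exp_weight_rV_gt0.
    by rewrite ger0_norm// ler_piMr.
have lc := lwh _ measurable_cosR (@norm_cos_le1 R).
have ls := lwh _ measurable_sinR (@norm_sin_le1 R).
have l1c := l1h _ (@continuous_cos R) (@norm_cos_le1 R).
have l1s := l1h _ (@continuous_sin R) (@norm_sin_le1 R).
split; rewrite step//; [|exact: measurable_cosR|exact: norm_cos_le1|
    |exact: measurable_sinR|exact: norm_sin_le1].
- transitivity (\int[@lebesgue_measure R]_t
      (poisson_kernel c z' * (exp_weight c t * cos (z0 * t)))).
    apply: eq_Rintegral => t _.
    transitivity (\int[lebesgue_rV n]_y
      (exp_weight c t * cos (z0 * t) * (exp_weight_rV c y * cos (dotv z' y)) -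
       exp_weight c t * sin (z0 * t) * (exp_weight_rV c y * sin (dotv z' y)))).
      by apply: eq_Rintegral => y _; rewrite cosD; ring.
    by rewrite RintB ?RintZ ?ic ?is_ //; [ring|exact: L1Z|exact: L1Z].
  rewrite RintZ// Rint_exp_weight_cos// /poisson_kernel.
  rewrite {2}/weight big_ord_recl [(2 / c) ^+ n.+1]exprS.
  rewrite (_ : \prod_(i < n) _ = weight (c^-1 *: z')); last first.
    by apply: eq_bigr => i _; rewrite !mxE.
  rewrite mxE -/z0 /cauchy_weight.
  rewrite (_ : 2 * c / _ = 2 / c * (1 + (c^-1 * z0) ^+ 2)^-1); first by ring.
  have D0 : c ^+ 2 + z0 ^+ 2 != 0 by rewrite gt_eqF// ltr_pwDl ?sqr_ge0 ?exprn_gt0.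
  by field; rewrite D0 gt_eqF.
- transitivity (\int[@lebesgue_measure R]_t
      (poisson_kernel c z' * (exp_weight c t * sin (z0 * t)))).
    apply: eq_Rintegral => t _.
    transitivity (\int[lebesgue_rV n]_y
      (exp_weight c t * sin (z0 * t) * (exp_weight_rV c y * cos (dotv z' y)) +
       exp_weight c t * cos (z0 * t) * (exp_weight_rV c y * sin (dotv z' y)))).
      by apply: eq_Rintegral => y _; rewrite sinD; ring.
    by rewrite RintD ?RintZ ?ic ?is_ //; [ring|exact: L1Z|exact: L1Z].
  by rewrite RintZ// Rint_exp_weight_sin// mulr0.
Qed.

(** * Plancherel inequalities *)

Section plancherel.
Context {R : realType} {n : nat}.
Local Notation mu := (@lebesgue_rV R n).
Local Notation mu2 := (mu \x mu)%E.
Implicit Types (f g : 'rV[R]_n -> R) (x y xi : 'rV[R]_n)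
  (z : ('rV[R]_n * 'rV[R]_n)%type).

Let mfst f : L1 mu f -> measurable_fun setT (fun z => f z.1).
Proof. by move=> lf; exact: measurableT_comp (L1_measurable lf) measurable_fst. Qed.

Let msnd f : L1 mu f -> measurable_fun setT (fun z => f z.2).
Proof. by move=> lf; exact: measurableT_comp (L1_measurable lf) measurable_snd. Qed.

Lemma L1_tensor f g : L1 mu f -> L1 mu g -> L1 mu2 (fun z => f z.1 * g z.2).
Proof.
move=> lf lg; apply: (@prod_dominated_integrable _ _ _ _ _ mu mu _
  (fun x => `|f x|) (fun x => `|g x|)).
- by apply: measurable_funM; [exact: mfst|exact: msnd].
- exact: L1_norm.
- exact: L1_norm.
- by move=> x y; rewrite normrM.
Qed.

Section tensor.
Variables (f g : 'rV[R]_n -> R) (lf : L1 mu f) (lg : L1 mu g).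

Let mtrig (h : R -> R) xi : measurable_fun setT h ->
  measurable_fun setT (fun z => f z.1 * g z.2 * h (dotv z.1 xi - dotv z.2 xi)).
Proof.
move=> mh; apply: measurable_funM.
  by apply: measurable_funM; [exact: mfst|exact: msnd].
apply: measurableT_comp => //; apply: measurable_funB.
  exact: measurableT_comp (measurable_dotvl xi) measurable_fst.
exact: measurableT_comp (measurable_dotvl xi) measurable_snd.
Qed.

Let tensor_fubini (h : R -> R) xi : measurable_fun setT h ->
  (forall t, `|h t| <= 1) ->
  \int[mu2]_z (f z.1 * g z.2 * h (dotv z.1 xi - dotv z.2 xi)) =
  \int[mu]_x \int[mu]_y (f x * g y * h (dotv x xi - dotv y xi)).
Proof.
move=> mh h1; apply: (Rint_fubini1 (mtrig xi mh) (L1_norm lf) (L1_norm lg)).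
by move=> x y /=; rewrite !normrM ler_piMr// mulr_ge0.
Qed.

(** The right side is the real part of f^(xi) times the conjugate of g^(xi); [tensor_sin] gives
    minus the imaginary part. As double integrals, both depend on xi through the trigonometric
    factor alone. *)
Lemma tensor_cos xi :
  \int[mu2]_z (f z.1 * g z.2 * cos (dotv z.1 xi - dotv z.2 xi)) =
  cos_transform f xi * cos_transform g xi + sin_transform f xi * sin_transform g xi.
Proof.
rewrite (tensor_fubini _ measurable_cosR (@norm_cos_le1 R)).
have lfc := L1_cos xi lf; have lfs := L1_sin xi lf.
have lgc := L1_cos xi lg; have lgs := L1_sin xi lg.
transitivity (\int[mu]_x (cos_transform g xi * (f x * cos (dotv x xi)) +
    sin_transform g xi * (f x * sin (dotv x xi)))).
  apply: eq_Rintegral => x _.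
  transitivity (\int[mu]_y ((f x * cos (dotv x xi)) * (g y * cos (dotv y xi)) +
      (f x * sin (dotv x xi)) * (g y * sin (dotv y xi)))).
    by apply: eq_Rintegral => y _; rewrite cosB; ring.
  by rewrite RintD ?RintZ//; [rewrite /cos_transform /sin_transform; ring|exact: L1Z|exact: L1Z].
by rewrite RintD ?RintZ//; [rewrite /cos_transform /sin_transform; ring|exact: L1Z|exact: L1Z].
Qed.

Lemma tensor_sin xi :
  \int[mu2]_z (f z.1 * g z.2 * sin (dotv z.1 xi - dotv z.2 xi)) =
  sin_transform f xi * cos_transform g xi - cos_transform f xi * sin_transform g xi.
Proof.
rewrite (tensor_fubini _ measurable_sinR (@norm_sin_le1 R)).
have lfc := L1_cos xi lf; have lfs := L1_sin xi lf.
have lgc := L1_cos xi lg; have lgs := L1_sin xi lg.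
transitivity (\int[mu]_x (cos_transform g xi * (f x * sin (dotv x xi)) -
    sin_transform g xi * (f x * cos (dotv x xi)))).
  apply: eq_Rintegral => x _.
  transitivity (\int[mu]_y ((f x * sin (dotv x xi)) * (g y * cos (dotv y xi)) -
      (f x * cos (dotv x xi)) * (g y * sin (dotv y xi)))).
    by apply: eq_Rintegral => y _; rewrite sinB; ring.
  by rewrite RintB ?RintZ//; [rewrite /cos_transform /sin_transform; ring|exact: L1Z|exact: L1Z].
by rewrite RintB ?RintZ//; [rewrite /cos_transform /sin_transform; ring|exact: L1Z|exact: L1Z].
Qed.

(** The damping makes the triple integral absolutely convergent, so that xi can be integrated
    first. *)
Let tensor_weighted (h : R -> R) c : 0 < c -> measurable_fun setT h ->
  (forall t, `|h t| <= 1) ->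
  \int[mu]_xi (exp_weight_rV c xi *
    \int[mu2]_z (f z.1 * g z.2 * h (dotv z.1 xi - dotv z.2 xi))) =
  \int[mu2]_z (f z.1 * g z.2 *
    \int[mu]_xi (exp_weight_rV c xi * h (dotv (z.1 - z.2) xi))).
Proof.
move=> c0 mh h1.
have lw := @L1_exp_weight_rV R n c c0.
have lfg := L1_tensor lf lg.
have lz xi : L1 mu2 (fun z => f z.1 * g z.2 * h (dotv z.1 xi - dotv z.2 xi)).
  apply: (L1_le (mtrig xi mh) _ (L1_norm lfg)) => z.
  by rewrite (normrM (_ * _)) ler_piMr.
have lxi z : L1 mu (fun xi => exp_weight_rV c xi * h (dotv (z.1 - z.2) xi)).
  apply: (L1_bounded lw _ (fun y => h1 _)).
  exact: measurableT_comp mh (measurable_dotvr _).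
have dB (z : 'rV[R]_n * 'rV[R]_n) xi : dotv (z.1 - z.2) xi = dotv z.1 xi - dotv z.2 xi.
  by rewrite /dotv -sumrB; apply: eq_bigr => i _; rewrite !mxE mulrBl.
transitivity (\int[mu]_xi \int[mu2]_z
    (exp_weight_rV c xi * (f z.1 * g z.2 * h (dotv z.1 xi - dotv z.2 xi)))).
  by apply: eq_Rintegral => xi _; rewrite RintZ.
transitivity (\int[mu2]_z \int[mu]_xi
    ((f z.1 * g z.2) * (exp_weight_rV c xi * h (dotv (z.1 - z.2) xi)))); last first.
  by apply: eq_Rintegral => z _; rewrite RintZ.
pose F (p : ('rV[R]_n * 'rV[R]_n) * 'rV[R]_n) := (f p.1.1 * g p.1.2) *
  (exp_weight_rV c p.2 * h (dotv (p.1.1 - p.1.2) p.2)).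
have mF : measurable_fun setT F.
  apply: measurable_funM.
    exact: measurableT_comp (L1_measurable lfg) measurable_fst.
  apply: measurable_funM.
    exact: measurableT_comp (L1_measurable lw) measurable_snd.
  apply: measurableT_comp => //.
  rewrite (_ : (fun _ => _) = (fun p : ('rV[R]_n * 'rV[R]_n) * 'rV[R]_n =>
      dotv p.1.1 p.2 - dotv p.1.2 p.2)); last by apply/funext => p; exact: dB.
  apply: measurable_funB; apply: measurable_sum => i; apply: measurable_funM.
  + apply: measurableT_comp (measurable_coord i) _.
    exact: measurableT_comp measurable_fst measurable_fst.
  + exact: measurableT_comp (measurable_coord i) measurable_snd.
  + apply: measurableT_comp (measurable_coord i) _.
    exact: measurableT_comp measurable_snd measurable_fst.
  + exact: measurableT_comp (measurable_coord i) measurable_snd.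
have Fle z xi : `|F (z, xi)| <= `|f z.1 * g z.2| * exp_weight_rV c xi.
  rewrite /F /= normrM ler_wpM2l// normrM.
  by rewrite ger0_norm ?ler_piMr// ltW// exp_weight_rV_gt0.
have FE : \int[mu2]_z \int[mu]_xi F (z, xi) = \int[mu]_xi \int[mu2]_z F (z, xi) :=
  @Rint_fubini _ _ _ _ _ (product_sigma_finite_measure mu mu) mu F _ _
    mF (L1_norm lfg) lw Fle.
rewrite [RHS]FE; apply: eq_Rintegral => xi _; apply: eq_Rintegral => z _.
by rewrite /F /= dB; ring.
Qed.

Lemma weighted_transform_cos c : 0 < c ->
  \int[mu]_xi (exp_weight_rV c xi *
    (cos_transform f xi * cos_transform g xi +
     sin_transform f xi * sin_transform g xi)) =
  \int[mu2]_z (f z.1 * g z.2 * poisson_kernel c (z.1 - z.2)).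
Proof.
move=> c0; under eq_Rintegral do rewrite -tensor_cos.
rewrite (tensor_weighted c0 measurable_cosR (@norm_cos_le1 R)).
by under eq_Rintegral => z _ do rewrite (proj1 (Rint_exp_weight_rV _ c0)).
Qed.

(** The damping is even, so its sine transform is zero. This cancels the cross terms of [fourier_sq]
    in [fourier_sq_ge]. *)
Lemma weighted_transform_sin c : 0 < c ->
  \int[mu]_xi (exp_weight_rV c xi *
    (sin_transform f xi * cos_transform g xi -
     cos_transform f xi * sin_transform g xi)) = 0.
Proof.
move=> c0; under eq_Rintegral do rewrite -tensor_sin.
rewrite (tensor_weighted c0 measurable_sinR (@norm_sin_le1 R)).
under eq_Rintegral => z _ do rewrite (proj2 (Rint_exp_weight_rV _ c0)) mulr0.
by rewrite /Rintegral integral0.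
Qed.

End tensor.

Lemma measurable_kernel_diff c :
  measurable_fun setT (fun z => poisson_kernel c (z.1 - z.2)).
Proof.
rewrite (_ : (fun _ => _) = (fun z => (2 / c) ^+ n *
    \prod_(i < n) (@cauchy_weight R) (c^-1 * (z.1 ord0 i - z.2 ord0 i)))).
  apply: measurable_funM => //; apply: measurable_prod => i _.
  apply: measurableT_comp (@measurable_cauchy_weight R) _.
  apply: measurable_funM => //; apply: measurable_funB.
    exact: measurableT_comp (measurable_coord i) measurable_fst.
  exact: measurableT_comp (measurable_coord i) measurable_snd.
apply/funext => z; rewrite /poisson_kernel /weight; congr (_ * _).
by apply: eq_bigr => i _; rewrite !mxE.
Qed.

Lemma poisson_kernelN c x : poisson_kernel c (- x) = poisson_kernel c x.
Proof. by rewrite /poisson_kernel scalerN weightN. Qed.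

Lemma kernel_diff_fst g c : 0 < c -> L1 mu g -> (forall x, 0 <= g x) ->
  L1 mu2 (fun z => g z.1 * poisson_kernel c (z.1 - z.2)) /\
  \int[mu2]_z (g z.1 * poisson_kernel c (z.1 - z.2)) =
    (2 * pi) ^+ n * \int[mu]_x g x.
Proof.
move=> c0 lg g0.
have m1 : measurable_fun setT (fun z => g z.1 * poisson_kernel c (z.1 - z.2)).
  by apply: measurable_funM; [exact: mfst|exact: measurable_kernel_diff].
have p0 z : 0 <= g z.1 * poisson_kernel c (z.1 - z.2).
  by rewrite mulr_ge0// poisson_kernel_ge0.
have E : (\int[mu2]_z (g z.1 * poisson_kernel c (z.1 - z.2))%:E =
    ((2 * pi) ^+ n * \int[mu]_x g x)%:E)%E.
  rewrite fubini_tonelli1//; last exact/measurable_EFinP.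
  rewrite -RintZ// -EFin_Rintegral; last exact: L1Z.
  apply: eq_integral => x _; rewrite /fubini_F /= EFin_Rintegral; last first.
    exact/L1Z/L1_poisson_kernel.
  by rewrite (RintZ (g x) (L1_poisson_kernel x c0)) (Rint_poisson_kernel x c0) mulrC.
split; last by rewrite /Rintegral E.
by apply: L1_lt_pinfty => //; rewrite E ltry.
Qed.

Lemma kernel_diff_snd g c : 0 < c -> L1 mu g -> (forall x, 0 <= g x) ->
  L1 mu2 (fun z => g z.2 * poisson_kernel c (z.1 - z.2)) /\
  \int[mu2]_z (g z.2 * poisson_kernel c (z.1 - z.2)) =
    (2 * pi) ^+ n * \int[mu]_x g x.
Proof.
move=> c0 lg g0.
have m1 : measurable_fun setT (fun z => g z.2 * poisson_kernel c (z.1 - z.2)).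
  by apply: measurable_funM; [exact: msnd|exact: measurable_kernel_diff].
have p0 z : 0 <= g z.2 * poisson_kernel c (z.1 - z.2).
  by rewrite mulr_ge0// poisson_kernel_ge0.
have E : (\int[mu2]_z (g z.2 * poisson_kernel c (z.1 - z.2))%:E =
    ((2 * pi) ^+ n * \int[mu]_x g x)%:E)%E.
  rewrite fubini_tonelli2//; last exact/measurable_EFinP.
  rewrite -RintZ// -EFin_Rintegral; last exact: L1Z.
  apply: eq_integral => x _; rewrite /fubini_G /=.
  under eq_integral do rewrite -poisson_kernelN opprB.
  rewrite EFin_Rintegral; last exact/L1Z/L1_poisson_kernel.
  by rewrite (RintZ (g x) (L1_poisson_kernel x c0)) (Rint_poisson_kernel x c0) mulrC.
split; last by rewrite /Rintegral E.
by apply: L1_lt_pinfty => //; rewrite E ltry.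
Qed.

Let measurable_sq_transform f : L1 mu f -> measurable_fun setT
  (fun xi => cos_transform f xi ^+ 2 + sin_transform f xi ^+ 2).
Proof.
move=> lf; apply: measurable_funD; apply: measurable_funX.
  exact: measurable_cos_transform.
exact: measurable_sin_transform.
Qed.

(* With the damping factor, Fubini turns the left side into the integral of
   f(x) f(y) against the Poisson kernel, and f(x) f(y) <= (f(x)^2 + f(y)^2) / 2;
   Fatou removes the damping. *)
Lemma plancherel_le f : L1 mu f -> L1 mu (fun x => f x ^+ 2) ->
  L1 mu (fun xi => cos_transform f xi ^+ 2 + sin_transform f xi ^+ 2) /\
  \int[mu]_xi (cos_transform f xi ^+ 2 + sin_transform f xi ^+ 2) <=
    (2 * pi) ^+ n * \int[mu]_x f x ^+ 2.
Proof.
move=> lf lf2; pose B := (\int[mu]_x `|f x|) ^+ 2 *+ 2.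
apply: (@Rint_fatou _ _ _ mu (fun k xi => exp_weight_rV (harmonic k) xi *
  (cos_transform f xi ^+ 2 + sin_transform f xi ^+ 2))).
- move=> k; apply: (@L1_bounded _ _ _ _ _ _ B) => //.
  + by apply: L1_exp_weight_rV; rewrite invr_gt0.
  + exact: measurable_sq_transform.
  + move=> xi; rewrite ger0_norm ?addr_ge0 ?sqr_ge0// /B mulr2n.
    rewrite -(real_normK (num_real (cos_transform f xi))).
    rewrite -(real_normK (num_real (sin_transform f xi))).
    by apply: lerD; rewrite ler_pXn2r ?nnegrE ?Rintegral_ge0// ?norm_cos_transform ?norm_sin_transform.
- by move=> k xi; rewrite mulr_ge0 ?addr_ge0 ?sqr_ge0// ltW// exp_weight_rV_gt0.
- move=> k; set c := harmonic k; have c0 : 0 < c by rewrite invr_gt0.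
  under eq_Rintegral do rewrite 2!expr2.
  rewrite weighted_transform_cos//.
  have [l1 e1] := kernel_diff_fst c0 lf2 (fun x => sqr_ge0 (f x)).
  have [l2 e2] := kernel_diff_snd c0 lf2 (fun x => sqr_ge0 (f x)).
  have -> : (2 * pi) ^+ n * \int[mu]_x f x ^+ 2 =
      \int[mu2]_z (2^-1 * (f z.1 ^+ 2 * poisson_kernel c (z.1 - z.2) +
        f z.2 ^+ 2 * poisson_kernel c (z.1 - z.2))).
    by rewrite RintZ ?RintD//; [rewrite e1 e2; field|exact: L1D].
  have le z : `|f z.1 * f z.2 * poisson_kernel c (z.1 - z.2)| <=
      2^-1 * (f z.1 ^+ 2 * poisson_kernel c (z.1 - z.2) +
        f z.2 ^+ 2 * poisson_kernel c (z.1 - z.2)).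
    have -> : 2^-1 * (f z.1 ^+ 2 * poisson_kernel c (z.1 - z.2) +
        f z.2 ^+ 2 * poisson_kernel c (z.1 - z.2)) =
      2^-1 * (f z.1 ^+ 2 + f z.2 ^+ 2) * poisson_kernel c (z.1 - z.2) by ring.
    rewrite normrM (@ger0_norm _ (poisson_kernel _ _)) ?poisson_kernel_ge0//.
    rewrite ler_wpM2r ?poisson_kernel_ge0// ler_norml.
    rewrite -subr_ge0 -[X in _ && X]subr_ge0; apply/andP; split.
      have -> : f z.1 * f z.2 - - (2^-1 * (f z.1 ^+ 2 + f z.2 ^+ 2)) =
        2^-1 * (f z.1 + f z.2) ^+ 2 by field.
      by rewrite mulr_ge0 ?sqr_ge0.
    have -> : 2^-1 * (f z.1 ^+ 2 + f z.2 ^+ 2) - f z.1 * f z.2 =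
      2^-1 * (f z.1 - f z.2) ^+ 2 by field.
    by rewrite mulr_ge0 ?sqr_ge0.
  have lr : L1 mu2 (fun z => 2^-1 * (f z.1 ^+ 2 * poisson_kernel c (z.1 - z.2) +
      f z.2 ^+ 2 * poisson_kernel c (z.1 - z.2))) by exact/L1Z/L1D.
  apply: Rint_le => //; last by move=> z; exact: le_trans (ler_norm _) (le z).
  apply: (L1_le _ le lr); apply: measurable_funM; last exact: measurable_kernel_diff.
  exact: L1_measurable (L1_tensor lf lf).
- move=> xi; rewrite -[X in _ --> X]mul1r; apply: cvgMr_tmp.
  exact: cvg_exp_weight_rV.
Qed.

(** The kernel is an approximate identity: the substitution y = x + c z turns it into the fixed
    density 2^n [weight z], and dominated convergence applies to f (x + c z) - f x. *)
Lemma cvg_poisson f (M : R) x : continuous f -> (forall y, `|f y| <= M) ->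
  \int[mu]_y (f y * poisson_kernel (harmonic k) (x - y)) @[k --> \oo] -->
  (2 * pi) ^+ n * f x.
Proof.
move=> cf fM; have mf := continuous_measurable_rV cf.
have h0 k : 0 < harmonic k :> R by rewrite invr_gt0.
have lP k := L1_poisson_kernel x (h0 k).
have lfP k : L1 mu (fun y => f y * poisson_kernel (harmonic k) (x - y)).
  by under eq_fun do rewrite mulrC; exact: L1_bounded (lP k) mf fM.
pose G k y := `|f y - f x| * poisson_kernel (harmonic k) (x - y).
have lG k : L1 mu (G k).
  rewrite /G; under eq_fun do rewrite mulrC.
  apply: (@L1_bounded _ _ _ _ _ _ (M + M) (lP k)).
    by apply: measurableT_comp => //; exact: measurable_funB.
  by move=> y; rewrite normr_id (le_trans (ler_normB _ _))// lerD.
have GE k : \int[mu]_y G k y =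
    \int[mu]_z (`|f (x + harmonic k *: z) - f x| * (2 ^+ n * weight z)).
  rewrite (@Rint_affine_rV _ _ x (harmonic k))//; last 2 first.
  - exact: L1_measurable (lG k).
  - by move=> z; rewrite mulr_ge0 ?poisson_kernel_ge0.
  rewrite -RintZ; last first.
    apply: (L1_affine_rV x (h0 k)); last exact: lG.
    by move=> z; rewrite mulr_ge0 ?poisson_kernel_ge0.
  apply: eq_Rintegral => z _; rewrite /G opprD addrA subrr add0r.
  rewrite poisson_kernelN /poisson_kernel scalerA mulVf ?gt_eqF//.
  rewrite scale1r expr_div_n; field.
  by rewrite expf_neq0 ?gt_eqF.
have cG : \int[mu]_y G k y @[k --> \oo] --> 0.
  under eq_fun do rewrite GE.
  have E0 : \int[mu]_z (0 : R) = 0 by rewrite /Rintegral integral0.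
  have : \int[mu]_z (`|f (x + harmonic k *: z) - f x| * (2 ^+ n * weight z))
      @[k --> \oo] --> \int[mu]_z (0 : R); last by rewrite E0.
  apply: (@Rint_dominated_cvg _ _ _ mu
    (fun k (z : 'rV[R]_n) => `|f (x + harmonic k *: z) - f x| * (2 ^+ n * weight z))
    (fun=> 0) (fun z : 'rV[R]_n => (M + M) * 2 ^+ n * weight z)).
  - move=> k; apply: measurable_funM.
      apply: measurableT_comp => //; apply: measurable_funB => //.
      exact: measurableT_comp mf (measurable_add_rV _ _).
    by apply: measurable_funM => //; exact: measurable_weight.
  - move=> k z; have w0 := ltW (weight_gt0 z).
    rewrite normrM normr_id -mulrA (@ger0_norm _ (_ * _)) ?mulr_ge0 ?exprn_ge0//.
    rewrite ler_wpM2r ?mulr_ge0 ?exprn_ge0//.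
    by rewrite (le_trans (ler_normB _ _))// lerD.
  - exact/L1Z/L1_weight.
  - move=> z; rewrite -[X in _ --> X](mul0r (2 ^+ n * weight z)).
    apply: cvgMr_tmp; rewrite -[X in _ --> X](@normr0 _ R); apply: cvg_norm.
    rewrite -(subrr (f x)); apply: cvgB; last exact: cvg_cst.
    rewrite -{2}(addr0 x) -(scale0r z).
    apply: continuous_cvg; first exact: cf.
    apply: cvgD; first exact: cvg_cst.
    by apply: cvgZr_tmp; exact: cvg_harmonic.
apply/subr_cvg0; apply: cvg0_le cG => k.
rewrite -(Rint_poisson_kernel x (h0 k)) mulrC -(RintZ (f x) (lP k)).
rewrite -RintB//; last exact: L1Z.
apply: Rint_norm_le; [by apply: L1B => //; exact: L1Z|exact: lG|].
by move=> y; rewrite /G -mulrBl normrM (@ger0_norm _ (poisson_kernel _ _)) ?poisson_kernel_ge0.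
Qed.

Lemma L1_bounded_sq f (M : R) : L1 mu f -> (forall y, `|f y| <= M) ->
  L1 mu (fun x => f x ^+ 2).
Proof. by move=> lf fM; exact: (L1_bounded lf (L1_measurable lf) fM). Qed.

(** By continuity the inner integral converges at every x ([cvg_poisson]). It is bounded by M (2
    pi)^n, so the outer integral converges with a multiple of |f| as majorant. *)
Lemma cvg_tensor_poisson f (M : R) : continuous f -> L1 mu f ->
  (forall y, `|f y| <= M) ->
  \int[mu2]_z (f z.1 * f z.2 * poisson_kernel (harmonic k) (z.1 - z.2))
    @[k --> \oo] --> (2 * pi) ^+ n * \int[mu]_x f x ^+ 2.
Proof.
move=> cf lf fM; have lf2 := L1_bounded_sq lf fM.
have h0 k : 0 < harmonic k :> R by rewrite invr_gt0.
have lP k x := L1_poisson_kernel x (h0 k).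
have mf := L1_measurable lf.
have lfP k x : L1 mu (fun y => f y * poisson_kernel (harmonic k) (x - y)).
  by under eq_fun do rewrite mulrC; exact: L1_bounded (lP k x) mf fM.
have M0 : 0 <= M by exact: le_trans (normr_ge0 _) (fM 0).
(* This crude bound depends on k and serves Fubini for each k separately; the majorant uniform in k
   is the multiple of |f| given below. *)
have pB (k : nat) x : poisson_kernel (harmonic k) x <= (2 / harmonic k) ^+ n.
  rewrite /poisson_kernel ler_piMr// ?exprn_ge0 ?divr_ge0 ?(ltW (h0 k))//.
  apply: prodr_ile1 => i _; rewrite ltW ?cauchy_weight_gt0//=.
  by rewrite invf_le1 ?ltr_pwDl ?sqr_ge0// lerDl sqr_ge0.
have dom k : forall x y, `|f x * f y * poisson_kernel (harmonic k) (x - y)| <=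
    `|f x| * ((2 / harmonic k) ^+ n * `|f y|).
  move=> x y; rewrite normrM (@ger0_norm _ (poisson_kernel _ _)) ?poisson_kernel_ge0// normrM.
  by rewrite -mulrA ler_wpM2l// mulrC ler_wpM2r.
have mF k : measurable_fun setT
    (fun z => f z.1 * f z.2 * poisson_kernel (harmonic k) (z.1 - z.2)).
  apply: measurable_funM; last exact: measurable_kernel_diff.
  by apply: measurable_funM; [exact: mfst|exact: msnd].
have E k : \int[mu2]_z (f z.1 * f z.2 * poisson_kernel (harmonic k) (z.1 - z.2)) =
    \int[mu]_x (f x * \int[mu]_y (f y * poisson_kernel (harmonic k) (x - y))).
  rewrite (Rint_fubini1 (mF k) (L1_norm lf) (L1Z _ (L1_norm lf)) (dom k)).
  apply: eq_Rintegral => x _; rewrite -(RintZ (f x) (lfP k x)).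
  by apply: eq_Rintegral => y _ /=; rewrite mulrA.
under eq_fun do rewrite E.
have -> : (2 * pi) ^+ n * \int[mu]_x f x ^+ 2 =
    \int[mu]_x (f x * ((2 * pi) ^+ n * f x)).
  by rewrite -(RintZ _ lf2); apply: eq_Rintegral => x _; ring.
apply: (proj2 (@Rint_dominated _ _ _ mu _ _
  (fun x => M * (2 * pi) ^+ n * `|f x|) _ _ (L1Z _ (L1_norm lf)) _)).
- move=> k; have lI := L1_fubini (mF k) (L1_norm lf) (L1Z _ (L1_norm lf)) (dom k).
  have := L1_measurable lI; congr (measurable_fun _ _); apply/funext => x.
  rewrite -(RintZ (f x) (lfP k x)).
  by apply: eq_Rintegral => y _ /=; rewrite mulrA.
- move=> k x; rewrite normrM mulrC ler_wpM2r//.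
  rewrite -(Rint_poisson_kernel x (h0 k)) -(RintZ M (lP k x)).
  apply: Rint_norm_le; [exact: lfP|exact/L1Z/lP|].
  move=> y; rewrite normrM (@ger0_norm _ (poisson_kernel _ _)) ?poisson_kernel_ge0//.
  by rewrite ler_wpM2r// poisson_kernel_ge0.
- by move=> x; apply: cvgMl_tmp; exact: cvg_poisson cf fM.
Qed.

(* |h^(xi)|^2 for h = f + i g with f, g real and h^(xi) = \int e^(-i x.xi) h(x) dx. *)
Definition fourier_sq f g xi : R :=
  (cos_transform f xi + sin_transform g xi) ^+ 2 +
  (cos_transform g xi - sin_transform f xi) ^+ 2.

Lemma fourier_sq_ge0 f g xi : 0 <= fourier_sq f g xi.
Proof. by rewrite addr_ge0 ?sqr_ge0. Qed.

Lemma measurable_fourier_sq f g : L1 mu f -> L1 mu g ->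
  measurable_fun setT (fourier_sq f g).
Proof.
move=> lf lg; apply: measurable_funD; apply: measurable_funX.
  by apply: measurable_funD; [exact: measurable_cos_transform|exact: measurable_sin_transform].
by apply: measurable_funB; [exact: measurable_cos_transform|exact: measurable_sin_transform].
Qed.

(* The constant is sharp up to the factor 2, which pays for dropping the cross terms. *)
Lemma fourier_sq_le f g : L1 mu f -> L1 mu g ->
  L1 mu (fun x => f x ^+ 2) -> L1 mu (fun x => g x ^+ 2) ->
  L1 mu (fourier_sq f g) /\
  \int[mu]_xi fourier_sq f g xi <=
    2 * (2 * pi) ^+ n * (\int[mu]_x f x ^+ 2 + \int[mu]_x g x ^+ 2).
Proof.
move=> lf lg lf2 lg2.
have [l1 i1] := plancherel_le lf lf2; have [l2 i2] := plancherel_le lg lg2.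
have le xi : fourier_sq f g xi <=
    2 * ((cos_transform f xi ^+ 2 + sin_transform f xi ^+ 2) +
         (cos_transform g xi ^+ 2 + sin_transform g xi ^+ 2)).
  rewrite /fourier_sq -subr_ge0.
  set a := cos_transform f xi; set b := sin_transform f xi.
  set a' := cos_transform g xi; set b' := sin_transform g xi.
  have -> : 2 * (a ^+ 2 + b ^+ 2 + (a' ^+ 2 + b' ^+ 2)) -
      ((a + b') ^+ 2 + (a' - b) ^+ 2) = (a - b') ^+ 2 + (a' + b) ^+ 2 by ring.
  by rewrite addr_ge0 ?sqr_ge0.
have lr := L1Z 2 (L1D l1 l2).
have lq : L1 mu (fourier_sq f g).
  apply: (L1_le (measurable_fourier_sq lf lg) _ lr) => xi.
  by rewrite ger0_norm ?fourier_sq_ge0.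
split => //; apply: le_trans (Rint_le lq lr le) _.
rewrite (RintZ 2 (L1D l1 l2)) (RintD l1 l2) -mulrA ler_pM2l// mulrDr.
exact: lerD.
Qed.

(** Under the damping the cross terms integrate to exactly 0, so no factor 2 is lost here. The
    damping is at most 1, hence each damped integral lies below the right side, and these integrals
    converge to the left side. *)
Lemma fourier_sq_ge f g (M : R) : continuous f -> continuous g ->
  L1 mu f -> L1 mu g -> (forall x, `|f x| <= M) -> (forall x, `|g x| <= M) ->
  (2 * pi) ^+ n * (\int[mu]_x f x ^+ 2 + \int[mu]_x g x ^+ 2) <=
  \int[mu]_xi fourier_sq f g xi.
Proof.
move=> cf cg lf lg fM gM.
have [lq _] := fourier_sq_le lf lg (L1_bounded_sq lf fM) (L1_bounded_sq lg gM).
have h0 k : 0 < harmonic k :> R by rewrite invr_gt0.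
have c1 : \int[mu2]_z (f z.1 * f z.2 * poisson_kernel (harmonic k) (z.1 - z.2)) +
    \int[mu2]_z (g z.1 * g z.2 * poisson_kernel (harmonic k) (z.1 - z.2))
    @[k --> \oo] -->
    (2 * pi) ^+ n * (\int[mu]_x f x ^+ 2 + \int[mu]_x g x ^+ 2).
  by rewrite mulrDr; apply: cvgD;
    [exact: cvg_tensor_poisson cf lf fM|exact: cvg_tensor_poisson cg lg gM].
apply: (cvgr_to_le c1); apply: nearW => k.
rewrite -!weighted_transform_cos//.
have lw := @L1_exp_weight_rV R n _ (h0 k).
have lwb (h : 'rV[R]_n -> R) B : measurable_fun setT h -> (forall xi, `|h xi| <= B) ->
    L1 mu (fun xi => exp_weight_rV (harmonic k) xi * h xi).
  by move=> mh hB; exact: L1_bounded lw mh hB.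
pose B := \int[mu]_x `|f x| + \int[mu]_x `|g x|.
have Bf0 : 0 <= \int[mu]_x `|f x| by exact: Rintegral_ge0.
have Bg0 : 0 <= \int[mu]_x `|g x| by exact: Rintegral_ge0.
have bcf xi : `|cos_transform f xi| <= B.
  by rewrite (le_trans (norm_cos_transform xi lf))// lerDl.
have bsf xi : `|sin_transform f xi| <= B.
  by rewrite (le_trans (norm_sin_transform xi lf))// lerDl.
have bcg xi : `|cos_transform g xi| <= B.
  by rewrite (le_trans (norm_cos_transform xi lg))// lerDr.
have bsg xi : `|sin_transform g xi| <= B.
  by rewrite (le_trans (norm_sin_transform xi lg))// lerDr.
have mcf := measurable_cos_transform lf; have msf := measurable_sin_transform lf.
have mcg := measurable_cos_transform lg; have msg := measurable_sin_transform lg.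
have bM a b : `|a| <= B -> `|b| <= B -> `|a * b| <= B * B.
  by move=> ? ?; rewrite normrM ler_pM.
have lff : L1 mu (fun xi => exp_weight_rV (harmonic k) xi *
    (cos_transform f xi * cos_transform f xi + sin_transform f xi * sin_transform f xi)).
  apply: (lwb _ (B * B + B * B)).
    by apply: measurable_funD; exact: measurable_funM.
  by move=> xi; rewrite (le_trans (ler_normD _ _))// lerD// bM.
have lgg : L1 mu (fun xi => exp_weight_rV (harmonic k) xi *
    (cos_transform g xi * cos_transform g xi + sin_transform g xi * sin_transform g xi)).
  apply: (lwb _ (B * B + B * B)).
    by apply: measurable_funD; exact: measurable_funM.
  by move=> xi; rewrite (le_trans (ler_normD _ _))// lerD// bM.
have lfg : L1 mu (fun xi => exp_weight_rV (harmonic k) xi *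
    (sin_transform g xi * cos_transform f xi - cos_transform g xi * sin_transform f xi)).
  apply: (lwb _ (B * B + B * B)).
    by apply: measurable_funB; exact: measurable_funM.
  by move=> xi; rewrite (le_trans (ler_normB _ _))// lerD// bM.
have lwq : L1 mu (fun xi => exp_weight_rV (harmonic k) xi * fourier_sq f g xi).
  apply: (L1_le _ _ lq).
    by apply: measurable_funM; [exact: L1_measurable lw|exact: measurable_fourier_sq].
  move=> xi; have w0 := ltW (exp_weight_rV_gt0 (harmonic k) xi).
  rewrite ger0_norm ?mulr_ge0 ?fourier_sq_ge0// ler_piMl ?fourier_sq_ge0//.
  exact: exp_weight_rV_le1 (ltW (h0 k)).
have E : \int[mu]_xi (exp_weight_rV (harmonic k) xi * fourier_sq f g xi) =
    \int[mu]_xi (exp_weight_rV (harmonic k) xi *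
      (cos_transform f xi * cos_transform f xi + sin_transform f xi * sin_transform f xi)) +
    \int[mu]_xi (exp_weight_rV (harmonic k) xi *
      (cos_transform g xi * cos_transform g xi + sin_transform g xi * sin_transform g xi)).
  rewrite -[LHS]subr0 -(mulr0 2) -(weighted_transform_sin lg lf (h0 k)).
  rewrite -(RintZ 2 lfg) -(RintD lff lgg).
  rewrite -(RintB lwq (L1Z 2 lfg)).
  by apply: eq_Rintegral => xi _; rewrite /fourier_sq; ring.
rewrite -E; apply: Rint_le => // xi.
rewrite ler_piMl ?fourier_sq_ge0//; exact: exp_weight_rV_le1 (ltW (h0 k)).
Qed.

End plancherel.

(** * Schwartz functions *)

Section decay.
Context {R : realType} {n : nat}.
Local Notation mu := (@lebesgue_rV R n).
Implicit Types (f g : 'rV[R]_n -> R) (x y xi : 'rV[R]_n).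

Lemma coord_le_norm x i : `|x ord0 i| <= `|x|.
Proof.
rewrite [leRHS](mx_normrE x).
exact: (le_bigmax _ (fun ij : 'I_1 * 'I_n => `|x ij.1 ij.2|) (ord0, i)).
Qed.

Lemma norm_rV_coord x : `|x| = 0 \/ exists i, `|x| = `|x ord0 i|.
Proof.
have [->|x0] := eqVneq `|x| 0; first by left.
by right; have [[i j] /= E] := mx_norm_neq0 x0; exists j; rewrite [LHS]E (ord1 i).
Qed.

(** Each factor satisfies 1 + x_i^2 <= (1 + |x|)^2. The exponent 2n is thus the decay at which
    integrability is guaranteed below. *)
Lemma weight_ge x : 1 <= (1 + `|x|) ^+ (2 * n) * weight x.
Proof.
have -> : (1 + `|x|) ^+ (2 * n) = \prod_(i < n) (1 + `|x|) ^+ 2.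
  by rewrite prodr_const card_ord -exprM.
rewrite /weight -big_split /=.
have : \prod_(i < n) (1 : R) <= \prod_(i < n) ((1 + `|x|) ^+ 2 * cauchy_weight (x ord0 i)).
  apply: ler_prod => i _; rewrite ler01/= /cauchy_weight.
  rewrite ler_pdivlMr ?ltr_pwDl ?sqr_ge0// mul1r sqrrD expr1n mul1r.
  rewrite -addrA lerD// ler_wpDl ?mulrn_wge0//.
  by rewrite -(real_normK (num_real (x ord0 i))) ler_pXn2r ?nnegrE// coord_le_norm.
by rewrite big1_eq.
Qed.

Lemma poly_weight_le (B : R) f : (forall x, (1 + `|x|) ^+ (2 * n) * `|f x| <= B) ->
  forall x, `|f x| <= B * weight x.
Proof.
move=> fB x; have w0 := weight_gt0 x.
apply: (@le_trans _ _ (((1 + `|x|) ^+ (2 * n) * weight x) * `|f x|)).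
  by rewrite ler_peMl// weight_ge.
by rewrite mulrAC ler_wpM2r// ltW.
Qed.

(** The sup norm equals some |x_i|, so bounds on single coordinate powers suffice. The factor 2^K
    comes from (1 + t)^K <= 2^K (1 + t^K). *)
Lemma poly_decay K f : (exists B, forall x, `|f x| <= B) ->
  (forall i, exists B, forall x, `|x ord0 i| ^+ K * `|f x| <= B) ->
  exists B, forall x, (1 + `|x|) ^+ K * `|f x| <= B.
Proof.
move=> [B0 fB0] /choice[B fB]; exists (2 ^+ K * (B0 + (B0 + \sum_i `|B i|))) => x.
have le2 : (1 + `|x|) ^+ K <= 2 ^+ K * (1 + `|x| ^+ K).
  have [x1|x1] := leP `|x| 1.
    apply: (@le_trans _ _ (2 ^+ K)); last by rewrite ler_peMr ?exprn_ge0// lerDl exprn_ge0.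
    by rewrite lerXn2r ?nnegrE ?addr_ge0// -[2]/(1 + 1) lerD2l.
  rewrite mulrDr -exprMn ler_wpDl// ?mulr_ge0 ?exprn_ge0//.
  by rewrite lerXn2r ?nnegrE ?addr_ge0 ?mulr_ge0// mulr_natl mulr2n lerD2r ltW.
apply: le_trans (ler_wpM2r (normr_ge0 _) le2) _.
rewrite -mulrA ler_wpM2l ?exprn_ge0// mulrDl mul1r lerD//.
have S0 (j : 'I_n) : `|B j| <= \sum_i `|B i|.
  by rewrite (bigD1 j)//= lerDl sumr_ge0.
have B00 : 0 <= B0 := le_trans (normr_ge0 _) (fB0 x).
have [x0|[i xi]] := norm_rV_coord x.
  rewrite x0 (@le_trans _ _ `|f x|) ?(le_trans (fB0 x)) ?lerDl ?sumr_ge0//.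
  by rewrite ler_piMl// exprn_ile1.
rewrite xi (le_trans (fB i x))// (le_trans (ler_norm _))// (le_trans (S0 i))//.
by rewrite lerDr.
Qed.

Lemma enorm_le x : enorm x <= n%:R * `|x|.
Proof.
have nx0 : 0 <= n%:R * `|x| by rewrite mulr_ge0.
rewrite /enorm -[leRHS](ger0_norm nx0) -sqrtr_sqr ler_sqrt ?sqr_ge0//.
apply: (@le_trans _ _ (\sum_(i < n) `|x| ^+ 2)).
  apply: ler_sum => i _; rewrite -expr2 -(real_normK (num_real (x ord0 i))).
  by rewrite lerXn2r ?nnegrE// coord_le_norm.
rewrite sumr_const card_ord exprMn -[leLHS]mulr_natl ler_wpM2r ?sqr_ge0//.
by rewrite -natrX ler_nat; case: (n) => // m; rewrite -mulnn leq_pmulr.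
Qed.

Lemma coord_le_enorm x i : `|x ord0 i| <= enorm x.
Proof.
rewrite /enorm /dotv -sqrtr_sqr ler_sqrt ?sumr_ge0//; last first.
  by move=> j _; rewrite -expr2 sqr_ge0.
rewrite (bigD1 i)//= -expr2 lerDl sumr_ge0// => j _.
by rewrite -expr2 sqr_ge0.
Qed.

Lemma norm_le_enorm x : `|x| <= enorm x.
Proof.
by have [->|[i ->]] := norm_rV_coord x; [exact: sqrtr_ge0|exact: coord_le_enorm].
Qed.

(* Outside a ball (q0 / 2 + f)^(1 / (2 tau)) is Lipschitz, hence at most linear. *)
Lemma tau_function_growth (tau : R) f : tau_function tau f ->
  exists C p, 0 <= C /\ forall x, `|f x| <= C * (1 + `|x|) ^+ p.
Proof.
move=> [tau0 cf [q0 q00 [fq [C1 [M [C10 M0 lip]]]]]].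
have cball : compact [set v : 'rV[R]_n | forall i, `[- M, M]%classic (v ord0 i)].
  by apply: (@rV_compact R n (fun=> `[- M, M]%classic)) => i; exact: segment_compact.
have [v0 /set_mem _ v0max] : exists2 c, c \in [set v : 'rV[R]_n |
    forall i, `[- M, M]%classic (v ord0 i)] &
    forall t, t \in [set v : 'rV[R]_n | forall i, `[- M, M]%classic (v ord0 i)] ->
      `|f t| <= `|f c|.
  apply: (@EVT_max_rV _ _ (fun t => `|f t|)) => //.
  - by exists 0 => i /=; rewrite mxE in_itv/= oppr_le0 ltW.
  - apply: continuous_subspaceT => v; apply: continuous_comp; first exact: cf.
    exact: norm_continuous.
have small x : enorm x < M -> `|f x| <= `|f v0|.
  move=> xM; apply: v0max; rewrite inE /= => i; rewrite in_itv/= -ler_norml.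
  exact: le_trans (coord_le_enorm x i) (ltW xM).
(* For n = 0 no vector has norm at least M, and the bound on the ball is then already global. *)
have [[y yM]|noy] := pselect (exists y, M <= enorm y); last first.
  exists `|f v0|, 0%N; split => // x; rewrite expr0 mulr1; apply: small.
  by rewrite ltNge; apply/negP => xM; apply: noy; exists x.
set g := fun x => (q0 / 2 + f x) `^ (1 / (2 * tau)).
have pos x : 0 < q0 / 2 + f x by have := fq x; lra.
(* The Lipschitz bound against the fixed y combined with |x| + |y| <= (1 + |y|) (1 + |x|); the
   factor n compares [enorm] with the sup norm. *)
pose D := g y + C1^-1 * (n%:R + n%:R * `|y|).
have D0 : 0 <= D.
  by rewrite addr_ge0 ?powR_ge0// mulr_ge0 ?invr_ge0 ?(ltW C10)// addr_ge0// mulr_ge0.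
have gle x : M <= enorm x -> g x <= D * (1 + `|x|).
  move=> xM; have h := lip x y xM yM.
  have h1 : g x - g y <= C1^-1 * enorm (x - y).
    by rewrite (le_trans (ler_norm _))// ler_pdivlMl.
  have h2 : enorm (x - y) <= n%:R * (`|x| + `|y|).
    by apply: le_trans (enorm_le _) _; rewrite ler_wpM2l// ler_normB.
  have h3 : C1^-1 * enorm (x - y) <= C1^-1 * (n%:R * (`|x| + `|y|)).
    by apply: ler_wpM2l => //; rewrite invr_ge0 ltW.
  have gy0 : 0 <= g y := powR_ge0 _ _.
  have : g x <= g y + C1^-1 * (n%:R * (`|x| + `|y|)) by lra.
  move/le_trans; apply; rewrite /D mulrDl lerD//.
    by rewrite ler_peMr// lerDl.
  rewrite -mulrA ler_wpM2l ?invr_ge0 ?(ltW C10)//.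
  have -> : (n%:R + n%:R * `|y|) * (1 + `|x|) =
    n%:R * (`|x| + `|y|) + n%:R * (1 + `|x| * `|y|) by ring.
  by rewrite lerDl mulr_ge0// addr_ge0// mulr_ge0.
(* Undoing the exponent 1 / (2 tau) raises the linear bound to the power 2 tau, which an integer p
   above it turns into a polynomial bound. *)
have [p ptau] : exists p : nat, 2 * tau <= p%:R.
  by exists (Num.bound (2 * tau)); rewrite ltW// archi_boundP// mulr_ge0// ltW.
have tau20 : 0 < 2 * tau by rewrite mulr_gt0.
exists (`|f v0| + (D `^ (2 * tau) + q0 / 2)), p; split.
  by rewrite !addr_ge0 ?powR_ge0// divr_ge0// ltW.
move=> x; have p1 : 1 <= (1 + `|x|) ^+ p by rewrite exprn_ege1// lerDl.
have q20 : 0 <= q0 / 2 by rewrite divr_ge0// ltW.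
have P0 : 0 <= D `^ (2 * tau) := powR_ge0 _ _.
have [xM|xM] := ltP (enorm x) M.
  rewrite (le_trans (small _ xM))// mulrDl ler_wpDr ?ler_peMr//.
  by rewrite mulr_ge0 ?addr_ge0// ltW// (lt_le_trans _ p1).
have fg : q0 / 2 + f x = g x `^ (2 * tau).
  by rewrite /g -powRrM mul1r mulVf ?gt_eqF// powRr1// ltW.
have h : q0 / 2 + f x <= D `^ (2 * tau) * (1 + `|x|) ^+ p.
  rewrite fg (@le_trans _ _ ((D * (1 + `|x|)) `^ (2 * tau)))//.
    apply: (ge0_ler_powR (ltW tau20)); rewrite ?nnegrE ?powR_ge0 ?gle//.
    exact: mulr_ge0 D0 (addr_ge0 ler01 (normr_ge0 x)).
  rewrite (powRM _ D0 (addr_ge0 ler01 (normr_ge0 x))); apply: ler_wpM2l => //.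
  by rewrite -powR_mulrn ?addr_ge0// ler_powR// lerDl.
have fq' : `|f x| <= q0 / 2 + f x + q0 / 2.
  by rewrite ler_norml; apply/andP; split; have := fq x; lra.
apply: le_trans fq' _; rewrite mulrDl ler_wpDl ?mulr_ge0 ?(le_trans _ p1)//.
by rewrite mulrDl lerD// ler_peMr.
Qed.

End decay.

(** * Rapid decay of Schwartz functions and of their transforms *)

Section schwartz_transform.
Context {R : realType} {n : nat}.
Local Notation mu := (@lebesgue_rV R n).
Implicit Types (f g : 'rV[R]_n -> R) (x y xi : 'rV[R]_n) (i : 'I_n).

Lemma mderiv0 f : mderiv (fun=> 0%N) f = f.
Proof. by rewrite /mderiv; elim: (enum 'I_n) => //= i s ->. Qed.

Lemma mderiv_iter N i f :
  mderiv (fun j => if j == i then N else 0%N) f = iter N (partial i) f.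
Proof.
have : uniq (enum 'I_n) by exact: enum_uniq.
rewrite /mderiv; have : i \in enum 'I_n by rewrite mem_enum.
elim: (enum 'I_n) => //= j s ih; rewrite inE; have [<- _|ij /= si] := eqVneq i j.
  move=> /andP[/negP jNs us]; congr (iter _ _ _).
  elim: s jNs us {ih} => //= k s ih; rewrite inE => iks /andP[_ us].
  have [ki|ki] := eqVneq k i; first by exfalso; apply: iks; rewrite ki eqxx.
  by rewrite /= ih// => si; apply: iks; rewrite si orbT.
by move=> /andP[_ us]; rewrite ih.
Qed.

Lemma schwartz_mderiv_decay (be : 'I_n -> nat) K f : schwartzR f ->
  exists B, forall x, (1 + `|x|) ^+ K * `|mderiv be f x| <= B.
Proof.
move=> [_ sf]; apply: poly_decay.
  have [B fB] := sf (fun=> 0%N) be; exists B => x.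
  by have := fB x; rewrite big1 ?mul1r// => i _; rewrite expr0.
move=> i; have [B fB] := sf (fun j => if j == i then K else 0%N) be; exists B => x.
have := fB x; rewrite (bigD1 i)//= eqxx big1 ?mulr1; last first.
  by move=> j /negbTE ->; rewrite expr0.
by rewrite normrM normrX.
Qed.

Lemma schwartz_decay K f : schwartzR f ->
  exists B, forall x, (1 + `|x|) ^+ K * `|f x| <= B.
Proof. by move=> /(schwartz_mderiv_decay (fun=> 0%N) K); rewrite mderiv0. Qed.

Lemma schwartz_partial_weight N i f : schwartzR f ->
  exists B, forall x, `|iter N (partial i) f x| <= B * weight x.
Proof.
move=> /(schwartz_mderiv_decay (fun j => if j == i then N else 0%N) (2 * n))[B fB].
by exists B; apply: poly_weight_le => x; rewrite -mderiv_iter.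
Qed.

Lemma schwartz_smooth_iter N i f : schwartzR f ->
  continuous (iter N (partial i) f) /\
  forall x, derivable (iter N (partial i) f) x (delta_mx ord0 i).
Proof.
move=> [sf _]; have := sf (nseq N i).
have -> : foldr partial f (nseq N i) = iter N (partial i) f.
  by elim: N => //= N ->.
by move=> [? d]; split.
Qed.

Lemma schwartz_continuous f : schwartzR f -> continuous f.
Proof. by move=> [sf _]; case: (sf [::]). Qed.

Lemma L1_poly_decay (h : 'rV[R]_n -> R) f (C : R) p : measurable_fun setT h ->
  (forall x, `|h x| <= C * (1 + `|x|) ^+ p) -> measurable_fun setT f ->
  (exists B, forall x, (1 + `|x|) ^+ (p + 2 * n) * `|f x| <= B) ->
  L1 mu (fun x => h x * f x).
Proof.
move=> mh hC mf [B fB]; apply: (@L1_le _ _ _ _ _ (fun x => (C * B) * weight x)).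
- exact: measurable_funM.
- have C0 : 0 <= C.
    have := le_trans (normr_ge0 _) (hC 0); by rewrite pmulr_lge0// exprn_gt0// ltr_pwDl.
  apply: poly_weight_le => x; rewrite normrM.
  have -> : (1 + `|x|) ^+ (2 * n) * (`|h x| * `|f x|) =
    `|h x| * ((1 + `|x|) ^+ (2 * n) * `|f x|) by ring.
  apply: (@le_trans _ _ (C * (1 + `|x|) ^+ p * ((1 + `|x|) ^+ (2 * n) * `|f x|))).
    by rewrite ler_wpM2r// mulr_ge0// exprn_ge0// addr_ge0.
  by rewrite -mulrA (mulrA ((1 + `|x|) ^+ p)) -exprD ler_wpM2l.
- exact/L1Z/L1_weight.
Qed.

Lemma L1_poly_decay1 f : measurable_fun setT f ->
  (exists B, forall x, (1 + `|x|) ^+ (2 * n) * `|f x| <= B) -> L1 mu f.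
Proof.
move=> mf fB; have := @L1_poly_decay (cst 1) f 1 0 _ _ mf fB.
rewrite /cst (_ : (fun x => 1 * f x) = f); last by apply/funext => x; rewrite mul1r.
apply => //.
by move=> x; rewrite normr1 mul1r expr0.
Qed.

Lemma schwartz_L1 f : schwartzR f -> L1 mu f.
Proof.
move=> sf; apply: L1_poly_decay1; last exact: schwartz_decay.
by apply: continuous_measurable_rV; exact: schwartz_continuous.
Qed.

Lemma schwartz_bounded f : schwartzR f -> exists B, forall x, `|f x| <= B.
Proof.
by move=> /(schwartz_decay 0)[B fB]; exists B => x; rewrite -[leLHS]mul1r -(expr0 (1 + `|x|)).
Qed.

Lemma schwartz_iter_L1 N i f : schwartzR f -> L1 mu (iter N (partial i) f).
Proof.
move=> sf; apply: L1_poly_decay1.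
  by apply: continuous_measurable_rV; exact: (proj1 (schwartz_smooth_iter N i sf)).
by rewrite -mderiv_iter; exact: schwartz_mderiv_decay.
Qed.

Lemma is_derive_dir (h : R -> R) (t v b : R) : is_derive t (1 : R) h b ->
  is_derive t v h (v * b).
Proof.
move=> [dh hE]; have dif : differentiable h t by apply/derivable1_diffP.
split; first exact: diff_derivable.
by rewrite deriveE// -hE deriveE// -[X in 'd _ _ X]mulr1 linearZ.
Qed.

Lemma dotv_delta (h : R) i x xi :
  dotv (h *: delta_mx ord0 i + x) xi = h * xi ord0 i + dotv x xi.
Proof.
rewrite /dotv (eq_bigr (fun j => h * (j == i)%:R * xi ord0 j + x ord0 j * xi ord0 j)).
  rewrite big_split/= (bigD1 i)//= eqxx mulr1 big1 ?addr0// => j /negbTE ->.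
  by rewrite mulr0 mul0r.
by move=> j _; rewrite !mxE eqxx mulrDl.
Qed.

Lemma continuous_mul_rV f g : continuous f -> continuous g ->
  continuous (fun x => f x * g x).
Proof. by move=> cf cg x; exact: cvgM (cf x) (cg x). Qed.

Lemma continuous_add_rV f g : continuous f -> continuous g ->
  continuous (fun x => f x + g x).
Proof. by move=> cf cg x; exact: cvgD (cf x) (cg x). Qed.

Lemma continuous_dotvl xi : continuous (fun x => dotv x xi).
Proof.
have h (s : seq 'I_n) : continuous (fun x => \sum_(i <- s) x ord0 i * xi ord0 i).
  elim: s => [|j s ih].
    rewrite (_ : (fun _ => _) = cst 0); first exact: cst_continuous.
    by apply/funext => x; rewrite big_nil.
  rewrite (_ : (fun _ => _) = (fun x => x ord0 j * xi ord0 j +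
      \sum_(i <- s) x ord0 i * xi ord0 i)).
    apply: continuous_add_rV => //; apply: continuous_mul_rV.
      exact: coord_continuous.
    exact: cst_continuous.
  by apply/funext => x; rewrite big_cons.
exact: h.
Qed.

Lemma is_derive_trig (h : R -> R) (b : R) i x xi :
  is_derive (dotv x xi) (1 : R) h b ->
  is_derive x (delta_mx ord0 i) (fun x => h (dotv x xi)) (xi ord0 i * b).
Proof.
move=> /(@is_derive_dir _ _ (xi ord0 i)) d.
apply: (@is_derive_along _ _ _ h (fun x => dotv x xi) _ _ _ _ _ d) => t.
exact: dotv_delta.
Qed.

(** Integration by parts: [Rint_partial_eq0] is applied to f times the cosine or sine of x.xi, and
    the weight bounds supply its decay hypotheses. *)
Lemma transform_partial (B : R) i f xi : continuous f -> continuous (partial i f) ->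
  (forall x, derivable f x (delta_mx ord0 i)) ->
  (forall x, `|f x| <= B * weight x) ->
  (forall x, `|partial i f x| <= B * weight x) ->
  cos_transform (partial i f) xi = xi ord0 i * sin_transform f xi /\
  sin_transform (partial i f) xi = - (xi ord0 i * cos_transform f xi).
Proof.
move=> cf cpf df fB pfB.
have mf := continuous_measurable_rV cf; have mpf := continuous_measurable_rV cpf.
have lw := @L1_weight R n.
have lf : L1 mu f by exact: L1_le mf fB (L1Z B lw).
have lpf : L1 mu (partial i f) by exact: L1_le mpf pfB (L1Z B lw).
have parts (h h' : R -> R) : continuous h -> continuous h' ->
    (forall t, `|h t| <= 1) -> (forall t, `|h' t| <= 1) ->
    (forall t, is_derive t (1 : R) h (h' t)) ->
    \int[mu]_x (partial i f x * h (dotv x xi)) =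
    - (xi ord0 i * \int[mu]_x (f x * h' (dotv x xi))).
  move=> ch ch' h1 h1' dh.
  have ctrig (k : R -> R) : continuous k -> continuous (fun x => k (dotv x xi)).
    move=> ck x; apply: continuous_comp; [exact: continuous_dotvl|exact: ck].
  have ltrig (k : R -> R) g : continuous k -> (forall t, `|k t| <= 1) -> L1 mu g ->
      L1 mu (fun x => g x * k (dotv x xi)).
    move=> ck k1 lg; apply: (L1_bounded lg _ (fun x => k1 _)).
    by apply: continuous_measurable_rV; exact: ctrig.
  have dF x : is_derive x (delta_mx ord0 i) (fun x => f x * h (dotv x xi))
      (partial i f x * h (dotv x xi) + xi ord0 i * (f x * h' (dotv x xi))).
    have d1 : is_derive x (delta_mx ord0 i) f (partial i f x) by split.
    apply: is_derive_eq (is_deriveM d1 (is_derive_trig i (dh _))) _.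
    by rewrite /GRing.scale/=; ring.
  have G0 : \int[mu]_x (partial i f x * h (dotv x xi) +
      xi ord0 i * (f x * h' (dotv x xi))) = 0.
    apply: (@Rint_partial_eq0 _ _ i (fun x => f x * h (dotv x xi)) _
      (B * (1 + `|xi ord0 i|))) => //.
    - apply: continuous_add_rV.
        by apply: continuous_mul_rV => //; exact: ctrig.
      apply: continuous_mul_rV; first exact: cst_continuous.
      by apply: continuous_mul_rV => //; exact: ctrig.
    - move=> x; rewrite normrM (@le_trans _ _ (B * weight x))//.
        by rewrite (le_trans _ (fB x))// ler_piMr.
      rewrite mulrAC ler_peMr ?lerDl//; exact: le_trans (normr_ge0 _) (fB x).
    - move=> x; rewrite (le_trans (ler_normD _ _))// mulrDr mulr1 mulrDl.
      apply: lerD; first by rewrite normrM (le_trans _ (pfB x))// ler_piMr.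
      rewrite normrM (mulrAC B) (mulrC _ `|xi ord0 i|) ler_wpM2l// normrM.
      by rewrite (le_trans _ (fB x))// ler_piMr.
  rewrite RintD ?RintZ in G0; [|exact: ltrig|exact: ltrig|exact/L1Z/ltrig].
  by apply/eqP; rewrite -addr_eq0; apply/eqP.
split.
  rewrite /cos_transform (parts cos (fun t => - sin t)).
  - rewrite -mulrN /sin_transform; congr (_ * _).
    transitivity (- 1 * \int[mu]_x (f x * - sin (dotv x xi))); first by rewrite mulN1r.
    rewrite -RintZ; last first.
      rewrite (_ : (fun _ => _) = (fun x => -1 * (f x * sin (dotv x xi)))).
        by apply: L1Z; exact: L1_sin.
      by apply/funext => x; ring.
    by apply: eq_Rintegral => x _; ring.
  - exact: continuous_cos.
  - by move=> t; apply: cvgN; exact: continuous_sin.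
  - exact: norm_cos_le1.
  - by move=> t; rewrite normrN norm_sin_le1.
rewrite /sin_transform (parts sin cos) //.
- exact: continuous_sin.
- exact: continuous_cos.
- exact: norm_sin_le1.
- exact: norm_cos_le1.
Qed.

(** A derivative exchanges the cosine and sine transforms up to sign, so it is the sum of their
    absolute values that reproduces itself, with one factor |xi_i| per derivative. *)
Lemma schwartz_transform_iter N i f xi : schwartzR f ->
  `|cos_transform (iter N (partial i) f) xi| +
  `|sin_transform (iter N (partial i) f) xi| =
  `|xi ord0 i| ^+ N * (`|cos_transform f xi| + `|sin_transform f xi|).
Proof.
move=> sf; elim: N => [|N ih]; first by rewrite expr0 mul1r.
have [c1 d1] := schwartz_smooth_iter N i sf.
have [c2 _] := schwartz_smooth_iter N.+1 i sf.
have [B1 hB1] := schwartz_partial_weight N i sf.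
have [B2 hB2] := schwartz_partial_weight N.+1 i sf.
have w0 x := ltW (weight_gt0 x).
have hB1' x : `|iter N (partial i) f x| <= Num.max B1 B2 * weight x.
  by rewrite (le_trans (hB1 x))// ler_wpM2r// le_max lexx.
have hB2' x : `|iter N.+1 (partial i) f x| <= Num.max B1 B2 * weight x.
  by rewrite (le_trans (hB2 x))// ler_wpM2r// le_max lexx orbT.
have [-> ->] := transform_partial xi c1 c2 d1 hB1' hB2'.
by rewrite normrN !normrM -mulrDr addrC ih exprS mulrA.
Qed.

Lemma schwartz_transform_decay K f : schwartzR f ->
  (exists B, forall xi, (1 + `|xi|) ^+ K * `|cos_transform f xi| <= B) /\
  (exists B, forall xi, (1 + `|xi|) ^+ K * `|sin_transform f xi| <= B).
Proof.
move=> sf; have lf := schwartz_L1 sf.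
have ci i xi : `|xi ord0 i| ^+ K * (`|cos_transform f xi| + `|sin_transform f xi|) <=
    \int[mu]_x `|iter K (partial i) f x| + \int[mu]_x `|iter K (partial i) f x|.
  have lK := schwartz_iter_L1 K i sf.
  rewrite -schwartz_transform_iter//.
  by rewrite lerD ?norm_cos_transform ?norm_sin_transform.
split; apply: poly_decay.
- by exists (\int[mu]_x `|f x|) => xi; exact: norm_cos_transform.
- move=> i; eexists => xi; apply: le_trans (ci i xi).
  by rewrite ler_wpM2l ?exprn_ge0// lerDl.
- by exists (\int[mu]_x `|f x|) => xi; exact: norm_sin_transform.
- move=> i; eexists => xi; apply: le_trans (ci i xi).
  by rewrite ler_wpM2l ?exprn_ge0// lerDr.
Qed.

End schwartz_transform.

(** * The quadratic form of A(D) + V on Schwartz functions *)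

Section operator_form.
Context {R : realType} {n : nat}.
Local Notation mu := (@lebesgue_rV R n).
Local Notation K := ((2 * pi) ^+ n : R).
Implicit Types (x y xi : 'rV[R]_n).

Lemma Rint_eq (f g : 'rV[R]_n -> R) : f =1 g -> \int[mu]_x f x = \int[mu]_x g x.
Proof. by move=> fg; apply: eq_Rintegral => x _. Qed.

Section transform_of_complex.
Variables (u : 'rV[R]_n -> R[i]) (u1 u2 : 'rV[R]_n -> R).
Hypotheses (uE : forall x, u x = Complex (u1 x) (u2 x)) (l1 : L1 mu u1) (l2 : L1 mu u2).

Lemma Re_fourier xi :
  complex.Re (fourier u xi) = cos_transform u1 xi + sin_transform u2 xi.
Proof.
rewrite /fourier /cintegral /= /cos_transform /sin_transform.
rewrite -(RintD (L1_cos xi l1) (L1_sin xi l2)).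
by apply: Rint_eq => x; rewrite uE /= cosN sinN; ring.
Qed.

Lemma Im_fourier xi :
  complex.Im (fourier u xi) = cos_transform u2 xi - sin_transform u1 xi.
Proof.
rewrite /fourier /cintegral /= /cos_transform /sin_transform.
rewrite -(RintB (L1_cos xi l2) (L1_sin xi l1)).
by apply: Rint_eq => x; rewrite uE /= cosN sinN; ring.
Qed.

End transform_of_complex.

Variables (A V : 'rV[R]_n -> R) (CA CV : R) (pA pV : nat).
Hypotheses (cA : continuous A) (cV : continuous V)
  (gA : forall x, `|A x| <= CA * (1 + `|x|) ^+ pA)
  (gV : forall x, `|V x| <= CV * (1 + `|x|) ^+ pV).

Section schwartz_function.
Variable u : 'rV[R]_n -> R[i].
Hypothesis su : schwartz u.
Local Notation u1 := (fun x => complex.Re (u x)).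
Local Notation u2 := (fun x => complex.Im (u x)).
Local Notation a := (fun xi => cos_transform u1 xi + sin_transform u2 xi).
Local Notation b := (fun xi => cos_transform u2 xi - sin_transform u1 xi).

Let s1 : schwartzR u1. Proof. by case: su. Qed.
Let s2 : schwartzR u2. Proof. by case: su. Qed.
Let l1 : L1 mu u1. Proof. exact: schwartz_L1. Qed.
Let l2 : L1 mu u2. Proof. exact: schwartz_L1. Qed.
Let uE x : u x = Complex (u1 x) (u2 x). Proof. by rewrite /=; case: (u x). Qed.
Let mA : measurable_fun setT A. Proof. exact: continuous_measurable_rV. Qed.
Let mV : measurable_fun setT V. Proof. exact: continuous_measurable_rV. Qed.

Let L1_growth_transform (h : 'rV[R]_n -> R) : measurable_fun setT h ->
  (exists B, forall xi, (1 + `|xi|) ^+ (pA + 2 * n) * `|h xi| <= B) ->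
  L1 mu (fun xi => A xi * h xi).
Proof. by move=> mh hB; exact: L1_poly_decay mA gA mh hB. Qed.

Let L1_Aa : L1 mu (fun xi => A xi * a xi).
Proof.
have lc : L1 mu (fun xi => A xi * cos_transform u1 xi).
  apply: L1_growth_transform; first exact: measurable_cos_transform.
  exact: (proj1 (schwartz_transform_decay _ s1)).
have ls : L1 mu (fun xi => A xi * sin_transform u2 xi).
  apply: L1_growth_transform; first exact: measurable_sin_transform.
  exact: (proj2 (schwartz_transform_decay _ s2)).
by have := L1D lc ls; congr (L1 _ _); apply/funext => xi; ring.
Qed.

Let L1_Ab : L1 mu (fun xi => A xi * b xi).
Proof.
have lc : L1 mu (fun xi => A xi * cos_transform u2 xi).
  apply: L1_growth_transform; first exact: measurable_cos_transform.
  exact: (proj1 (schwartz_transform_decay _ s2)).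
have ls : L1 mu (fun xi => A xi * sin_transform u1 xi).
  apply: L1_growth_transform; first exact: measurable_sin_transform.
  exact: (proj2 (schwartz_transform_decay _ s1)).
by have := L1B lc ls; congr (L1 _ _); apply/funext => xi; ring.
Qed.

(** [Rm] and [Im] are the real and imaginary parts of the inverse Fourier integral of A times
    [fourier u], without the factor (2 pi)^(-n). *)
Let Rm x := \int[mu]_xi (A xi * a xi * cos (dotv x xi) - A xi * b xi * sin (dotv x xi)).
Let Im x := \int[mu]_xi (A xi * b xi * cos (dotv x xi) + A xi * a xi * sin (dotv x xi)).

Let multiplierE x : multiplier A u x = Complex (K^-1 * Rm x) (K^-1 * Im x).
Proof.
rewrite /multiplier /cintegral.
have fE xi : fourier u xi = Complex (a xi) (b xi).
  by rewrite -(Re_fourier uE l1 l2) -(Im_fourier uE l1 l2); case: (fourier u xi).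
have -> : \int[mu]_xi complex.Re (expi (dotv x xi) * (A xi)%:C%C * fourier u xi) = Rm x.
  by apply: Rint_eq => xi; rewrite fE /=; ring.
have -> : \int[mu]_xi complex.Im (expi (dotv x xi) * (A xi)%:C%C * fourier u xi) = Im x.
  by apply: Rint_eq => xi; rewrite fE /=; ring.
by rewrite /GRing.mul /= !mul0r subr0 addr0.
Qed.

Let F z := u1 z.1 * (A z.2 * a z.2 * cos (dotv z.1 z.2) - A z.2 * b z.2 * sin (dotv z.1 z.2)) +
  u2 z.1 * (A z.2 * b z.2 * cos (dotv z.1 z.2) + A z.2 * a z.2 * sin (dotv z.1 z.2)).

Let Rker z := A z.2 * a z.2 * cos (dotv z.1 z.2) - A z.2 * b z.2 * sin (dotv z.1 z.2).
Let Iker z := A z.2 * b z.2 * cos (dotv z.1 z.2) + A z.2 * a z.2 * sin (dotv z.1 z.2).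

Let mcosz : measurable_fun setT (fun z : 'rV[R]_n * 'rV[R]_n => cos (dotv z.1 z.2)).
Proof. exact: measurableT_comp measurable_cosR (@measurable_dotv R n). Qed.
Let msinz : measurable_fun setT (fun z : 'rV[R]_n * 'rV[R]_n => sin (dotv z.1 z.2)).
Proof. exact: measurableT_comp measurable_sinR (@measurable_dotv R n). Qed.
Let mAaz : measurable_fun setT (fun z : 'rV[R]_n * 'rV[R]_n => A z.2 * a z.2).
Proof. exact: measurableT_comp (L1_measurable L1_Aa) measurable_snd. Qed.
Let mAbz : measurable_fun setT (fun z : 'rV[R]_n * 'rV[R]_n => A z.2 * b z.2).
Proof. exact: measurableT_comp (L1_measurable L1_Ab) measurable_snd. Qed.
Let mRker : measurable_fun setT Rker.
Proof. by apply: measurable_funB; exact: measurable_funM. Qed.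
Let mIker : measurable_fun setT Iker.
Proof. by apply: measurable_funD; exact: measurable_funM. Qed.

Let dom xi := `|A xi * a xi| + `|A xi * b xi|.
Let ldom : L1 mu dom. Proof. exact: L1D (L1_norm L1_Aa) (L1_norm L1_Ab). Qed.

Let Rker_le x xi : `|Rker (x, xi)| <= dom xi.
Proof.
rewrite (le_trans (ler_normB _ _))// lerD//= normrM ler_piMr//.
  exact: norm_cos_le1.
exact: norm_sin_le1.
Qed.

Let Iker_le x xi : `|Iker (x, xi)| <= dom xi.
Proof.
rewrite (le_trans (ler_normD _ _))// addrC lerD//= normrM ler_piMr//.
  exact: norm_sin_le1.
exact: norm_cos_le1.
Qed.

Let mRm : measurable_fun setT Rm.
Proof. exact: (measurable_Rint_param mRker ldom Rker_le). Qed.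

Let mIm : measurable_fun setT Im.
Proof. exact: (measurable_Rint_param mIker ldom Iker_le). Qed.

Let L1_Rker x : L1 mu (fun xi => Rker (x, xi)).
Proof.
by apply: (L1_le _ (Rker_le x) ldom); exact: measurableT_comp mRker (pair1_measurable x).
Qed.

Let L1_Iker x : L1 mu (fun xi => Iker (x, xi)).
Proof.
by apply: (L1_le _ (Iker_le x) ldom); exact: measurableT_comp mIker (pair1_measurable x).
Qed.

Let Rm_le x : `|Rm x| <= \int[mu]_xi dom xi.
Proof. exact: (Rint_norm_le (L1_Rker x) ldom (Rker_le x)). Qed.

Let Im_le x : `|Im x| <= \int[mu]_xi dom xi.
Proof. exact: (Rint_norm_le (L1_Iker x) ldom (Iker_le x)). Qed.

Let L1_pairing : L1 mu (fun x => u1 x * Rm x + u2 x * Im x).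
Proof. exact: L1D (L1_bounded l1 mRm Rm_le) (L1_bounded l2 mIm Im_le). Qed.

Let mF : measurable_fun setT F.
Proof.
apply: measurable_funD; apply: measurable_funM => //.
  exact: measurableT_comp (L1_measurable l1) measurable_fst.
exact: measurableT_comp (L1_measurable l2) measurable_fst.
Qed.

Let F_le x xi : `|F (x, xi)| <= (`|u1 x| + `|u2 x|) * dom xi.
Proof.
rewrite (le_trans (ler_normD _ _))// mulrDl !normrM.
by apply: lerD; apply: ler_wpM2l => //; [exact: Rker_le|exact: Iker_le].
Qed.

(** Exchanging x and xi makes the inner integral over x rebuild the Fourier transform of u, whose
    parts are a and b; what remains is A (a^2 + b^2). The rapid decay of the transforms provides the
    product majorant. *)
Let pairing : \int[mu]_x (u1 x * Rm x + u2 x * Im x) =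
  \int[mu]_xi (A xi * fourier_sq u1 u2 xi).
Proof.
have -> : \int[mu]_x (u1 x * Rm x + u2 x * Im x) = \int[mu]_x \int[mu]_xi F (x, xi).
  apply: Rint_eq => x; rewrite -(RintZ (u1 x) (L1_Rker x)) -(RintZ (u2 x) (L1_Iker x)).
  by rewrite -(RintD (L1Z _ (L1_Rker x)) (L1Z _ (L1_Iker x))).
rewrite (Rint_fubini mF (L1D (L1_norm l1) (L1_norm l2)) ldom F_le).
apply: Rint_eq => xi.
have lc1 := L1_cos xi l1; have ls1 := L1_sin xi l1.
have lc2 := L1_cos xi l2; have ls2 := L1_sin xi l2.
transitivity (\int[mu]_x (A xi * a xi * (u1 x * cos (dotv x xi) + u2 x * sin (dotv x xi)) +
    A xi * b xi * (u2 x * cos (dotv x xi) - u1 x * sin (dotv x xi)))).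
  by apply: Rint_eq => x; rewrite /F /=; ring.
have la := L1D lc1 ls2; have lb := L1B lc2 ls1.
rewrite (RintD (L1Z (A xi * a xi) la) (L1Z (A xi * b xi) lb)) (RintZ _ la) (RintZ _ lb).
rewrite (RintD lc1 ls2) (RintB lc2 ls1) /fourier_sq /cos_transform /sin_transform.
by ring.
Qed.

Let L1_fourier_weighted : L1 mu (fun xi => A xi * fourier_sq u1 u2 xi).
Proof.
pose B1 := \int[mu]_x `|u1 x|; pose B2 := \int[mu]_x `|u2 x|.
have ma : measurable_fun setT a.
  by apply: measurable_funD; [exact: measurable_cos_transform|exact: measurable_sin_transform].
have mb : measurable_fun setT b.
  by apply: measurable_funB; [exact: measurable_cos_transform|exact: measurable_sin_transform].
have aB xi : `|a xi| <= B1 + B2.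
  by rewrite (le_trans (ler_normD _ _))// lerD ?norm_cos_transform ?norm_sin_transform.
have bB xi : `|b xi| <= B2 + B1.
  by rewrite (le_trans (ler_normB _ _))// lerD ?norm_cos_transform ?norm_sin_transform.
have := L1D (L1_bounded L1_Aa ma aB) (L1_bounded L1_Ab mb bB).
by congr (L1 _ _); apply/funext => xi; rewrite /fourier_sq; ring.
Qed.

Let L1_potential (f : 'rV[R]_n -> R) : schwartzR f -> L1 mu (fun x => V x * f x ^+ 2).
Proof.
move=> sf; have [B fB] := schwartz_bounded sf.
have mf : measurable_fun setT f by apply: continuous_measurable_rV; exact: schwartz_continuous.
apply: (L1_poly_decay mV gV (measurable_funX 2 mf)).
have [C fC] := schwartz_decay (pV + 2 * n) sf; exists (C * B) => x.
rewrite expr2 normrM mulrA ler_pM// mulr_ge0// exprn_ge0// addr_ge0//.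
Qed.

Lemma schwartz_quadratic_form :
  [/\ measurable_fun setT (fun x => complex.Re (AD_plus_V A V u x)),
      measurable_fun setT (fun x => complex.Im (AD_plus_V A V u x)),
      L1 mu (fun x => V x * (u1 x ^+ 2 + u2 x ^+ 2)),
      L1 mu (fun xi => A xi * fourier_sq u1 u2 xi) &
      \int[mu]_x (complex.Re (AD_plus_V A V u x) * u1 x +
                  complex.Im (AD_plus_V A V u x) * u2 x) =
      K^-1 * \int[mu]_xi (A xi * fourier_sq u1 u2 xi) +
      \int[mu]_x (V x * (u1 x ^+ 2 + u2 x ^+ 2))].
Proof.
have RE x : complex.Re (AD_plus_V A V u x) = K^-1 * Rm x + V x * u1 x.
  by rewrite /AD_plus_V multiplierE (uE x) /=; ring.
have IE x : complex.Im (AD_plus_V A V u x) = K^-1 * Im x + V x * u2 x.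
  by rewrite /AD_plus_V multiplierE (uE x) /=; ring.
have mu1 := L1_measurable l1; have mu2 := L1_measurable l2.
have lV : L1 mu (fun x => V x * (u1 x ^+ 2 + u2 x ^+ 2)).
  have := L1D (L1_potential s1) (L1_potential s2).
  by congr (L1 _ _); apply/funext => x; ring.
split => //.
- rewrite (_ : (fun _ => _) = (fun x => K^-1 * Rm x + V x * u1 x)); last exact/funext.
  by apply: measurable_funD; exact: measurable_funM.
- rewrite (_ : (fun _ => _) = (fun x => K^-1 * Im x + V x * u2 x)); last exact/funext.
  by apply: measurable_funD; exact: measurable_funM.
- rewrite -pairing -(RintZ _ L1_pairing) -(RintD (L1Z _ L1_pairing) lV).
  by apply: Rint_eq => x; rewrite RE IE; ring.
Qed.

End schwartz_function.
End operator_form.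

(** * Localization in phase space *)

Section localization.
Context {R : realType} {n : nat}.
Local Notation mu := (@lebesgue_rV R n).
Local Notation K := ((2 * pi) ^+ n : R).
Implicit Types (x y xi : 'rV[R]_n) (f g : 'rV[R]_n -> R) (E : set 'rV[R]_n).

Definition truncate E f x : R := f x * \1_E x.

Lemma indic_le1 E x : `|\1_E x : R| <= 1.
Proof. by rewrite indicE; case: (x \in E); rewrite ?normr1 ?normr0. Qed.

Lemma indic_ge0 E x : 0 <= \1_E x :> R.
Proof. by rewrite indicE. Qed.

Lemma L1_truncate E f : measurable E -> L1 mu f -> L1 mu (truncate E f).
Proof.
move=> mE lf; apply: (L1_bounded lf _ (indic_le1 E)).
exact: measurable_indic.
Qed.

Lemma L1_truncate_sq E f : measurable E -> L1 mu (fun x => f x ^+ 2) ->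
  L1 mu (fun x => truncate E f x ^+ 2).
Proof.
move=> mE lf; have := L1_truncate mE lf; congr (L1 _ _); apply/funext => x.
by rewrite /truncate indicE; case: (x \in E); rewrite ?mulr1 ?mulr0 ?expr0n.
Qed.

(** Parallelogram identity: the difference of the two sides is the squared modulus of the transform
    of the difference. *)
Lemma fourier_sq_add_le f f' g g' xi : L1 mu f -> L1 mu f' -> L1 mu g -> L1 mu g' ->
  fourier_sq (fun x => f x + f' x) (fun x => g x + g' x) xi <=
  2 * fourier_sq f g xi + 2 * fourier_sq f' g' xi.
Proof.
move=> lf lf' lg lg'.
have cE (h h' : 'rV[R]_n -> R) : L1 mu h -> L1 mu h' ->
    cos_transform (fun x => h x + h' x) xi = cos_transform h xi + cos_transform h' xi.
  move=> lh lh'; rewrite /cos_transform -(RintD (L1_cos xi lh) (L1_cos xi lh')).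
  by apply: Rint_eq => x; ring.
have sE (h h' : 'rV[R]_n -> R) : L1 mu h -> L1 mu h' ->
    sin_transform (fun x => h x + h' x) xi = sin_transform h xi + sin_transform h' xi.
  move=> lh lh'; rewrite /sin_transform -(RintD (L1_sin xi lh) (L1_sin xi lh')).
  by apply: Rint_eq => x; ring.
rewrite /fourier_sq !cE// !sE// -subr_ge0.
set a := cos_transform f xi; set b := sin_transform f xi.
set c := cos_transform g xi; set d := sin_transform g xi.
set a' := cos_transform f' xi; set b' := sin_transform f' xi.
set c' := cos_transform g' xi; set d' := sin_transform g' xi.
rewrite (_ : _ - _ = (a + d - a' - d') ^+ 2 + (c - b - c' + b') ^+ 2); last by ring.
by rewrite addr_ge0 ?sqr_ge0.
Qed.

Variables (A V : 'rV[R]_n -> R) (CA CV : R) (pA pV : nat) (q1 q2 Lam : R).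
Hypotheses (cA : continuous A) (cV : continuous V)
  (gA : forall x, `|A x| <= CA * (1 + `|x|) ^+ pA)
  (gV : forall x, `|V x| <= CV * (1 + `|x|) ^+ pV)
  (V0 : forall x, 0 <= V x + q1) (A0 : forall xi, 0 <= A xi + q2) (Lam0 : 0 < Lam).

Let E := [set x : 'rV[R]_n | V x + q1 <= Lam].
Let F := [set xi : 'rV[R]_n | A xi + q2 <= Lam].

Lemma measurable_sublevel (h : 'rV[R]_n -> R) (c d : R) : continuous h ->
  measurable [set x : 'rV[R]_n | h x + c <= d].
Proof.
move=> ch; rewrite (_ : [set x | _] = h @^-1` `]-oo, d - c]).
  rewrite -[X in measurable X]setTI.
  by apply: continuous_measurable_rV => //; exact: measurable_itv.
by apply/seteqP; split => x /=; rewrite in_itv/= lerBrDr.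
Qed.

Let mE : measurable E. Proof. exact: measurable_sublevel. Qed.
Let mF : measurable F. Proof. exact: measurable_sublevel. Qed.

(* Outside F, Lam <= A + q2; outside E, Lam <= V + q1; the quadratic form controls both. *)
Lemma schwartz_localization (u : 'rV[R]_n -> R[i])
    (u1 := fun x => complex.Re (u x)) (u2 := fun x => complex.Im (u x))
    (X := \int[mu]_x (u1 x ^+ 2 + u2 x ^+ 2)) : schwartz u ->
  K * X <= 2 * \int[mu]_xi (\1_F xi * fourier_sq (truncate E u1) (truncate E u2) xi) +
    4 * K / Lam * (\int[mu]_x (complex.Re (AD_plus_V A V u x) * u1 x +
                               complex.Im (AD_plus_V A V u x) * u2 x) +
                   (`|q1| + 2 * `|q2|) * X).
Proof.
move=> su; have [s1 s2] := su.
have l1 : L1 mu u1 := schwartz_L1 s1; have l2 : L1 mu u2 := schwartz_L1 s2.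
have [B1 b1] := schwartz_bounded s1; have [B2 b2] := schwartz_bounded s2.
have q1l := L1_bounded_sq l1 b1; have q2l := L1_bounded_sq l2 b2.
have [_ _ lV lA ->] := schwartz_quadratic_form cA cV gA gV su.
have lX : L1 mu (fun x => u1 x ^+ 2 + u2 x ^+ 2) := L1D q1l q2l.
have K0 : 0 < K by rewrite exprn_gt0// mulr_gt0// pi_gt0.
have XE : X = \int[mu]_x u1 x ^+ 2 + \int[mu]_x u2 x ^+ 2 by exact: RintD.
have X0 : 0 <= X by apply: Rintegral_ge0 => x _; rewrite addr_ge0 ?sqr_ge0.
have [lfs fs_le] := fourier_sq_le l1 l2 q1l q2l.
have fs_ge : K * X <= \int[mu]_xi fourier_sq u1 u2 xi.
  rewrite XE; apply: (fourier_sq_ge (M := Num.max B1 B2)) => //.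
  - exact: schwartz_continuous s1.
  - exact: schwartz_continuous s2.
  - by move=> x; rewrite le_max b1.
  - by move=> x; rewrite le_max b2 orbT.
rewrite -XE in fs_le.
have mEc : measurable (~` E) := measurableC mE.
have le1 := L1_truncate mE l1; have le2 := L1_truncate mE l2.
have lc1 := L1_truncate mEc l1; have lc2 := L1_truncate mEc l2.
have [lfE _] := fourier_sq_le le1 le2 (L1_truncate_sq mE q1l) (L1_truncate_sq mE q2l).
have [lfC fC_le] := fourier_sq_le lc1 lc2 (L1_truncate_sq mEc q1l) (L1_truncate_sq mEc q2l).
set fsE := fourier_sq (truncate E u1) (truncate E u2) in lfE *.
set fsC := fourier_sq (truncate (~` E) u1) (truncate (~` E) u2) in lfC fC_le *.
have m1F : measurable_fun setT (\1_F : _ -> R) by exact: measurable_indic.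
have lFE : L1 mu (fun xi => \1_F xi * fsE xi).
  by under eq_fun do rewrite mulrC; exact: L1_bounded lfE m1F (indic_le1 F).
have lAq : L1 mu (fun xi => (A xi + q2) * fourier_sq u1 u2 xi).
  by have := L1D lA (L1Z q2 lfs); congr (L1 _ _); apply/funext => xi; ring.
have lVq : L1 mu (fun x => (V x + q1) * (u1 x ^+ 2 + u2 x ^+ 2)).
  by have := L1D lV (L1Z q1 lX); congr (L1 _ _); apply/funext => xi; ring.
have LamV0 : 0 <= Lam^-1 by rewrite invr_ge0 ltW.
have split_E f : f = (fun x => truncate E f x + truncate (~` E) f x).
  apply/funext => x; rewrite /truncate !indicE in_setC; case: (x \in E) => /=.
    by rewrite mulr1 mulr0 addr0.
  by rewrite mulr0 mulr1 add0r.
(* On F the function is split into its parts inside and outside E. Off F the factor (A + q2) / Lam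
   is at least 1, so the last term alone dominates. *)
have pw xi : fourier_sq u1 u2 xi <= 2 * (\1_F xi * fsE xi) + 2 * fsC xi +
    Lam^-1 * ((A xi + q2) * fourier_sq u1 u2 xi).
  have fs0 := fourier_sq_ge0 u1 u2 xi.
  have fE0 := fourier_sq_ge0 (truncate E u1) (truncate E u2) xi.
  have fC0 := fourier_sq_ge0 (truncate (~` E) u1) (truncate (~` E) u2) xi.
  have [xF|xF] := pselect (F xi).
    rewrite indicE mem_set// mul1r ler_wpDr//.
      by rewrite mulr_ge0// mulr_ge0.
    by have := fourier_sq_add_le xi le1 lc1 le2 lc2; rewrite -(split_E u1) -(split_E u2).
  rewrite indicE memNset// mul0r mulr0 add0r ler_wpDl ?mulr_ge0// mulrA.
  rewrite ler_peMl// -ler_pdivrMl ?invr_gt0// invrK mulr1.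
  by move/negP: xF; rewrite -ltNge => /ltW.
have step1 : \int[mu]_xi fourier_sq u1 u2 xi <=
    2 * \int[mu]_xi (\1_F xi * fsE xi) + 2 * \int[mu]_xi fsC xi +
    Lam^-1 * \int[mu]_xi ((A xi + q2) * fourier_sq u1 u2 xi).
  rewrite -(RintZ 2 lFE) -(RintZ 2 lfC) -(RintZ Lam^-1 lAq).
  rewrite -(RintD (L1Z 2 lFE) (L1Z 2 lfC)) -(RintD (L1D (L1Z 2 lFE) (L1Z 2 lfC)) (L1Z _ lAq)).
  apply: Rint_le => //.
  exact: L1D (L1D (L1Z 2 lFE) (L1Z 2 lfC)) (L1Z _ lAq).
(* Chebyshev's inequality outside E, where (V + q1) / Lam is at least 1. *)
have trC : \int[mu]_x truncate (~` E) u1 x ^+ 2 + \int[mu]_x truncate (~` E) u2 x ^+ 2 <=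
    Lam^-1 * \int[mu]_x ((V x + q1) * (u1 x ^+ 2 + u2 x ^+ 2)).
  have t1 := L1_truncate_sq mEc q1l; have t2 := L1_truncate_sq mEc q2l.
  rewrite -(RintD t1 t2) -(RintZ Lam^-1 lVq).
  apply: Rint_le; [exact: L1D|exact: L1Z|move=> x].
  have u0 : 0 <= u1 x ^+ 2 + u2 x ^+ 2 by rewrite addr_ge0 ?sqr_ge0.
  rewrite /truncate !indicE in_setC; have [xE|xE] := pselect (E x).
    rewrite mem_set//= !mulr0 expr0n addr0 mulr_ge0// mulr_ge0//.
  rewrite memNset//= !mulr1 mulrA ler_peMl// -ler_pdivrMl ?invr_gt0// invrK mulr1.
  by move/negP: xE; rewrite -ltNge => /ltW.
have VE : \int[mu]_x ((V x + q1) * (u1 x ^+ 2 + u2 x ^+ 2)) =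
    \int[mu]_x (V x * (u1 x ^+ 2 + u2 x ^+ 2)) + q1 * X.
  rewrite -(RintZ q1 lX) -(RintD lV (L1Z q1 lX)).
  by apply: Rint_eq => x; ring.
have AE : \int[mu]_xi ((A xi + q2) * fourier_sq u1 u2 xi) =
    \int[mu]_xi (A xi * fourier_sq u1 u2 xi) + q2 * \int[mu]_xi fourier_sq u1 u2 xi.
  rewrite -(RintZ q2 lfs) -(RintD lA (L1Z q2 lfs)).
  by apply: Rint_eq => x; ring.
have A'0 : 0 <= \int[mu]_xi ((A xi + q2) * fourier_sq u1 u2 xi).
  by apply: Rintegral_ge0 => x _; rewrite mulr_ge0// fourier_sq_ge0.
set T := \int[mu]_xi (\1_F xi * fsE xi) in step1 *.
set IA := \int[mu]_xi (A xi * fourier_sq u1 u2 xi) in AE *.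
set IV := \int[mu]_x (V x * (u1 x ^+ 2 + u2 x ^+ 2)) in VE *.
set IF := \int[mu]_xi fourier_sq u1 u2 xi in fs_ge fs_le step1 AE.
set IC := \int[mu]_xi fsC xi in fC_le step1.
rewrite AE in step1 A'0; rewrite VE in trC.
have IF0 : 0 <= IF by apply: le_trans fs_ge; rewrite mulr_ge0// ltW.
have IC_le : IC <= 2 * K * (Lam^-1 * (IV + q1 * X)).
  by apply: le_trans fC_le _; rewrite ler_wpM2l// mulr_ge0// ltW.
(* The sign of q2 is unknown, so the upper Plancherel bound with its factor 2 is used; this is where
   2 |q2| in the statement comes from. *)
have q2IF : q2 * IF <= `|q2| * (2 * K * X).
  apply: (@le_trans _ _ (`|q2| * IF)); first by rewrite ler_wpM2r// ler_norm.
  by rewrite ler_wpM2l.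
have q1X : q1 * X <= `|q1| * X by rewrite ler_wpM2r// ler_norm.
have -> : 4 * K / Lam * (K^-1 * IA + IV + (`|q1| + 2 * `|q2|) * X) =
    Lam^-1 * (4 * (IA + `|q2| * (2 * K * X))) + Lam^-1 * (4 * K * (IV + `|q1| * X)).
  by field; rewrite !gt_eqF.
(* The V part carries 4 = 2 * 2, one factor from splitting u along E and one from [fourier_sq_le].
   The nonnegative A part is enlarged by the same 4, so that both recombine into the quadratic
   form. *)
have s2' : Lam^-1 * (IA + q2 * IF) <= Lam^-1 * (4 * (IA + `|q2| * (2 * K * X))).
  apply: ler_wpM2l => //; apply: (@le_trans _ _ (4 * (IA + q2 * IF))).
    by rewrite ler_peMl// ler1n.
  by rewrite ler_pM2l// lerD2l.
have s3' : 2 * IC <= Lam^-1 * (4 * K * (IV + `|q1| * X)).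
  apply: (@le_trans _ _ (2 * (2 * K * (Lam^-1 * (IV + q1 * X))))); first by rewrite ler_pM2l.
  have -> : 2 * (2 * K * (Lam^-1 * (IV + q1 * X))) = Lam^-1 * (4 * K * (IV + q1 * X)) by ring.
  apply: ler_wpM2l => //; apply: ler_wpM2l; first by rewrite mulr_ge0// ltW.
  by rewrite lerD2l.
apply: le_trans fs_ge _; apply: le_trans step1 _.
rewrite -addrA lerD2l addrC; exact: lerD.
Qed.

End localization.

(** * Orthonormal eigenfunctions *)

Section real_inner_product.
Context {R : realType} {n : nat}.
Local Notation mu := (@lebesgue_rV R n).
Local Notation fn := ('rV[R]_n -> R[i]).
Implicit Types (u v w : fn) (x xi : 'rV[R]_n) (a b c : R).

Definition norm_sq u x : R := complex.Re (u x) ^+ 2 + complex.Im (u x) ^+ 2.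

Definition finite_norm u : Prop :=
  [/\ measurable_fun setT (fun x => complex.Re (u x)),
      measurable_fun setT (fun x => complex.Im (u x)) & L1 mu (norm_sq u)].

(** [re_prod] and [im_prod] are the real and imaginary parts of u times the conjugate of v. *)
Definition re_prod u v x : R :=
  complex.Re (u x) * complex.Re (v x) + complex.Im (u x) * complex.Im (v x).

Definition im_prod u v x : R :=
  complex.Im (u x) * complex.Re (v x) - complex.Re (u x) * complex.Im (v x).

Definition re_inner u v : R := \int[mu]_x re_prod u v x.

Definition lin a u b v : fn := fun x => real_complex R a * u x + real_complex R b * v x.

Lemma norm_sq_ge0 u x : 0 <= norm_sq u x.
Proof. by rewrite addr_ge0 ?sqr_ge0. Qed.

Lemma Re_lin a u b v x :
  complex.Re (lin a u b v x) = a * complex.Re (u x) + b * complex.Re (v x).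
Proof. by rewrite /lin; case: (u x) => ? ?; case: (v x) => ? ? /=; ring. Qed.

Lemma Im_lin a u b v x :
  complex.Im (lin a u b v x) = a * complex.Im (u x) + b * complex.Im (v x).
Proof. by rewrite /lin; case: (u x) => ? ?; case: (v x) => ? ? /=; ring. Qed.

Lemma integral_norm_sq u :
  (\int[mu]_x (norm_sq u x)%:E = L2norm u `^ 2)%E.
Proof.
rewrite /L2norm poweR_Lnorm//; apply: eq_integral => x _.
rewrite /= /Normc.normc /norm_sq; case: (u x) => p q /=.
rewrite ger0_norm ?sqrtr_ge0// powR_mulrn ?sqrtr_ge0// sqr_sqrtr//.
by rewrite addr_ge0 ?sqr_ge0.
Qed.

Lemma measurable_norm_sq u : measurable_fun setT (fun x => complex.Re (u x)) ->
  measurable_fun setT (fun x => complex.Im (u x)) -> measurable_fun setT (norm_sq u).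
Proof. by move=> mr mi; apply: measurable_funD; exact: measurable_funX. Qed.

Lemma L2_finite_norm u : L2 u <-> finite_norm u.
Proof.
split=> [[mr mi uoo]|[mr mi l]]; split => //.
  apply: L1_lt_pinfty; first exact: measurable_norm_sq.
    exact: norm_sq_ge0.
  by rewrite integral_norm_sq; exact: poweR_lty.
apply: (@lty_poweRy _ _ 2) => //.
by rewrite -integral_norm_sq EFin_Rintegral// ltry.
Qed.

Lemma re_inner_sq u : re_inner u u = \int[mu]_x norm_sq u x.
Proof. by apply: Rint_eq => x; rewrite /re_prod /norm_sq !expr2. Qed.

Lemma re_inner_ge0 u : 0 <= re_inner u u.
Proof. by rewrite re_inner_sq; apply: Rintegral_ge0 => x _; exact: norm_sq_ge0. Qed.

Lemma L2norm_lt_re_inner u (e : R) :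
  measurable_fun setT (fun x => complex.Re (u x)) ->
  measurable_fun setT (fun x => complex.Im (u x)) ->
  0 <= e -> (L2norm u < e%:E)%E -> finite_norm u /\ re_inner u u <= e ^+ 2.
Proof.
move=> mr mi e0 ue.
have fu : finite_norm u by apply/L2_finite_norm; split => //; exact: lt_trans ue (ltry _).
split => //; have [_ _ l] := fu.
rewrite re_inner_sq -lee_fin -EFin_Rintegral// integral_norm_sq.
have -> : (e ^+ 2)%:E = (e%:E `^ 2)%E by rewrite poweR_EFin powR_mulrn.
by rewrite gt0_ler_poweR ?in_itv/= ?leey ?andbT ?lee_fin ?Lnorm_ge0// ltW.
Qed.

Lemma norm_mul_le (p q : R) : `|p * q| <= p ^+ 2 + q ^+ 2.
Proof.
have h : 0 <= (p + q) ^+ 2 + p ^+ 2 + q ^+ 2 by rewrite !addr_ge0 ?sqr_ge0.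
have h' : 0 <= (p - q) ^+ 2 + p ^+ 2 + q ^+ 2 by rewrite !addr_ge0 ?sqr_ge0.
rewrite ler_norml; apply/andP; split; rewrite -subr_ge0; nra.
Qed.

Lemma L1_re_prod u v : finite_norm u -> finite_norm v -> L1 mu (re_prod u v).
Proof.
move=> [mr mi l] [mr' mi' l']; apply: L1_le (L1D l l').
  by apply: measurable_funD; exact: measurable_funM.
move=> x; rewrite (le_trans (ler_normD _ _))//.
rewrite /norm_sq addrACA lerD//; exact: norm_mul_le.
Qed.

Lemma L1_im_prod u v : finite_norm u -> finite_norm v -> L1 mu (im_prod u v).
Proof.
move=> [mr mi l] [mr' mi' l']; apply: L1_le (L1D l l').
  by apply: measurable_funB; exact: measurable_funM.
move=> x; rewrite (le_trans (ler_normB _ _))// addrC.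
rewrite /norm_sq [leRHS](_ : _ = (complex.Re (u x) ^+ 2 + complex.Im (v x) ^+ 2) +
  (complex.Im (u x) ^+ 2 + complex.Re (v x) ^+ 2)); last by ring.
by apply: lerD; exact: norm_mul_le.
Qed.

Lemma re_innerC u v : re_inner u v = re_inner v u.
Proof. by apply: Rint_eq => x; rewrite /re_prod; ring. Qed.

Lemma finite_norm_lin a u b v : finite_norm u -> finite_norm v ->
  finite_norm (lin a u b v).
Proof.
move=> fu fv; have [mr mi l] := fu; have [mr' mi' l'] := fv; split.
- rewrite (_ : (fun _ => _) = (fun x => a * complex.Re (u x) + b * complex.Re (v x))).
    by apply: measurable_funD; exact: measurable_funM.
  by apply/funext => x; exact: Re_lin.
- rewrite (_ : (fun _ => _) = (fun x => a * complex.Im (u x) + b * complex.Im (v x))).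
    by apply: measurable_funD; exact: measurable_funM.
  by apply/funext => x; exact: Im_lin.
- have := L1D (L1D (L1Z (a ^+ 2) l) (L1Z (b ^+ 2) l')) (L1Z (2 * a * b) (L1_re_prod fu fv)).
  congr (L1 _ _); apply/funext => x.
  by rewrite /norm_sq /re_prod Re_lin Im_lin; ring.
Qed.

Lemma re_inner_linl a u b v w : finite_norm u -> finite_norm v -> finite_norm w ->
  re_inner (lin a u b v) w = a * re_inner u w + b * re_inner v w.
Proof.
move=> fu fv fw; have l1 := L1_re_prod fu fw; have l2 := L1_re_prod fv fw.
rewrite /re_inner -(RintZ a l1) -(RintZ b l2) -(RintD (L1Z a l1) (L1Z b l2)).
by apply: Rint_eq => x; rewrite /re_prod Re_lin Im_lin; ring.
Qed.

Lemma re_inner_linr a u b v w : finite_norm u -> finite_norm v -> finite_norm w ->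
  re_inner w (lin a u b v) = a * re_inner w u + b * re_inner w v.
Proof. by move=> fu fv fw; rewrite re_innerC re_inner_linl// !(re_innerC w). Qed.

Lemma re_inner_cauchy_schwarz u v : finite_norm u -> finite_norm v ->
  re_inner u v ^+ 2 <= re_inner u u * re_inner v v.
Proof.
move=> fu fv.
have E a b : 0 <= a ^+ 2 * re_inner u u + 2 * a * b * re_inner u v + b ^+ 2 * re_inner v v.
  have := re_inner_ge0 (lin a u b v).
  rewrite re_inner_linl ?re_inner_linr//; last exact: finite_norm_lin.
  by rewrite (re_innerC v u); congr (0 <= _); ring.
have := re_inner_ge0 v; rewrite le_eqVlt => /predU1P[v0|v0].
  rewrite -v0 mulr0; suff -> : re_inner u v = 0 by rewrite expr0n.
  apply/eqP/negP => /negP c0.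
  (* With v of norm 0 the quadratic expression is affine in b, and this b gives it the value -1. *)
  have := E 1 (- (re_inner u u + 1) / (2 * re_inner u v)).
  rewrite -v0 mulr0 addr0 expr1n mul1r mulr1.
  have -> : re_inner u u + 2 * (- (re_inner u u + 1) / (2 * re_inner u v)) * re_inner u v = -1.
    by field.
  by rewrite oppr_ge0 real_leNgt ?num_real// ltr01.
have := E (re_inner v v) (- re_inner u v).
have -> : re_inner v v ^+ 2 * re_inner u u +
    2 * re_inner v v * - re_inner u v * re_inner u v + (- re_inner u v) ^+ 2 * re_inner v v =
    re_inner v v * (re_inner u u * re_inner v v - re_inner u v ^+ 2) by ring.
by rewrite pmulr_rge0// subr_ge0.
Qed.

(* Orthonormality for the real part of the inner product: real scalars are enough
   for Bessel's inequality. *)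
Definition orthonormal (N : nat) (e : nat -> fn) : Prop :=
  (forall i, (i < N)%N -> finite_norm (e i)) /\
  forall i j, (i < N)%N -> (j < N)%N -> re_inner (e i) (e j) = (i == j)%:R.

(** The components along the e j are subtracted one at a time, and S is any property that survives
    such a subtraction. A trivial S yields Bessel's inequality; an S that records coefficients
    yields the Gram-Schmidt step. *)
Lemma orthonormal_residual (S : fn -> Prop) (N : nat) (e : nat -> fn) (g : fn) :
  orthonormal N e -> finite_norm g -> S g ->
  (forall c j h, (j < N)%N -> finite_norm h -> S h -> S (lin 1 h c (e j))) ->
  exists h, [/\ finite_norm h, S h, (forall j, (j < N)%N -> re_inner (e j) h = 0) &
    re_inner h h = re_inner g g - \sum_(i < N) re_inner (e i) g ^+ 2].
Proof.
move=> [fe oe] fg Sg Sstep.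
suff : forall k, (k <= N)%N -> exists h, [/\ finite_norm h, S h,
    (forall j, (j < N)%N -> re_inner (e j) h = if (j < k)%N then 0 else re_inner (e j) g) &
    re_inner h h = re_inner g g - \sum_(i < k) re_inner (e i) g ^+ 2].
  move=> /(_ N (leqnn N))[h [fh Sh oh hh]]; exists h; split => // j jN.
  by rewrite oh// jN.
elim=> [_|k ih kN].
  by exists g; split => //; rewrite big_ord0 subr0.
have [h [fh Sh oh hh]] := ih (ltnW kN).
have fk := fe k kN; have hk := oh k kN; rewrite ltnn in hk.
exists (lin 1 h (- re_inner (e k) g) (e k)); split.
- exact: finite_norm_lin.
- exact: Sstep.
- move=> j jN; rewrite re_inner_linr//; last exact: fe.
  rewrite mul1r oh// oe// [in RHS]ltnS [in RHS]leq_eqVlt.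
  have [->|jk] := eqVneq j k; first by rewrite ltnn mulr1 subrr.
  by rewrite mulr0 addr0.
- rewrite re_inner_linl ?re_inner_linr//; last exact: finite_norm_lin.
  rewrite (re_innerC h) hk oe// eqxx hh big_ord_recr /=; ring.
Qed.

Lemma bessel (N : nat) (e : nat -> fn) (g : fn) : orthonormal N e -> finite_norm g ->
  \sum_(i < N) re_inner (e i) g ^+ 2 <= re_inner g g.
Proof.
move=> oe fg.
have [h [_ _ _ hh]] := @orthonormal_residual (fun=> True) N e g oe fg I (fun _ _ _ _ _ _ => I).
by have := re_inner_ge0 h; rewrite hh subr_ge0.
Qed.

Lemma re_inner_eq0_ae u : finite_norm u -> re_inner u u = 0 -> ae_eqC u (fun=> 0).
Proof.
move=> [mr mi l]; rewrite re_inner_sq => u0.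
have h : (\int[mu]_x `|(norm_sq u x)%:E| = 0)%E.
  under eq_integral do rewrite gee0_abs ?lee_fin ?norm_sq_ge0//.
  by rewrite EFin_Rintegral// u0.
have ml : measurable_fun setT (EFin \o norm_sq u).
  by apply/measurable_EFinP; exact: L1_measurable l.
have := (ae_eq_integral_abs mu measurableT ml).1 h.
apply: filterS => x /(_ I)/= [] /eqP; rewrite /norm_sq.
rewrite paddr_eq0 ?sqr_ge0// !sqrf_eq0; case: (u x) => p q /= /andP[/eqP -> /eqP ->].
by [].
Qed.

(** P is meant to be membership in an eigenspace. Independence over the reals suffices because the
    inner product is the real one. *)
Lemma gram_schmidt (P : fn -> Prop) (m : nat) (e : 'I_m -> fn) :
  (forall u, P u -> finite_norm u) ->
  (forall a u b v, P u -> P v -> P (lin a u b v)) -> (forall i, P (e i)) ->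
  (forall c : 'I_m -> R,
    ae_eqC (fun x => \sum_(i < m) real_complex R (c i) * e i x) (fun=> 0) ->
    forall i, c i = 0) ->
  exists2 f : nat -> fn, orthonormal m f & forall i, (i < m)%N -> P (f i).
Proof.
move=> Pf Plin Pe ind.
(* [comb k] says that u is a real combination of the first k vectors e; it keeps later subtractions
   from touching the coefficient of the next e. *)
pose comb k u := exists2 c : 'I_m -> R, (forall j : 'I_m, (k <= j)%N -> c j = 0) &
  u = (fun x => \sum_(i < m) real_complex R (c i) * e i x).
suff : forall k, (k <= m)%N -> exists2 f : nat -> fn, orthonormal k f &
    forall i, (i < k)%N -> P (f i) /\ comb k (f i).
  by move=> /(_ m (leqnn m))[f of_ Pf']; exists f => // i /Pf'[].
elim=> [_|k ih km]; first by exists (fun _ _ => 0).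
have [f of_ fP] := ih (ltnW km).
pose ek := e (Ordinal km).
(* The coefficient of the new vector remains 1 throughout, so a residual of norm 0 would contradict
   independence. *)
pose S u := P u /\ exists2 c : 'I_m -> R,
  c (Ordinal km) = 1 /\ (forall j : 'I_m, (k < j)%N -> c j = 0) &
  u = (fun x => \sum_(i < m) real_complex R (c i) * e i x).
have Sek : S ek.
  split; first exact: Pe.
  exists (fun j => (j == Ordinal km)%:R).
    split; first by rewrite eqxx.
    by move=> j kj; rewrite -val_eqE/= gtn_eqF.
  apply/funext => x; rewrite (bigD1 (Ordinal km))//= eqxx mul1r big1 ?addr0//.
  by move=> j /negbTE ->; rewrite mul0r.
have Sstep c j h : (j < k)%N -> finite_norm h -> S h -> S (lin 1 h c (f j)).
  move=> jk fh [Ph [d [dk d0] hE]]; have [Pfj [d' d'0 fjE]] := fP j jk.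
  split; first exact: Plin.
  exists (fun i => d i + c * d' i).
    by split=> [|i ki]; rewrite ?dk d'0 ?mulr0 ?addr0 ?d0// ltnW.
  apply/funext => x; rewrite /lin hE fjE !mulr_sumr -big_split/=.
  by apply: eq_bigr => i _; rewrite mul1r rmorphD rmorphM mulrDl mulrA.
have [h [fh [Ph [d [dk d0] hE]] oh _]] :=
  orthonormal_residual of_ (Pf _ (Pe (Ordinal km))) Sek Sstep.
have h0 : 0 < re_inner h h.
  rewrite lt_neqAle re_inner_ge0 andbT; apply/eqP => /esym hh.
  have /ind/(_ (Ordinal km)) : ae_eqC
      (fun x => \sum_(i < m) real_complex R (d i) * e i x) (fun=> 0).
    by rewrite -hE; exact: re_inner_eq0_ae.
  by rewrite dk => /eqP; rewrite oner_eq0.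
pose s := (Num.sqrt (re_inner h h))^-1.
have ss : s * (s * re_inner h h) = 1.
  rewrite mulrA -expr2 exprVn sqr_sqrtr ?ltW// mulVf// gt_eqF//.
pose g : fn := lin s h 0 h.
have fg : finite_norm g by exact: finite_norm_lin.
have gh u : finite_norm u -> re_inner u g = s * re_inner u h.
  by move=> fu; rewrite re_inner_linr// mul0r addr0.
have Pg : P g by exact: Plin.
have [ff off] := of_.
have ltk i : (i < k.+1)%N = (i == k) || (i < k)%N by rewrite ltnS leq_eqVlt.
exists (fun i => if i == k then g else f i).
  split=> [i|i j]; rewrite !ltk.
    by have [//|ik /= /ff] := eqVneq i k.
  have [->|ik] := eqVneq i k; have [->|jk] := eqVneq j k => //= ki kj.
  - by rewrite gh// re_innerC gh.
  - by rewrite re_innerC gh ?oh ?mulr0//; exact: ff.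
  - by rewrite gh ?oh ?mulr0 ?(negbTE ik)//; exact: ff.
  - exact: off.
move=> i; rewrite ltk; have [_ _|ik /= /fP[Pfi [c c0 fE]]] := eqVneq i k.
  split => //; exists (fun j => s * d j).
    by move=> j kj; rewrite d0// mulr0.
  apply/funext => x; rewrite /g /lin rmorph0 mul0r addr0 hE mulr_sumr.
  by apply: eq_bigr => j _; rewrite rmorphM mulrA.
by split => //; exists c => // j kj; rewrite c0// ltnW.
Qed.

End real_inner_product.

(** * Orthonormal eigenfunctions of a self-adjoint operator *)

Section spectral.
Context {R : realType} {n : nat}.
Local Notation mu := (@lebesgue_rV R n).
Local Notation fn := ('rV[R]_n -> R[i]).
Variable H : fn -> fn -> Prop.
Hypothesis sH : selfadjoint H.
Implicit Types (u v w : fn) (a b E : R).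

Lemma innerE u v :
  inner u v = Complex (re_inner u v) (\int[mu]_x im_prod u v x).
Proof.
rewrite /inner /cintegral; congr Complex; apply: Rint_eq => x.
  by rewrite /re_prod; case: (u x) => ? ?; case: (v x) => ? ? /=; ring.
by rewrite /im_prod; case: (u x) => ? ?; case: (v x) => ? ? /=; ring.
Qed.

Lemma inner_linr a u b v w : finite_norm u -> finite_norm v -> finite_norm w ->
  inner w (lin a u b v) = real_complex R a * inner w u + real_complex R b * inner w v.
Proof.
move=> fu fv fw; rewrite !innerE re_inner_linr//.
have -> : \int[mu]_x im_prod w (lin a u b v) x =
    a * \int[mu]_x im_prod w u x + b * \int[mu]_x im_prod w v x.
  have l1 := L1_im_prod fw fu; have l2 := L1_im_prod fw fv.
  rewrite -(RintZ a l1) -(RintZ b l2) -(RintD (L1Z a l1) (L1Z b l2)).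
  by apply: Rint_eq => x; rewrite /im_prod Re_lin Im_lin; ring.
by apply/eqP; rewrite eq_complex /=; apply/andP; split; apply/eqP; ring.
Qed.

Lemma eigenfunction_finite_norm E u : eigenfunction H E u ->
  finite_norm u /\ finite_norm (fun x => real_complex R E * u x).
Proof.
by case: sH => HL2 _ _ /HL2[lu lEu]; split; exact/L2_finite_norm.
Qed.

(** H is given only as a graph, so linearity is obtained from the adjoint condition: belonging to
    the graph is tested by inner products, and these are linear. *)
Lemma eigenfunction_lin E a u b v : eigenfunction H E u -> eigenfunction H E v ->
  eigenfunction H E (lin a u b v).
Proof.
move=> eu ev; have [fu fEu] := eigenfunction_finite_norm eu.
have [fv fEv] := eigenfunction_finite_norm ev.
have [HL2 _ adj] := sH.
have EE : (fun x => real_complex R E * lin a u b v x) =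
    lin a (fun x => real_complex R E * u x) b (fun x => real_complex R E * v x).
  by apply/funext => x; rewrite /lin; ring.
have fl := finite_norm_lin a b fu fv; have flE := finite_norm_lin a b fEu fEv.
apply/adj; rewrite ?EE; [exact/L2_finite_norm|exact/L2_finite_norm|].
move=> w f Hwf; have [/L2_finite_norm fw /L2_finite_norm ff] := HL2 _ _ Hwf.
rewrite !inner_linr//.
have [lu lEu] := HL2 _ _ eu; have [lv lEv] := HL2 _ _ ev.
by rewrite ((adj _ _ lu lEu).1 eu _ _ Hwf) ((adj _ _ lv lEv).1 ev _ _ Hwf).
Qed.

Lemma eigenfunction_orthogonal E E' u v : eigenfunction H E u ->
  eigenfunction H E' v -> E != E' -> re_inner u v = 0.
Proof.
move=> eu ev EE'; have [fu fEu] := eigenfunction_finite_norm eu.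
have [fv fEv] := eigenfunction_finite_norm ev.
have [HL2 _ adj] := sH; have [lv lEv] := HL2 _ _ ev.
have := (adj _ _ lv lEv).1 ev _ _ eu; rewrite !innerE => -[+ _].
have -> : re_inner (fun x => real_complex R E * u x) v = E * re_inner u v.
  rewrite -(RintZ E (L1_re_prod fu fv)); apply: Rint_eq => x.
  by rewrite /re_prod; case: (u x) => ? ?; case: (v x) => ? ? /=; ring.
have -> : re_inner u (fun x => real_complex R E' * v x) = E' * re_inner u v.
  rewrite -(RintZ E' (L1_re_prod fu fv)); apply: Rint_eq => x.
  by rewrite /re_prod; case: (u x) => ? ?; case: (v x) => ? ? /=; ring.
by move/eqP; rewrite -subr_eq0 -mulrBl mulf_eq0 subr_eq0 (negbTE EE') => /eqP.
Qed.

Variable lam : nat -> R.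
Hypothesis lamH : eigenvalue_sequence H lam.

(* The number of i < j with lam i = lam j: f j below is vector number rank j of an
   orthonormal basis of the eigenspace of lam j. *)
Let rank (j : nat) : nat := count (fun i => lam i == lam j) (iota 1 j.-1).

Lemma orthonormal_eigenfunctions : exists f : nat -> fn,
  (forall j, (0 < j)%N -> eigenfunction H (lam j) (f j)) /\
  forall i j, (0 < i)%N -> (0 < j)%N -> re_inner (f i) (f j) = (i == j)%:R.
Proof.
have [_ mult] := lamH.
have /choice[m mP] : forall E, exists m, multiplicity H E m /\
    ([set j : nat | (1 <= j)%N /\ lam j = E] #= `I_m)%card.
  by move=> E; have [m ? ?] := mult E; exists m.
have /choice[b bP] : forall E, exists f : nat -> fn, orthonormal (m E) f /\
    forall i, (i < m E)%N -> eigenfunction H E (f i).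
  move=> E; have [[e [ee ind _]] _] := mP E.
  (* Complex independence is specialized to real coefficients, which gives as many real-orthonormal
     vectors as the complex dimension. *)
  have [f of_ fP] := @gram_schmidt R n (eigenfunction H E) (m E) e
    (fun u eu => (eigenfunction_finite_norm eu).1) (@eigenfunction_lin E) ee
    (fun c ce i => congr1 (@complex.Re R) (ind (fun i => real_complex R (c i)) ce i)).
  by exists f.
(* The indices up to j with value [lam j], j included, are [rank j] + 1 distinct elements of a set
   of cardinality [m (lam j)]. *)
have rank_lt j : (0 < j)%N -> (rank j < m (lam j))%N.
  move=> j0; have [_ cardE] := mP (lam j).
  pose s := [seq i <- iota 1 j | lam i == lam j].
  have ss : size s = (rank j).+1.
    rewrite /s size_filter -[X in iota 1 X](prednK j0) -[X in iota 1 X]addn1 iotaD count_cat /=.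
    by rewrite add1n (prednK j0) eqxx addn1.
  have us : uniq s by rewrite filter_uniq// iota_uniq.
  rewrite -ss -(card_fset_set cardE); apply: uniq_leq_size => // i.
  rewrite mem_filter mem_iota => /andP[/eqP lij /andP[i1 _]].
  rewrite in_fset_set ?inE//=; apply/finite_setP; exists (m (lam j)); exact: cardE.
have rank_mono i j : (0 < i)%N -> (i < j)%N -> lam i = lam j -> (rank i < rank j)%N.
  move=> i0 ij lij; rewrite /rank lij.
  have -> : iota 1 j.-1 = iota 1 i.-1 ++ i :: iota i.+1 (j.-1 - i).
    rewrite -[i :: _]/(iota i (j.-1 - i).+1) -{2}(prednK i0) -(add1n i.-1) -iotaD.
    congr (iota _ _); lia.
  by rewrite count_cat /= lij eqxx addnCA add1n ltnS leq_addr.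
exists (fun j => b (lam j) (rank j)); split=> [j j0|i j i0 j0].
  by have [_] := bP (lam j); apply; exact: rank_lt.
have [lij|lij] := eqVneq (lam i) (lam j); last first.
  rewrite (@eigenfunction_orthogonal (lam i) (lam j))//.
  - by case: eqVneq => // ij; move: lij; rewrite ij eqxx.
  - by have [_] := bP (lam i); apply; exact: rank_lt.
  - by have [_] := bP (lam j); apply; exact: rank_lt.
have [[_ ob] _] := bP (lam j).
rewrite lij ob ?rank_lt//; last by rewrite -lij rank_lt.
congr (_%:R); congr nat_of_bool; apply/eqP/eqP => [rij|->//].
have [ij|ji|//] := ltngtP i j.
  by have := rank_mono i j i0 ij lij; rewrite rij ltnn.
by have := rank_mono j i j0 ji (esym lij); rewrite rij ltnn.
Qed.

End spectral.

(** * Counting eigenvalues *)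

Section phase_space.
Context {R : realType} {n : nat}.
Local Notation mu := (@lebesgue_rV R n).
Local Notation fn := ('rV[R]_n -> R[i]).
Implicit Types (u v h : fn) (x xi : 'rV[R]_n).

Variables (E F : set 'rV[R]_n).
Hypotheses (mE : measurable E)
  (lE : L1 mu (\1_E)) (lF : L1 mu (\1_F)).

Let rE := \int[mu]_x \1_E x.
Let rF := \int[mu]_xi \1_F xi.

Definition truncated_fourier_sq u xi : R :=
  fourier_sq (truncate E (fun x => complex.Re (u x)))
             (truncate E (fun x => complex.Im (u x))) xi.

(* re_inner (wave xi) u and re_inner (wave' xi) u are the real and imaginary parts
   of the Fourier transform of 1_E u at xi. *)
Let wave xi : fn := fun x =>
  Complex (\1_E x * cos (dotv x xi)) (\1_E x * sin (dotv x xi)).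

Let wave' xi : fn := fun x =>
  Complex (- (\1_E x * sin (dotv x xi))) (\1_E x * cos (dotv x xi)).

Let indic_sq x : \1_E x ^+ 2 = \1_E x :> R.
Proof. by rewrite indicE; case: (x \in E); rewrite ?expr1n ?expr0n. Qed.

Let norm_sq_wave xi : norm_sq (wave xi) = \1_E /\ norm_sq (wave' xi) = \1_E.
Proof.
split; apply/funext => x; rewrite /norm_sq /= ?sqrrN !exprMn indic_sq -mulrDr.
  by rewrite cos2Dsin2 mulr1.
by rewrite addrC cos2Dsin2 mulr1.
Qed.

Let finite_norm_wave xi : finite_norm (wave xi) /\ finite_norm (wave' xi).
Proof.
have mc : measurable_fun setT (fun x => \1_E x * cos (dotv x xi) : R).
  exact: L1_measurable (L1_cos xi lE).
have ms : measurable_fun setT (fun x => \1_E x * sin (dotv x xi) : R).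
  exact: L1_measurable (L1_sin xi lE).
have [w w'] := norm_sq_wave xi.
split; split => //=; rewrite ?w ?w'//.
exact: measurableT_comp.
Qed.

Let re_inner_wave xi : re_inner (wave xi) (wave xi) = rE /\
  re_inner (wave' xi) (wave' xi) = rE.
Proof. by have [w w'] := norm_sq_wave xi; rewrite !re_inner_sq w w'. Qed.

Lemma L1_truncate_finite_norm u : finite_norm u ->
  L1 mu (truncate E (fun x => complex.Re (u x))) /\
  L1 mu (truncate E (fun x => complex.Im (u x))).
Proof.
move=> [mr mi l]; have ml : measurable_fun setT (\1_E : 'rV[R]_n -> R).
  exact: measurable_indic.
by split; apply: L1_le (L1D l lE);
  [exact: measurable_funM| |exact: measurable_funM|] => x;
  rewrite (le_trans (norm_mul_le _ _))// indic_sq lerD2r /norm_sq ?lerDl ?lerDr sqr_ge0.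
Qed.

Lemma truncated_fourier_sqE u xi : finite_norm u ->
  truncated_fourier_sq u xi = re_inner (wave xi) u ^+ 2 + re_inner (wave' xi) u ^+ 2.
Proof.
move=> fu; have [l1 l2] := L1_truncate_finite_norm fu.
rewrite /truncated_fourier_sq /fourier_sq /cos_transform /sin_transform.
congr (_ ^+ 2 + _ ^+ 2).
  rewrite -(RintD (L1_cos xi l1) (L1_sin xi l2)); apply: Rint_eq => x.
  by rewrite /re_prod /truncate /=; ring.
rewrite -(RintB (L1_cos xi l2) (L1_sin xi l1)); apply: Rint_eq => x.
by rewrite /re_prod /truncate /=; ring.
Qed.

Lemma truncated_fourier_sq_le u xi : finite_norm u ->
  truncated_fourier_sq u xi <= 2 * rE * re_inner u u.
Proof.
move=> fu; have [fw fw'] := finite_norm_wave xi; have [w w'] := re_inner_wave xi.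
rewrite truncated_fourier_sqE// -mulrA mulr_natl mulr2n.
apply: lerD; first by rewrite -w; exact: re_inner_cauchy_schwarz.
by rewrite -w'; exact: re_inner_cauchy_schwarz.
Qed.

(** The real and imaginary parts are tested against two functions of squared norm |E|, and real
    Bessel applies to each; hence the factor 2. *)
Lemma truncated_fourier_sq_bessel N (e : nat -> fn) xi : orthonormal N e ->
  \sum_(i < N) truncated_fourier_sq (e i) xi <= 2 * rE.
Proof.
move=> oe; have [fw fw'] := finite_norm_wave xi; have [w w'] := re_inner_wave xi.
have eE (i : 'I_N) : true -> truncated_fourier_sq (e i) xi =
    re_inner (e i) (wave xi) ^+ 2 + re_inner (e i) (wave' xi) ^+ 2.
  rewrite truncated_fourier_sqE; last exact: oe.1.
  by rewrite (re_innerC (wave xi)) (re_innerC (wave' xi)).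
rewrite (eq_bigr _ eE) big_split mulr_natl mulr2n; apply: lerD.
  by rewrite -w; exact: bessel.
by rewrite -w'; exact: bessel.
Qed.

Lemma truncated_fourier_sq_ge0 u xi : 0 <= truncated_fourier_sq u xi.
Proof. exact: fourier_sq_ge0. Qed.

(** Unlike the quadratic form, this is controlled by the L^2 norm alone ([phase_mass_le],
    [phase_mass_add_le]), so it can be compared between an eigenfunction and its Schwartz
    approximation. *)
Definition phase_mass u : R := \int[mu]_xi (\1_F xi * truncated_fourier_sq u xi).

Lemma L1_phase_mass u : finite_norm u ->
  L1 mu (fun xi => \1_F xi * truncated_fourier_sq u xi).
Proof.
move=> fu; have [l1 l2] := L1_truncate_finite_norm fu.
apply: (L1_bounded (M := 2 * rE * re_inner u u) lF).
  exact: measurable_fourier_sq.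
by move=> xi; rewrite ger0_norm ?truncated_fourier_sq_ge0 ?truncated_fourier_sq_le.
Qed.

Lemma phase_mass_le u : finite_norm u -> phase_mass u <= 2 * rE * rF * re_inner u u.
Proof.
move=> fu; rewrite mulrAC -(RintZ _ lF); apply: Rint_le => //.
- exact: L1_phase_mass.
- exact: L1Z.
- by move=> xi; rewrite mulrC ler_wpM2r ?indic_ge0 ?truncated_fourier_sq_le.
Qed.

Lemma phase_mass_bessel N (e : nat -> fn) : orthonormal N e ->
  \sum_(i < N) phase_mass (e i) <= 2 * rE * rF.
Proof.
move=> oe.
pose G (i : 'I_N) xi : R := \1_F xi * truncated_fourier_sq (e i) xi.
have lG i : L1 mu (G i) by exact: L1_phase_mass (oe.1 _ (ltn_ord i)).
rewrite -(Rint_sum _ lG) -(RintZ _ lF); apply: Rint_le.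
- exact: L1_sum.
- exact: L1Z.
- move=> xi; rewrite -mulr_sumr mulrC ler_wpM2r ?indic_ge0//.
  exact: truncated_fourier_sq_bessel.
Qed.

Lemma phase_mass_add_le u h : finite_norm u -> finite_norm h ->
  phase_mass (fun x => u x + h x) <= 2 * phase_mass u + 2 * phase_mass h.
Proof.
move=> fu fh; have [u1 u2] := L1_truncate_finite_norm fu.
have [h1 h2] := L1_truncate_finite_norm fh.
have lu := L1_phase_mass fu; have lh := L1_phase_mass fh.
have fuh : finite_norm (fun x => u x + h x).
  have := finite_norm_lin 1 1 fu fh; congr finite_norm; apply/funext => x.
  by rewrite /lin !mul1r.
have -> : 2 * phase_mass u + 2 * phase_mass h = \int[mu]_xi
    (2 * (\1_F xi * truncated_fourier_sq u xi) + 2 * (\1_F xi * truncated_fourier_sq h xi)).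
  by rewrite (RintD (L1Z 2 lu) (L1Z 2 lh)) (RintZ 2 lu) (RintZ 2 lh).
apply: Rint_le; [exact: L1_phase_mass|exact: L1D (L1Z 2 lu) (L1Z 2 lh)|move=> xi].
rewrite !(mulrCA 2) -mulrDr; apply: ler_wpM2l; first exact: indic_ge0.
have RE : truncate E (fun x => complex.Re (u x + h x)) = (fun x =>
    truncate E (fun x => complex.Re (u x)) x + truncate E (fun x => complex.Re (h x)) x).
  by apply/funext => x; rewrite /truncate -mulrDl; case: (u x) (h x) => ? ? [].
have IE : truncate E (fun x => complex.Im (u x + h x)) = (fun x =>
    truncate E (fun x => complex.Im (u x)) x + truncate E (fun x => complex.Im (h x)) x).
  by apply/funext => x; rewrite /truncate -mulrDl; case: (u x) (h x) => ? ? [].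
by rewrite /truncated_fourier_sq RE IE; exact: fourier_sq_add_le.
Qed.

End phase_space.

(** * Lower bound for the phase-space mass of an eigenfunction *)

Section eigenfunction_mass.
Context {R : realType} {n : nat}.
Local Notation mu := (@lebesgue_rV R n).
Local Notation fn := ('rV[R]_n -> R[i]).
Local Notation K := ((2 * pi) ^+ n : R).

Lemma L2norm_cvg0 (phi : nat -> fn) (e : R) : 0 < e ->
  L2norm (phi k) @[k --> \oo] --> 0%E -> \forall k \near \oo, (L2norm (phi k) < e%:E)%E.
Proof.
move=> e0 cphi; apply: (cphi [set y | y < e%:E]%E).
by apply: open_nbhs_nbhs; split => //; exact: open_ereal_lt_ereal.
Qed.

Lemma expr_2pi_ge1 : 1 <= K.
Proof.
apply: exprn_ege1; have := @pi_ge2 R; lra.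
Qed.

(* The factor 32 in Lam makes the energy term of schwartz_localization at most k / 8;
   u is the exact eigenfunction and the errors a, b, c, s come from its Schwartz
   approximation. *)
Lemma localization_arith (k l ell Q e rE rF a b c s Tp Tu Th : R)
    (Lam := 32 * (ell + 1 + 2 * Q)) (W := rE * rF) :
  `|l| <= ell -> 0 <= e -> e <= 1 / 64 -> 0 <= W -> e ^+ 2 <= 1 / 64 -> e * `|l| <= 1 / 64 ->
  e * W <= 1 / 64 -> 0 <= Q -> `|a| <= e -> `|b| <= e -> `|c| <= e -> 0 <= s ->
  s <= e ^+ 2 -> Tp <= 2 * Tu + 2 * Th -> Th <= 2 * rE * rF * s ->
  k * (1 + 2 * a + s) <= 2 * Tp +
    4 * k / Lam * (l + l * a + b + c + Q * (1 + 2 * a + s)) ->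
  1 <= k -> 1 <= 16 * Tu.
Proof.
move=> lell e0 e1 W0 ee el eW Q0 ae be ce s0 se pm mh loc k1.
have mh' : Th <= 1 / 32.
  have e2 : e * (e * W) <= 1 / 64 * (1 / 64) by apply: ler_pM => //; exact: mulr_ge0.
  have Ws : W * s <= e * (e * W) by rewrite mulrA -expr2 mulrC ler_wpM2r.
  by rewrite (le_trans mh)// -[2 * _ * _]mulrA -/W -mulrA; clear -e2 Ws; lra.
have laE : `|l * a| <= 1 / 64.
  rewrite normrM; apply: le_trans el; rewrite mulrC; exact: ler_wpM2r.
have inner_le : l + l * a + b + c <= ell + 1.
  have := le_trans (ler_norm l) lell; move: laE be ce; rewrite !ler_norml; clear -e1; lra.
have X1 : 1 / 2 <= 1 + 2 * a + s by move: ae; rewrite ler_norml; clear -e1 s0; lra.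
have X2 : 1 + 2 * a + s <= 2 by move: ae; rewrite ler_norml; clear -e1 se ee; lra.
have Lam0 : 0 < Lam by rewrite /Lam; have := le_trans (normr_ge0 l) lell; clear -Q0; lra.
have X4 : 4 * k / Lam * (l + l * a + b + c + Q * (1 + 2 * a + s)) <= k / 8.
  rewrite mulrAC ler_pdivrMr// [leRHS](_ : _ = 4 * k * (ell + 1 + 2 * Q)); last first.
    by rewrite /Lam; field.
  apply: ler_wpM2l; first by clear -k1; lra.
  apply: lerD => //; rewrite mulrC; exact: ler_wpM2r.
(* Together with [loc] and [X4] this gives 3k/8 <= 2 Tp <= 4 Tu + 1/8, and k >= 1 then yields Tu >=
   1/16. *)
have : k / 2 <= k * (1 + 2 * a + s) by apply: ler_wpM2l; clear -k1 X1; lra.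
clear -loc X4 pm mh' k1; lra.
Qed.

Lemma eigenfunction_phase_mass (A V : 'rV[R]_n -> R) (CA CV : R) (pA pV : nat)
    (q1 q2 lam ell : R) (u : fn)
    (Lam := 32 * (ell + 1 + 2 * (`|q1| + 2 * `|q2|)))
    (E := [set x | V x + q1 <= Lam]) (F := [set xi | A xi + q2 <= Lam]) :
  continuous A -> continuous V ->
  (forall x, `|A x| <= CA * (1 + `|x|) ^+ pA) ->
  (forall x, `|V x| <= CV * (1 + `|x|) ^+ pV) ->
  (forall x, 0 <= V x + q1) -> (forall xi, 0 <= A xi + q2) ->
  L1 mu (\1_E) -> L1 mu (\1_F) ->
  closure_on_schwartz (AD_plus_V A V) u (fun x => real_complex R lam * u x) ->
  `|lam| <= ell -> re_inner u u = 1 -> 1 <= 16 * phase_mass E F u.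
Proof.
move=> cA cV gA gV V0 A0 lE lF [/L2_finite_norm fu _ [phi [sphi cphi cP]]] lamell u1.
have mE : measurable E by exact: measurable_sublevel.
have Lam0 : 0 < Lam.
  by rewrite mulr_gt0// ltr_wpDr ?mulr_ge0 ?addr_ge0// ltr_wpDl// (le_trans _ lamell).
set W := (\int[mu]_x \1_E x) * (\int[mu]_xi \1_F xi) : R.
have W0 : 0 <= W.
  by rewrite mulr_ge0//; apply: Rintegral_ge0 => x _; exact: indic_ge0.
(* One tolerance for all errors: e, e |lam| and e W are each at most 1/64. *)
pose e := (64 * (1 + `|lam| + W))^-1.
have e0 : 0 < e by rewrite invr_gt0 mulr_gt0// ltr_wpDr// ltr_wpDr.
have eE : e * (64 * (1 + `|lam| + W)) = 1 by rewrite mulVf// -invr_eq0 gt_eqF.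
have [k [hk dk]] : exists k, (L2norm (fun x => phi k x - u x)%R < e%:E)%E /\
    (L2norm (fun x => AD_plus_V A V (phi k) x - real_complex R lam * u x)%R < e%:E)%E.
  have [N _ NP] := filterI (L2norm_cvg0 e0 cphi) (L2norm_cvg0 e0 cP).
  by exists N; exact: NP (leqnn N).
have sk := sphi k; set p := phi k in hk dk sk.
set Pp := AD_plus_V A V p in dk.
have [s1 s2] := sk.
have [mu1 mu2 _] := fu.
pose h : fn := fun x => p x - u x; pose d : fn := fun x => Pp x - real_complex R lam * u x.
have mp1 : measurable_fun setT (fun x => complex.Re (p x)).
  exact: L1_measurable (schwartz_L1 s1).
have mp2 : measurable_fun setT (fun x => complex.Im (p x)).
  exact: L1_measurable (schwartz_L1 s2).
have [mP1 mP2 _ _ _] := schwartz_quadratic_form cA cV gA gV sk.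
have [fh hh] : finite_norm h /\ re_inner h h <= e ^+ 2.
  apply: L2norm_lt_re_inner => //; last exact: ltW.
    rewrite (_ : (fun _ => _) = (fun x => complex.Re (p x) - complex.Re (u x))).
      exact: measurable_funB.
    by apply/funext => x; rewrite /h; case: (p x) (u x) => ? ? [].
  rewrite (_ : (fun _ => _) = (fun x => complex.Im (p x) - complex.Im (u x))).
    exact: measurable_funB.
  by apply/funext => x; rewrite /h; case: (p x) (u x) => ? ? [].
have [fd dd] : finite_norm d /\ re_inner d d <= e ^+ 2.
  apply: L2norm_lt_re_inner => //; last exact: ltW.
    rewrite (_ : (fun _ => _) = (fun x => complex.Re (Pp x) - lam * complex.Re (u x))).
      by apply: measurable_funB => //; exact: measurable_funM.
    by apply/funext => x; rewrite /d; case: (Pp x) (u x) => ? ? [? ?] /=; ring.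
  rewrite (_ : (fun _ => _) = (fun x => complex.Im (Pp x) - lam * complex.Im (u x))).
    by apply: measurable_funB => //; exact: measurable_funM.
  by apply/funext => x; rewrite /d; case: (Pp x) (u x) => ? ? [? ?] /=; ring.
(* With p = u + h and P p = lam u + d, the norm and the quadratic form of p become their values at u
   plus inner products with the small h and d. *)
have pE : p = lin 1 u 1 h by apply/funext => x; rewrite /lin /h; ring.
have PE : Pp = lin lam u 1 d by apply/funext => x; rewrite /lin /d; ring.
have fp : finite_norm p by rewrite pE; exact: finite_norm_lin.
have small (v w : fn) : finite_norm v -> finite_norm w -> re_inner v v <= 1 ->
    re_inner w w <= e ^+ 2 -> `|re_inner v w| <= e.
  move=> fv fw v1 we.
  suff : `|re_inner v w| ^+ 2 <= e ^+ 2 by rewrite ler_pXn2r ?nnegrE// ltW.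
  rewrite real_normK ?num_real//.
  apply: le_trans (re_inner_cauchy_schwarz fv fw) _.
  by rewrite -[leRHS]mul1r; apply: ler_pM => //; exact: re_inner_ge0.
have e1 : e <= 1 / 64.
  by have := normr_ge0 lam; nra.
have el : e * `|lam| <= 1 / 64 by nra.
have eW : e * W <= 1 / 64 by have := normr_ge0 lam; nra.
have ee1 : e ^+ 2 <= 1 / 64 by nra.
have u1le : re_inner u u <= 1 by rewrite u1.
have uh := small _ _ fu fh u1le hh.
have du : `|re_inner d u| <= e by rewrite re_innerC; exact: small.
have dh : `|re_inner d h| <= e by apply: small => //; by apply: le_trans dd _; lra.
have hu : re_inner h u = re_inner u h := re_innerC h u.
have XE : \int[mu]_x (complex.Re (p x) ^+ 2 + complex.Im (p x) ^+ 2) =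
    1 + 2 * re_inner u h + re_inner h h.
  have fl : finite_norm (lin 1 u 1 h) by exact: finite_norm_lin.
  by rewrite -[LHS]re_inner_sq pE re_inner_linl// !re_inner_linr// hu u1; ring.
have QE : \int[mu]_x (complex.Re (Pp x) * complex.Re (p x) +
      complex.Im (Pp x) * complex.Im (p x)) =
    lam + lam * re_inner u h + re_inner d u + re_inner d h.
  have fl : finite_norm (lin 1 u 1 h) by exact: finite_norm_lin.
  by rewrite -[LHS]/(re_inner Pp p) PE pE re_inner_linl// !re_inner_linr// u1; ring.
have := schwartz_localization cA cV gA gV V0 A0 Lam0 sk.
rewrite -/Pp XE QE -/(phase_mass E F p) => loc.
have pm : phase_mass E F p <= 2 * phase_mass E F u + 2 * phase_mass E F h.
  have -> : p = (fun x => u x + h x) by apply/funext => x; rewrite /h; ring.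
  exact: phase_mass_add_le.
have mh := phase_mass_le mE lE lF fh.
apply: (localization_arith lamell _ _ _ ee1 el eW _ uh du dh _ hh pm mh loc) => //.
- exact: ltW.
- exact: re_inner_ge0.
- exact: expr_2pi_ge1.
Qed.

End eigenfunction_mass.

(** * Volume of sublevel sets in phase space *)

Section phase_volume.
Context {R : realType} {n : nat}.
Local Notation mu := (@lebesgue_rV R n).
Implicit Types (x xi : 'rV[R]_n) (E F : set 'rV[R]_n).

Lemma L1_indic_bounded E (B : R) : measurable E -> (forall x, E x -> `|x| <= B) ->
  L1 mu (\1_E).
Proof.
move=> mE EB.
apply: L1_le (L1Z ((1 + `|B|) ^+ (2 * n)) (@L1_weight R n)); first exact: measurable_indic.
apply: poly_weight_le => x; rewrite indicE; have [xE|xE] := pselect (E x).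
  rewrite mem_set// normr1 mulr1 lerXn2r ?nnegrE ?addr_ge0// lerD2l.
  exact: le_trans (EB x xE) (ler_norm _).
by rewrite memNset// normr0 mulr0 exprn_ge0// addr_ge0.
Qed.

Variables (A V : 'rV[R]_n -> R) (q mp : R).
Hypotheses (cA : continuous A) (cV : continuous V)
  (a1 : forall x xi, 1 <= q + V x + A xi) (mp0 : 0 < mp)
  (aoo : (\int[mu]_x \int[mu]_xi ((q + V x + A xi) `^ (- mp))%:E < +oo)%E).

Let mu2 := product_sigma_finite_measure mu mu.
Let a (z : 'rV[R]_n * 'rV[R]_n) : R := q + V z.1 + A z.2.
Let S (k : nat) : set ('rV[R]_n * 'rV[R]_n) := [set z | a z <= k%:R].

Let ma : measurable_fun setT a.
Proof.
apply: measurable_funD; last first.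
  exact: measurableT_comp (continuous_measurable_rV cA) measurable_snd.
apply: measurable_funD => //.
exact: measurableT_comp (continuous_measurable_rV cV) measurable_fst.
Qed.

Let lG : L1 mu2 (fun z => a z `^ (- mp)).
Proof.
have mG : measurable_fun setT (fun z => a z `^ (- mp)).
  exact: measurableT_comp (measurable_powR _) ma.
apply: L1_lt_pinfty => //; first by move=> z; exact: powR_ge0.
rewrite (_ : integral _ _ _ =
  (\int[mu]_x \int[mu]_xi ((q + V x + A xi) `^ (- mp))%:E)%E)//.
rewrite (@fubini_tonelli1 _ _ _ _ _ mu mu (fun z => (a z `^ (- mp))%:E)) //.
  exact/measurable_EFinP.
by move=> z; rewrite lee_fin powR_ge0.
Qed.

Let mS k : measurable (S k).
Proof.
rewrite (_ : S k = a @^-1` `]-oo, k%:R]).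
  by rewrite -[X in measurable X]setTI; exact: ma.
by apply/seteqP; split => z /=; rewrite in_itv.
Qed.

(** Chebyshev's inequality in pointwise form: a <= k on S k gives 1 <= (k / a)^mp. *)
Let indS (k : nat) z : \1_(S k) z <= k%:R `^ mp * a z `^ (- mp).
Proof.
have az : 0 < a z by exact: lt_le_trans ltr01 (a1 _ _).
rewrite indicE; have [zS|zS] := pselect (S k z); last first.
  by rewrite memNset// mulr_ge0 ?powR_ge0.
rewrite mem_set// powRN ler_pdivlMr ?powR_gt0// mul1r.
by apply: ge0_ler_powR; rewrite ?nnegrE// ltW.
Qed.

Let lS k : L1 mu2 (\1_(S k)).
Proof.
apply: L1_le (L1Z (k%:R `^ mp) lG); first exact: measurable_indic.
by move=> z; rewrite ger0_norm ?indS// indicE.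
Qed.

(** The functions k^(-mp) 1_(S k) are dominated by the integrable a^(-mp) and tend to 0 pointwise
    because k^(-mp) does. This improves the bound O(k^mp) of [indS] to o(k^mp), which is what allows
    an arbitrary L in the theorem. *)
Lemma sublevel_volume_small (eps : R) : 0 < eps -> exists N : nat,
  forall (k : nat) E F, (N <= k)%N -> measurable E -> measurable F ->
    L1 mu (\1_E) -> L1 mu (\1_F) ->
    (forall x xi, E x -> F xi -> q + V x + A xi <= k%:R) ->
    (\int[mu]_x \1_E x) * (\int[mu]_xi \1_F xi) <= eps * k%:R `^ mp.
Proof.
move=> eps0.
pose f (k : nat) z : R := k.+1%:R `^ (- mp) * \1_(S k.+1) z.
have i0 k z : 0 <= \1_(S k) z :> R by rewrite indicE.
have fG k z : `|f k z| <= a z `^ (- mp).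
  rewrite ger0_norm ?mulr_ge0 ?powR_ge0//.
  by rewrite /f powRN -ler_pdivlMl ?invr_gt0 ?powR_gt0// invrK; exact: indS.
have mf k : measurable_fun setT (f k).
  by apply: measurable_funM => //; exact: measurable_indic.
have k0 : (fun k : nat => k.+1%:R `^ (- mp)) @ \oo --> (0 : R).
  apply/cvgr0Pnorm_lt => e e0; pose D := e `^ (- mp^-1).
  have DE : D `^ mp = e^-1.
    by rewrite /D -powRrM mulNr mulVf ?gt_eqF// powRN powRr1// ltW.
  exists (Num.truncn D) => // k /= Dk.
  rewrite ger0_norm ?powR_ge0// powRN invf_plt ?posrE ?powR_gt0// -DE.
  apply: gt0_ltr_powR; rewrite ?nnegrE ?powR_ge0//.
  by apply: lt_le_trans (truncnS_gt D) _; rewrite ler_nat ltnS.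
have cf z : f k z @[k --> \oo] --> (0 : R).
  apply: (cvg0_le _ k0) => k.
  by rewrite normrM ger0_norm ?powR_ge0// ler_piMr ?powR_ge0// ger0_norm.
have := Rint_dominated_cvg mf fG lG cf.
rewrite [X in _ --> X](_ : _ = 0); last by rewrite /Rintegral integral0.
(* [f k] belongs to level k + 1, so the threshold is N + 1 and level 0 does not occur. *)
move=> /cvgr0Pnorm_lt/(_ _ eps0)[N _ NP]; exists N.+1 => -[//|k] E F Nk mE mF lE lF EF.
have EF0 : (\int[mu]_x \1_E x) * (\int[mu]_xi \1_F xi) <= \int[mu2]_z \1_(S k.+1) z.
  pose G (z : 'rV[R]_n * 'rV[R]_n) : R := \1_E z.1 * \1_F z.2.
  have mG : measurable_fun setT G.
    apply: measurable_funM; first exact: measurableT_comp (L1_measurable lE) measurable_fst.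
    exact: measurableT_comp (L1_measurable lF) measurable_snd.
  have Gle x xi : `|G (x, xi)| <= \1_E x * \1_F xi by rewrite ger0_norm// mulr_ge0// indicE.
  have -> : (\int[mu]_x \1_E x) * (\int[mu]_xi \1_F xi) = \int[mu2]_z G z.
    rewrite (Rint_fubini1 mG lE lF Gle) mulrC -(RintZ _ lE); apply: Rint_eq => x.
    by rewrite mulrC -(RintZ _ lF).
  apply: Rint_le => //; first exact: (prod_dominated_integrable mG lE lF Gle).
  move=> [x xi]; rewrite /G /= !indicE.
  have [xE|xE] := pselect (E x); last by rewrite [x \in E]memNset// mul0r.
  have [xF|xF] := pselect (F xi); last by rewrite [xi \in F]memNset// mulr0.
  by rewrite !mem_set// ?mulr1//; exact: EF.
apply: le_trans EF0 _; have := NP k Nk; rewrite /f (RintZ _ (lS k.+1)).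
rewrite ger0_norm; last first.
  by rewrite mulr_ge0 ?powR_ge0//; apply: Rintegral_ge0.
rewrite powRN mulrC ltr_pdivrMr ?powR_gt0//; exact: ltW.
Qed.

End phase_volume.

(** * From the counting bound to eigenvalue growth *)

Section eigenvalue_growth.
Context {R : realType}.

Lemma powRVK (s y : R) : 0 < s -> 0 <= y -> (y `^ s) `^ s^-1 = y.
Proof. by move=> s0 y0; rewrite -powRrM mulfV ?gt_eqF// powRr1. Qed.

Lemma growth_of_counting_bound (lam : nat -> R) (s : R) :
  (forall i j : nat, (1 <= i)%N -> (i <= j)%N -> lam i <= lam j) -> 0 < s ->
  (forall eps : R, 0 < eps -> exists2 c : R, 0 <= c & forall j : nat, (1 <= j)%N ->
     j%:R <= eps * (`|lam j| + c) `^ s) ->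
  forall (r : R) (L : nat), s <= r -> exists L0 : nat, forall j : nat, (1 <= j)%N ->
    (L0 <= j)%N -> L%:R * j%:R `^ (1 / r) <= lam j.
Proof.
move=> mono s0 bound r L sr.
(* Chosen so that the counting bound becomes (L + 1) j^(1/s) <= |lam j| + c; L + 1 rather than L
   leaves one spare copy of j^(1/s). *)
pose eps : R := (L.+1%:R `^ s)^-1.
have L0 : 0 < L.+1%:R `^ s :> R by rewrite powR_gt0.
have [|c c0 cP] := bound eps; first by rewrite invr_gt0.
pose D := c + `|lam 1%N| + 1; exists (Num.truncn (D `^ s)).+1 => j j1 Dj.
have s'0 : 0 < s^-1 by rewrite invr_gt0.
have D0 : 0 <= D by rewrite addr_ge0// addr_ge0.
have jD : D < j%:R `^ s^-1.
  rewrite -[ltLHS](powRVK s0 D0); apply: gt0_ltr_powR; rewrite ?nnegrE ?powR_ge0//.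
  by apply: lt_le_trans (truncnS_gt _) _; rewrite ler_nat.
have jl : L.+1%:R * j%:R `^ s^-1 <= `|lam j| + c.
  have := cP j j1; rewrite /eps ler_pdivlMl// => jle.
  have lc0 : 0 <= `|lam j| + c by rewrite addr_ge0.
  rewrite -[leRHS](powRVK s0 lc0) -[X in X * _](powRVK s0 (ler0n _ _)).
  rewrite -powRM ?powR_ge0//; apply: ge0_ler_powR => //; rewrite ?nnegrE ?powR_ge0//.
  exact: ltW.
have jr : j%:R `^ (1 / r) <= j%:R `^ s^-1.
  rewrite div1r; apply: ler_powR; rewrite ?ler1n// lef_pV2 ?posrE//.
  exact: lt_le_trans s0 sr.
(* The spare j^(1/s) exceeds D and so absorbs c, |lam 1| and 1. *)
have lj : L%:R * j%:R `^ s^-1 + `|lam 1%N| + 1 <= `|lam j|.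
  by move: jl; rewrite -natr1 mulrDl mul1r /D in jD *; lra.
apply: (@le_trans _ _ (L%:R * j%:R `^ s^-1)); first by rewrite ler_wpM2l.
(* If lam j <= 0, monotonicity gives lam 1 <= lam j <= 0, hence |lam j| <= |lam 1|, against [lj].
   Large eigenvalues in absolute value are therefore positive. *)
have lam0 : 0 < lam j.
  rewrite real_ltNge ?num_real//; apply/negP => lj0.
  have l1 := mono _ _ (leqnn 1) j1.
  have p0 : 0 <= L%:R * j%:R `^ s^-1 :> R by rewrite mulr_ge0 ?powR_ge0.
  by move: lj; rewrite !ler0_norm//; lra.
by move: lj; rewrite (gtr0_norm lam0); have := normr_ge0 (lam 1%N); lra.
Qed.

End eigenvalue_growth.

Lemma elliptic_sublevel_bounded (R : realType) (n : nat) (f : 'rV[R]_n -> R) (del C Lam : R) :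
  0 < del -> 0 < C -> (forall x, C * (1 + enorm x) `^ del <= f x) ->
  exists B : R, forall x, f x <= Lam -> `|x| <= B.
Proof.
move=> del0 C0 fC; exists ((Lam / C) `^ del^-1) => x fx.
have n0 : 0 <= 1 + enorm x by rewrite addr_ge0// sqrtr_ge0.
apply: (@le_trans _ _ (1 + enorm x)).
  by rewrite (le_trans (norm_le_enorm x))// lerDr.
have le : (1 + enorm x) `^ del <= Lam / C.
  by rewrite ler_pdivlMr// mulrC (le_trans (fC x)).
rewrite -[leLHS](powRVK del0 n0); apply: ge0_ler_powR => //; rewrite ?nnegrE ?powR_ge0//.
  by rewrite invr_ge0 ltW.
exact: le_trans (powR_ge0 _ _) le.
Qed.

Theorem mainTheorem3 (R : realType) (n : nat) (gam kap : R)
    (A V : 'rV[R]_n -> R) (q mu r : R)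
    (H : ('rV[R]_n -> R[i]) -> ('rV[R]_n -> R[i]) -> Prop) (lam : nat -> R)
    (gam_gt0 : 0 < gam) (kap_gt0 : 0 < kap)
    (A_gam : tau_function gam A) (V_kap : tau_function kap V)
    (q_gt0 : 0 < q) (q_ge1 : forall x xi, 1 <= q + V x + A xi)
    (C1 : [/\ smooth A, smooth V &
           symbol_class gam kap q A V 1 (fun x xi => A xi + V x)])
    (C2 : exists delta C : R, [/\ 0 < delta, 0 < C &
           forall x xi, C * (1 + enorm x + enorm xi) `^ delta <= q + V x + A xi])
    (mu_gt0 : 0 < mu)
    (C3 : (\int[lebesgue_rV n]_x \int[lebesgue_rV n]_xi
             ((q + V x + A xi) `^ (- mu))%:E < +oo)%E)
    (r_ge_mu : mu <= r)
    (H_AV : selfadjoint_determined_by (AD_plus_V A V) H)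
    (lam_H : eigenvalue_sequence H lam) :
  forall L : nat, exists L0 : nat, forall j : nat, (1 <= j)%N -> (L0 <= j)%N ->
    L%:R * j%:R `^ (1 / r) <= lam j.
Proof.
have [cA cV] : continuous A /\ continuous V.
  by have [_ cA _] := A_gam; have [_ cV _] := V_kap.
have [CA [pA [_ gA]]] := tau_function_growth A_gam.
have [CV [pV [_ gV]]] := tau_function_growth V_kap.
have [del [C [del0 C0 aC]]] := C2.
(* With these shifts V + q1 and A + q2 are the restrictions of a to xi = 0 and to x = 0, so they
   inherit positivity and the growth in C2. *)
pose q1 := q + A 0; pose q2 := q + V 0.
have e00 : enorm (0 : 'rV[R]_n) = 0.
  rewrite /enorm (_ : dotv _ _ = 0) ?sqrtr0// /dotv big1// => i _.
  by rewrite !mxE mul0r.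
have VE x : V x + q1 = q + V x + A 0 by rewrite /q1; ring.
have AE xi : A xi + q2 = q + V 0 + A xi by rewrite /q2; ring.
have V0 x : 0 <= V x + q1 by rewrite VE (le_trans ler01).
have A0 xi : 0 <= A xi + q2 by rewrite AE (le_trans ler01).
pose E (Lam : R) := [set x | V x + q1 <= Lam]; pose F (Lam : R) := [set xi | A xi + q2 <= Lam].
have mE (Lam : R) : measurable (E Lam) by exact: measurable_sublevel.
have mF (Lam : R) : measurable (F Lam) by exact: measurable_sublevel.
have lE (Lam : R) : L1 (lebesgue_rV n) (\1_(E Lam)).
  have [|B EB] := @elliptic_sublevel_bounded R n (fun x => V x + q1) del C Lam del0 C0.
    by move=> x; rewrite VE; have := aC x 0; rewrite e00 addr0.
  exact: L1_indic_bounded (mE Lam) EB.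
have lF (Lam : R) : L1 (lebesgue_rV n) (\1_(F Lam)).
  have [|B FB] := @elliptic_sublevel_bounded R n (fun x => A x + q2) del C Lam del0 C0.
    by move=> xi; rewrite AE; have := aC 0 xi; rewrite e00 addr0.
  exact: L1_indic_bounded (mF Lam) FB.
(* a(x, xi) = (V x + q1) + (A xi + q2) - a(0, 0), and a(0, 0) >= 1 may be dropped. *)
have EF Lam x xi : E Lam x -> F Lam xi -> q + V x + A xi <= 2 * Lam.
  rewrite /E /F /= => xE xF; have := q_ge1 0 0; move: xE xF; rewrite /q1 /q2; lra.
have [sH Hcl] := H_AV.
have [f [ef of_]] := orthonormal_eigenfunctions sH lam_H.
have [mono _] := lam_H.
pose Q := `|q1| + 2 * `|q2|.
have Q0 : 0 <= Q by rewrite addr_ge0// mulr_ge0.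
(* By monotonicity |lam 1| + |lam J| bounds |lam i| for 1 <= i <= J, so one cutoff serves all J
   eigenfunctions. *)
pose Lam J := 32 * (`|lam 1%N| + `|lam J| + 1 + 2 * Q).
pose W J := (\int[lebesgue_rV n]_x \1_(E (Lam J)) x) *
  (\int[lebesgue_rV n]_xi \1_(F (Lam J)) xi).
have count (J : nat) : (1 <= J)%N -> J%:R <= 32 * W J.
  move=> J1; pose e i := f i.+1.
  have oe : orthonormal J e.
    split=> [i iJ|i j iJ jJ]; last by rewrite of_.
    by have [] := eigenfunction_finite_norm sH (ef i.+1 isT).
  have mass (i : 'I_J) : true -> 1 <= 16 * phase_mass (E (Lam J)) (F (Lam J)) (e i).
    move=> _; have ei := ef i.+1 isT.
    apply: (eigenfunction_phase_mass cA cV gA gV V0 A0 (lE _) (lF _) ((Hcl _ _).1 ei)).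
      have l1 := mono 1%N i.+1 isT isT; have lJ := mono i.+1 J isT (ltn_ord i).
      rewrite ler_norml; apply/andP; split.
        by have := ler_norm (- lam 1%N); rewrite normrN; have := normr_ge0 (lam J); lra.
      by have := ler_norm (lam J); have := normr_ge0 (lam 1%N); lra.
    by rewrite of_// eqxx.
  (* Each mass is at least 1/16 and the masses add up to at most 2 |E| |F|; hence the constant
     32. *)
  have := ler_sum (index_enum 'I_J) mass; rewrite sumr_const card_ord -mulr_sumr => le1.
  have := phase_mass_bessel (mE (Lam J)) (lE (Lam J)) (lF (Lam J)) oe.
  rewrite -mulrA -/(W J); lra.
move=> L; apply: (growth_of_counting_bound mono mu_gt0 _ L r_ge_mu) => eps eps0.
(* The denominator compensates for the 32 of [count] and for the bound k <= 64 Y below, where 64 = 2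
   * 32. *)
have eps'0 : 0 < eps / (32 * 64 `^ mu) by rewrite divr_gt0// mulr_gt0// powR_gt0.
have [N NP] := sublevel_volume_small cA cV q_ge1 mu_gt0 C3 eps'0.
(* The term N + 1 absorbs both the rounding to an integer level and the requirement N <= k, so the
   bound holds for every J >= 1. *)
exists (`|lam 1%N| + 1 + 2 * Q + N.+1%:R) => [|J J1].
  by rewrite !addr_ge0// mulr_ge0.
apply: le_trans (count J J1) _.
(* k is an integer level above both 2 Lam J and N. *)
set Y := _ + (_ + _); pose k := (Num.truncn (2 * Lam J) + N).+1.
have Lam0 : 0 <= 2 * Lam J by rewrite !mulr_ge0// !addr_ge0// mulr_ge0.
have kge : 2 * Lam J <= k%:R.
  by rewrite ltW// (lt_le_trans (truncnS_gt _))// ler_nat ltnS leq_addr.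
have kle : k%:R <= 64 * Y.
  have tl : (Num.truncn (2 * Lam J))%:R <= 2 * Lam J by rewrite truncn_le.
  rewrite /k /Y -addnS natrD; move: tl; rewrite {2}/Lam.
  have : 0 <= N.+1%:R :> R by [].
  clear; lra.
have Y0 : 0 <= Y by rewrite -(pmulr_rge0 _ (ltr0n _ 64)) (le_trans _ kle).
have Wle : W J <= eps / (32 * 64 `^ mu) * k%:R `^ mu.
  apply: NP => //; first by rewrite /k ltnW// ltnS leq_addl.
  by move=> x xi xE xF; exact: le_trans (EF _ _ _ xE xF) kge.
have kY : k%:R `^ mu <= 64 `^ mu * Y `^ mu.
  rewrite -powRM//; apply: ge0_ler_powR; rewrite ?nnegrE//; first exact: ltW.
  by rewrite mulr_ge0.
apply: (@le_trans _ _ (32 * (eps / (32 * 64 `^ mu) * (64 `^ mu * Y `^ mu)))).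
  by rewrite ler_pM2l//; apply: le_trans Wle _; rewrite ler_pM2l.
rewrite le_eqVlt; apply/orP; left; apply/eqP; field.
by rewrite gt_eqF// powR_gt0.
Qed.
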